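(* Let $X,X_1,X_2,\dots$ be i.i.d. real random variables with distribution function $F$ and tail quantile function $U$. Assume that $U\in2\mathrm{RV}_{\gamma,\rho}$ with $0<\gamma<1/2$, $\rho\le0$ and auxiliary function $A(t)$. Further assume that $\tau_n\to1$, $n(1-\tau_n)\to\infty$ as $n\to\infty$, and that, for an estimator $\widehat\gamma$ of $\gamma$ based on $X_1,\dots,X_n$, $$\sqrt{n(1-\tau_n)}\left(\widehat\gamma-\gamma,\ \frac{\widehat q_{\tau_n}}{q_{\tau_n}}-1\right)\overset{d}{\longrightarrow}(\Gamma,\Theta)$$ for some random vector $(\Gamma,\Theta)$. If $\sqrt{n(1-\tau_n)}\,q_{\tau_n}^{-1}\to\lambda_1\in\mathbb{R}$ and $\sqrt{n(1-\tau_n)}\,A((1-\tau_n)^{-1})\to\lambda_2\in\mathbb{R}$, then, as $n\to\infty$, $$\sqrt{n(1-\tau_n)}\left(\frac{\widehat{dev}_{\tau_n}}{dev_{\tau_n}}-1\right)\overset{d}{\longrightarrow}m(\gamma)\Gamma+\Theta-(\lambda_1\xi_1+\lambda_2\xi_2),$$ where $$m(\gamma)=-\log(\gamma^{-1}-1)+\frac1{1-\gamma}+\frac1{1-2\gamma}.$$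
   Context: For $\tau\in(0,1)$, $q_\tau=\inf\{x:F(x)\ge\tau\}$. Write $x_+=\max\{x,0\}$, $x_-=-\min\{x,0\}$. The expectile is $e_\tau=\arg\min_{x\in\mathbb{R}}E[\tau(X-x)_+^2+(1-\tau)(X-x)_-^2]$, and the adjusted standard-deviatile (deviatile) is $$dev_\tau=dev_\tau(X)=\Big(\tfrac{\tau}{1-\tau}E[(X-e_\tau)_+^2]+E[(X-e_\tau)_-^2]\Big)^{1/2}.$$ The tail quantile function is $U(t)=F^{\leftarrow}(1-1/t)$, with $F^{\leftarrow}$ the left-continuous inverse of $F$. A measurable, eventually positive function $f$ is in $2\mathrm{RV}_{\gamma,\rho}$ ($\rho\le0$) with auxiliary function $A$ if $A$ is ultimately positive or ultimately negative, $A(t)\to0$, and $\lim_{t\to\infty}\frac{f(tx)/f(t)-x^\gamma}{A(t)}=x^\gamma\int_1^xu^{\rho-1}du$ for all $x>0$ (the integral being $\log x$ when $\rho=0$). Order statistics: $X_{1,n}\le\dots\le X_{n,n}$. Estimators: $$\widehat q_{\tau_n}=X_{n-\lfloor n(1-\tau_n)\rfloor,n},\qquad \widehat\beta_\gamma=\frac{(\widehat\gamma^{-1}-1)^{-\widehat\gamma}}{\sqrt{1-2\widehat\gamma}},\qquad \widehat{dev}_{\tau_n}=\widehat\beta_\gamma\,\widehat q_{\tau_n}.$$ Constants: $$\xi_1=(2\gamma-1)(\gamma^{-1}-1)^{\gamma}E(X),\qquad \xi_2=\frac{(\gamma^{-1}-1)^{-\rho}(2-3\gamma-\rho)}{(1-\rho-2\gamma)(1-\rho-\gamma)}+\frac{(\gamma^{-1}-1)^{-\rho}-1}{\rho},$$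 where the last fraction is read as $-\log(\gamma^{-1}-1)$ when $\rho=0$. *)

(* Defs.v *)
(* MathComp-Analysis *)
From HB Require Import structures.
From mathcomp Require Import all_boot all_order all_algebra.
From mathcomp Require Import all_classical all_reals all_analysis.

Set Implicit Arguments.
Unset Strict Implicit.
Unset Printing Implicit Defensive.

Import Order.TTheory GRing.Theory Num.Theory.
Import numFieldNormedType.Exports.

Local Open Scope classical_set_scope.
Local Open Scope ring_scope.

Section Probability.
Context d (T : measurableType d) (R : realType) (P : probability T R).

Definition mutually_independent (X : nat -> {RV P >-> R}) : Prop :=
  forall (s : seq nat) (B : nat -> set R), uniq s ->
    (forall i, measurable (B i)) ->
    P (\bigcap_(i in [set` s]) (X i @^-1` B i)) =
    (\prod_(i <- s) P (X i @^-1` B i))%E.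

Definition identically_distributed (X : nat -> {RV P >-> R}) : Prop :=
  forall (i j : nat) (B : set R), measurable B ->
    distribution P (X i) B = distribution P (X j) B.

Definition iid (X : nat -> {RV P >-> R}) : Prop :=
  mutually_independent X /\ identically_distributed X.

(* Left-continuous inverse of the distribution function of X; [inf] is the
   actual infimum for tau in (0, 1), and the junk value 0 when the set is empty
   or unbounded below. *)
Definition quantile (X : {RV P >-> R}) (tau : R) : R :=
  inf [set x : R | (tau%:E <= cdf X x)%E].

Definition tail_quantile (X : {RV P >-> R}) (t : R) : R :=
  quantile X (1 - t^-1).

(* [f^\+] and [f^\-] are the nonnegative functions max(f, 0) and
   max(-f, 0) = -min(f, 0). *)
Definition expectile_loss (X : {RV P >-> R}) (tau x : R) : \bar R :=
  'E_P[(fun w => (tau * ((X \- cst x)^\+ w) ^+ 2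
                 + (1 - tau) * ((X \- cst x)^\- w) ^+ 2)%R)]%E.

(* The minimizer is unique when tau is in (0, 1) and X has a finite second
   moment; 0 is returned only if there is no minimizer. *)
Definition expectile (X : {RV P >-> R}) (tau : R) : R :=
  xget 0 [set x : R |
    forall y : R, (expectile_loss X tau x <= expectile_loss X tau y)%E].

Definition deviatile (X : {RV P >-> R}) (tau : R) : R :=
  let e := expectile X tau in
  Num.sqrt (tau / (1 - tau) * fine 'E_P[(fun w => (((X \- cst e)^\+ w) ^+ 2)%R)]%E
            + fine 'E_P[(fun w => (((X \- cst e)^\- w) ^+ 2)%R)]%E).

(* X_{k,n}, the k-th smallest (1 <= k <= n) of X 1 w, ..., X n w. *)
Definition order_stat (X : nat -> {RV P >-> R}) (k n : nat) (w : T) : R :=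
  nth 0 (sort <=%O [seq X i w | i <- iota 1 n]) k.-1.

Definition quantile_estimator (X : nat -> {RV P >-> R}) (tau : R) (n : nat)
    (w : T) : R :=
  order_stat X (n - Num.truncn (n%:R * (1 - tau)))%N n w.

End Probability.

(* Weak convergence of the laws of the Y_ n (on T) to the law of Y (on a
   possibly different space T'), tested on bounded continuous functions. *)
Definition cvg_in_distribution d d' (T : measurableType d)
    (T' : measurableType d') (R : realType) (P : probability T R)
    (P' : probability T' R) (V : topologicalType) (Y_ : nat -> T -> V)
    (Y : T' -> V) : Prop :=
  forall f : V -> R, continuous f -> (exists M : R, forall v, `|f v| <= M) ->
    'E_P[f \o Y_ n]%E @[n --> \oo] --> 'E_P'[f \o Y]%E.

Section RegularVariation.
Context (R : realType).

Definition oriented_integral (a b : R) (f : R -> R) : R :=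
  if a <= b then \int[lebesgue_measure]_(u in `[a, b]) f u
  else - \int[lebesgue_measure]_(u in `[b, a]) f u.

Definition second_order_RV (gamma rho : R) (A f : R -> R) : Prop :=
  [/\ rho <= 0,
      measurable_fun (`]0, +oo[ : set R) f /\ (\forall t \near +oo, 0 < f t),
      (\forall t \near +oo, 0 < A t) \/ (\forall t \near +oo, A t < 0),
      A t @[t --> +oo] --> 0 &
      forall x : R, 0 < x ->
        (f (t * x) / f t - x `^ gamma) / A t @[t --> +oo] -->
        x `^ gamma * oriented_integral 1 x (fun u => u `^ (rho - 1))].

Definition beta_coef (gamma : R) : R :=
  (gamma^-1 - 1) `^ (- gamma) / Num.sqrt (1 - 2 * gamma).

Definition xi1 (gamma mean : R) : R :=
  (2 * gamma - 1) * (gamma^-1 - 1) `^ gamma * mean.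

Definition xi2 (gamma rho : R) : R :=
  (gamma^-1 - 1) `^ (- rho) * (2 - 3 * gamma - rho)
    / ((1 - rho - 2 * gamma) * (1 - rho - gamma))
  + (if rho == 0 then - ln (gamma^-1 - 1)
     else ((gamma^-1 - 1) `^ (- rho) - 1) / rho).

Definition m_coef (gamma : R) : R :=
  - ln (gamma^-1 - 1) + (1 - gamma)^-1 + (1 - 2 * gamma)^-1.

End RegularVariation.

Definition deviatile_estimator d (T : measurableType d) (R : realType)
    (P : probability T R) (X : nat -> {RV P >-> R}) (gamma_hat tau : R)
    (n : nat) (w : T) : R :=
  beta_coef gamma_hat * quantile_estimator X tau n w.

(* Main.v *)
(* On the logarithmic scale l s = ln U(e^s) - gamma s, the second-order condition
   says l (s + u) - l s ~ a s * h u with h u = (e^(rho u) - 1) / rho (h u = u if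
   rho = 0); by a Steinhaus-Egorov argument this holds uniformly on compact u-sets.
   If 1 - F(x) = e^(-s), then the law of X above x is that of U(e^(s + u)), u > 0
   standard exponential, conditionally on the excess of x; hence the partial moments
   of X above x admit expansions with the explicit constants of the exponential law.
   The deviatile only depends on these moments at x = e_tau through the first-order
   condition for the expectile, which also determines ln (1 - tau) + s.  This gives
   the deterministic limit of sqrt(n(1 - tau_n)) (beta_gamma q_tau / dev_tau - 1).
   The estimation errors of gamma and q_tau enter through a delta method, for which
   it suffices that the linearization is uniform on bounded sets of the pair. *)
Require Import Defs.
From HB Require Import structures.
From mathcomp Require Import all_boot all_order all_algebra.
From mathcomp Require Import all_classical all_reals all_analysis.
From mathcomp Require Import measurable_realfun ring lra.

Set Implicit Arguments.
Unset Strict Implicit.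
Unset Printing Implicit Defensive.

Import Order.TTheory GRing.Theory Num.Theory.
Import numFieldNormedType.Exports.

Local Open Scope classical_set_scope.
Local Open Scope ring_scope.


(** * Uniform convergence for regularly varying increments *)

(** [A] is not assumed measurable, whereas the Steinhaus-Egorov argument has to be applied to the
    logarithm of the normalising function as well as to l. So [A] is replaced by an equivalent
    increment quotient of l, which inherits measurability from U. F may have jumps and flat pieces.
    The exponential representation survives both, but if 1 - F(e) = e^(-s) and F is flat to the left
    of e, then U(e^s) is strictly below e. Since e lies between U(e^s) and U(e^(s + v)) for every v
    > 0, the log-ratio of e and U(e^s) is o(a(s)) and leaves no trace in the limit. The number
    gamma^-1 - 1 is the limit of (1 - F(e_tau)) / (1 - tau), forced by the first-order condition.
    The lambda1 part of the bias comes from the terms E(X) / e in that condition and in the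
    deviatile, the lambda2 part from the second-order behaviour of U; terms of order 1 - tau
    disappear because q_tau (1 - tau) tends to 0. Finite second moments are derived: gamma < 1/2
    controls the right tail and [X_neg2] the left one. *)

Lemma lebesgue_measure_translation (R : realType) (u : R)
    (A : set (measurableTypeR R)) :
  measurable A ->
  lebesgue_measure [set y : R | A (y - u)] = lebesgue_measure A.
Proof.
move=> mA.
have mf : measurable_fun setT (fun y : measurableTypeR R => y - u : measurableTypeR R).
  exact: measurable_funB.
pose f := (fun y : measurableTypeR R => y - u : measurableTypeR R).
pose m := pushforward (@lebesgue_measure R) f.
suff -> : lebesgue_measure A = m A by [].
apply: lebesgue_measure_unique => // _ [[a b]] _ <-.
transitivity (lebesgue_measure (f @^-1` `]a, b]%classic)); last by [].
have -> : f @^-1` `]a, b]%classic = `]a + u, b + u]%classic.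
  apply/seteqP; split => y; rewrite /f /= !in_itv/=; lra.
rewrite !lebesgue_measure_itv/= !lte_fin ltrD2r.
by case: ifP => // _; rewrite -!EFinB; congr EFin; ring.
Qed.

Lemma uniform_near (R : realType) (A : set R) (f : nat -> R -> R) (g : R -> R) (e : R) :
  {uniform A, f @ \oo --> g} -> 0 < e ->
  \forall n \near \oo, forall y, A y -> `|f n y - g y| < e.
Proof.
move=> H e0.
have := H (fun h => forall y, A y -> `|h y - g y| < e).
apply.
apply/uniform_nbhs; exists [set xy | `|xy.2 - xy.1| < e]; split.
  rewrite -entourage_from_ballE; exists e => //= [[x y]] /=.
  by rewrite distrC.
by move=> h /= hA y Ay; exact: (hA y Ay).
Qed.

(* Steinhaus-type argument: two subsets of [0, 2b] of large measure still
   meet after one of them is shifted by u in [0, b]. *)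
Lemma shifted_sets_meet (R : realType) (b u : R) (V W : set (measurableTypeR R)) :
  0 < b -> 0 <= u <= b -> measurable V -> measurable W ->
  V `<=` `[0, 2 * b] -> W `<=` `[0, 2 * b] ->
  ((3 * b)%:E < lebesgue_measure V + lebesgue_measure W)%E ->
  exists y, W y /\ V (u + y).
Proof.
move=> b0 /andP[u0 ub] mV mW Vb Wb; apply: contraPP => /forallNP H.
apply/negP; rewrite -leNgt.
pose W' := [set y : measurableTypeR R | W (y - u)].
have mW' : measurable W'.
  rewrite -[W']setTI.
  have mf : measurable_fun setT (fun y : measurableTypeR R => y - u : measurableTypeR R).
    exact: measurable_funB.
  exact: mf.
rewrite -(lebesgue_measure_translation u mW).
rewrite -[X in (_ + X <= _)%E]/(lebesgue_measure W').
rewrite -measureU//; last first.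
  apply/seteqP; split => // y [Vy W'y]; apply: (H (y - u)); split => //.
  by rewrite addrC subrK.
(* Without a common point, V and the translate of W by u are disjoint subsets of [0, 3b], since u <=
   b. *)
have -> : (3 * b)%:E = lebesgue_measure (`[0, 3 * b]%classic : set R).
  by rewrite lebesgue_measure_itv/= lte_fin ifT ?oppr0 ?adde0//; lra.
apply: le_measure; rewrite ?inE//; first exact: measurableU.
by move=> y [/Vb|/Wb]; rewrite /= !in_itv/=; lra.
Qed.

(** Egorov with an exceptional set of measure below b/4. The bound 3b/2 is chosen so that two such
    sets have total measure above 3b, as [shifted_sets_meet] requires. *)
Lemma Egorov_itv (R : realType) (b eta : R) (f : nat -> R -> R) (g : R -> R) :
  0 < b -> 0 < eta -> (forall n, measurable_fun setT (f n)) ->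
  (forall y : R, 0 <= y -> f n y @[n --> \oo] --> g y) ->
  exists V : set R, [/\ measurable V, V `<=` `[0, 2 * b],
    ((3 / 2 * b)%:E < lebesgue_measure V)%E &
    \forall n \near \oo, forall y, V y -> `|f n y - g y| < eta].
Proof.
move=> b0 eta0 mf fg.
pose A : set (measurableTypeR R) := `[0, 2 * b]%classic.
have Alt : (lebesgue_measure A < +oo)%E.
  by rewrite lebesgue_measure_itv/=; case: ifP => //; rewrite -EFinB ltry.
have mfA n : measurable_fun A (f n) by exact: measurable_funS (mf n).
have fgA y : A y -> f n y @[n --> \oo] --> g y.
  by rewrite /A/= in_itv/= => /andP[y0 _]; exact: fg.
have b4 : 0 < b / 4 by rewrite divr_gt0.
have [B [mB Bb Bu]] := pointwise_almost_uniform mfA (measurable_itv _) Alt fgA b4.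
have mA : measurable A by exact: measurable_itv.
have mAB : measurable (A `\` B) by exact: measurableD.
exists (A `\` B); split.
- exact: mAB.
- by move=> y [].
- have mAE : lebesgue_measure A = (2 * b)%:E.
    by rewrite lebesgue_measure_itv/= lte_fin ifT ?oppr0 ?adde0//; lra.
  have : ((2 * b)%:E <= lebesgue_measure (A `\` B) + lebesgue_measure B)%E.
    rewrite -mAE; apply: (le_trans _ (measureU2 _ mAB mB)).
    apply: le_measure; rewrite ?inE//; first exact: measurableU.
    by move=> y Ay; have [By|By] := pselect (B y); [right | left].
  move=> H; rewrite ltNge; apply/negP => H2.
  have : ((2 * b)%:E < (3 / 2 * b)%:E + (b / 4)%:E)%E.
    apply: (le_lt_trans H); apply: lee_ltD => //.
    rewrite ge0_fin_numE//; apply: le_lt_trans Alt.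
    by apply: le_measure; rewrite ?inE.
  rewrite -EFinD lte_fin; lra.
- exact: uniform_near Bu eta0.
Qed.

(** A failure of uniformity yields bad pairs (s n, u n); the pointwise limits are then uniform on
    large sets along both s n and s n + u n. The weight [theta] allows two uses: increments of l
    normalised by a, and increments of ln |a| normalised by 1. *)
Lemma uniform_convergence (R : realType) (f c k theta : R -> R) (b K : R) :
  0 < b -> measurable_fun setT f ->
  (\forall s \near +oo, c s != 0) ->
  (forall u : R, 0 <= u -> (f (s + u) - f s) / c s @[s --> +oo] --> k u) ->
  (forall e : R, 0 < e -> \forall s \near +oo, forall u : R, 0 <= u <= b ->
     `|c (s + u) / c s - theta u| <= e) ->
  (forall u y : R, 0 <= u -> 0 <= y -> k (u + y) = k u + theta u * k y) ->
  (forall u : R, 0 <= u <= 2 * b -> `|k u| <= K) ->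
  (forall u : R, 0 <= u <= b -> `|theta u| <= K) ->
  forall e : R, 0 < e -> \forall s \near +oo, forall u : R, 0 <= u <= b ->
     `|f (s + u) - f s - c s * k u| <= e * `|c s|.
Proof.
move=> b0 mf cN0 fk cth kD kK thK e e0.
have K0 : 0 <= K by apply: le_trans (thK 0 _) => //; rewrite lexx ltW.
(* The total error is eta |c(s)| (1 + (K + 1) + K), where |c(s + u)| <= (K + 1) |c(s)| because eta
   <= 1. *)
pose eta := Num.min 1 (e / (2 + 2 * K)).
have eta0 : 0 < eta by rewrite lt_min ltr01 divr_gt0//; lra.
have eta1 : eta <= 1 by rewrite ge_min lexx.
have etae : eta * (2 + 2 * K) <= e.
  by rewrite -ler_pdivlMr ?ge_min ?lexx ?orbT//; lra.
apply: contrapT => H.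
have bad n : exists su : R * R, [/\ n%:R <= su.1, 0 <= su.2 <= b &
    e * `|c su.1| < `|f (su.1 + su.2) - f su.1 - c su.1 * k su.2|].
  apply: contrapT => /forallNP Hn; apply: H.
  near=> s => u ub; rewrite leNgt; apply/negP => Hs; apply: (Hn (s, u)).
  by split => //=; near: s; apply: nbhs_pinfty_ge; rewrite num_real.
have [su suP] := choice bad.
pose s n := (su n).1; pose u n := (su n).2.
have sy : s n @[n --> \oo] --> +oo.
  apply/cvgryPge => M; near=> n; have [+ _ _] := suP n; apply: le_trans.
  by near: n; exact: nbhs_infty_ger.
have ub n : 0 <= u n <= b by have [] := suP n.
have suy : s n + u n @[n --> \oo] --> +oo.
  apply/cvgryPge => M; near=> n; have [+ /andP[+ _] _] := suP n.
  move=> h1 h2; apply: (le_trans _ (lerD h1 h2)); rewrite addr0.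
  by near: n; exact: nbhs_infty_ger.
have mfs (t : R) : measurable_fun setT (fun y => (f (t + y) - f t) / c t).
  apply: measurable_funM => //; apply: measurable_funB => //.
  by apply: (measurableT_comp mf); exact: measurable_funD.
have [V [mV Vb Vm Vu]] := @Egorov_itv R b eta (fun n y => (f (s n + y) - f (s n)) / c (s n)) k
  b0 eta0 (fun n => mfs _) (fun y y0 => cvg_comp _ _ sy (fk y y0)).
have [W [mW Wb Wm Wu]] := @Egorov_itv R b eta
  (fun n y => (f (s n + u n + y) - f (s n + u n)) / c (s n + u n)) k
  b0 eta0 (fun n => mfs _) (fun y y0 => cvg_comp _ _ suy (fk y y0)).
near \oo => n.
have cs0 : c (s n) != 0 by near: n; exact: sy cN0.
have csu0 : c (s n + u n) != 0 by near: n; exact: suy cN0.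
have /(_ _ (ub n)) cthn : forall v, 0 <= v <= b -> `|c (s n + v) / c (s n) - theta v| <= eta.
  by near: n; exact: sy (cth _ eta0).
(* The point s + u + y is reached from s, through u + y in V, and from s + u, through y in W;
   subtracting the two increments leaves f(s + u) - f(s). *)
have [|y [Wy Vy]] := @shifted_sets_meet R b (u n) V W b0 (ub n) mV mW Vb Wb.
  apply: (le_lt_trans _ (lteD Vm Wm)).
  by rewrite -EFinD lee_fin; lra.
have y0 : 0 <= y <= 2 * b by have := Wb _ Wy; rewrite /= in_itv.
have h1 : `|f (s n + (u n + y)) - f (s n) - c (s n) * k (u n + y)| <= eta * `|c (s n)|.
  rewrite -ler_pdivrMr ?normr_gt0// -normf_div.
  rewrite mulrBl [c _ * _]mulrC mulfK//; apply: ltW.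
  by move: (u n + y) Vy; near: n.
have h2 : `|f (s n + u n + y) - f (s n + u n) - c (s n + u n) * k y| <= eta * `|c (s n + u n)|.
  rewrite -ler_pdivrMr ?normr_gt0// -normf_div.
  rewrite mulrBl [c _ * k _]mulrC mulfK//; apply: ltW.
  by move: y Wy {y0 Vy h1}; near: n.
have h3 : `|c (s n + u n) - theta (u n) * c (s n)| <= eta * `|c (s n)|.
  by rewrite -ler_pdivrMr ?normr_gt0// -normf_div mulrBl mulfK.
have [_ _] := suP n; apply/negP; rewrite -leNgt -/(s n) -/(u n).
have kE : k (u n + y) = k (u n) + theta (u n) * k y.
  by apply: kD; [case/andP: (ub n)|case/andP: y0].
have thn := thK _ (ub n); have kyn := kK _ y0.
rewrite addrA in h1.
set F1 := f (s n + u n + y) in h1 h2; set F2 := f (s n) in h1 *.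
set F3 := f (s n + u n) in h2 *.
rewrite kE in h1.
set C := c (s n) in h1 h3 *; set C' := c (s n + u n) in h2 h3 *.
set k1 := k (u n) in h1 *; set k2 := k y in h1 h2 kyn *.
set t := theta (u n) in h1 h3 thn *.
have C'le : `|C'| <= (K + eta) * `|C|.
  have -> : C' = (C' - t * C) + t * C by ring.
  apply: (le_trans (ler_normD _ _)); rewrite normrM.
  have := ler_wpM2r (normr_ge0 C) thn; nra.
have -> : F3 - F2 - C * k1 = (F1 - F2 - C * (k1 + t * k2)) - (F1 - F3 - C' * k2)
   - (C' - t * C) * k2 by ring.
apply: (@le_trans _ _ (eta * `|C| + eta * `|C'| + eta * `|C| * K)).
  apply: (le_trans (ler_normB _ _)); apply: lerD.
    by apply: (le_trans (ler_normB _ _)); apply: lerD.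
  by rewrite normrM; apply: ler_pM.
have : eta * `|C'| <= eta * ((K + 1) * `|C|).
  rewrite ler_pM2l//; apply: (le_trans C'le).
  by apply: ler_wpM2r => //; lra.
have := ler_wpM2r (normr_ge0 C) etae; lra.
Unshelve. all: by end_near. Qed.

(** * The limit function of the second-order condition on the logarithmic scale *)

Section box_cox.
Context (R : realType).
Implicit Types (rho u v : R).

Definition box_cox rho u : R :=
  if rho == 0 then u else (expR (rho * u) - 1) / rho.

(** This cocycle identity is the functional equation linking [k] and [theta] in
    [uniform_convergence]. *)
Lemma box_coxD rho u v :
  box_cox rho (u + v) = box_cox rho u + expR (rho * u) * box_cox rho v.
Proof.
rewrite /box_cox; case: eqP => [->|/eqP r0]; first by rewrite mul0r expR0 mul1r.
by rewrite mulrDr expRD; field.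
Qed.

Lemma box_cox_le rho u : rho <= 0 -> 0 <= u -> box_cox rho u <= u.
Proof.
move=> r0 u0; rewrite /box_cox; case: eqP => [//|/eqP rN0].
have rlt : rho < 0 by rewrite lt_neqAle rN0.
rewrite ler_ndivrMr//; have := expR_ge1Dx (rho * u); lra.
Qed.

Lemma box_cox_ge0 rho u : rho <= 0 -> 0 <= u -> 0 <= box_cox rho u.
Proof.
move=> r0 u0; rewrite /box_cox; case: eqP => [//|/eqP rN0].
have rlt : rho < 0 by rewrite lt_neqAle rN0.
rewrite ler_ndivlMr// mul0r subr_le0 -expR0 ler_expR; nra.
Qed.

Lemma box_cox_gt0 rho u : rho <= 0 -> 0 < u -> 0 < box_cox rho u.
Proof.
move=> r0 u0; rewrite /box_cox; case: eqP => [//|/eqP rN0].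
have rlt : rho < 0 by rewrite lt_neqAle rN0.
rewrite ltr_ndivlMr// mul0r subr_lt0 -expR0 ltr_expR; nra.
Qed.

Lemma box_cox_continuous rho : continuous (box_cox rho).
Proof.
move=> u; rewrite /box_cox; case: eqP => [_|rN0]; first exact: cvg_id.
apply: cvgMl; apply: cvgB; last exact: cvg_cst.
apply: (@continuous_comp _ _ _ (fun u => rho * u) expR); last exact: continuous_expR.
exact: mulrl_continuous.
Qed.

Lemma oriented_integral_powR rho u : 0 <= u ->
  oriented_integral 1 (expR u) (fun v => v `^ (rho - 1)) = box_cox rho u.
Proof.
move=> u0; rewrite /oriented_integral ifT; last by rewrite -expR0 ler_expR.
move: u0; rewrite le_eqVlt => /predU1P[<-|u0].
  rewrite expR0 set_itv1 /Rintegral integral_set1/= /box_cox.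
  by case: eqP => // _; rewrite mulr0 expR0 subrr mul0r.
pose F v := if rho == 0 then ln v else expR (rho * ln v) / rho.
have powRE v : 0 < v -> v `^ (rho - 1) = expR ((rho - 1) * ln v).
  by move=> v0; rewrite /powR (gt_eqF v0).
have dF v : 0 < v -> is_derive v 1 F (v `^ (rho - 1)).
  move=> v0; rewrite /F powRE//.
  have dl : is_derive v 1 (@ln R) v^-1 by exact: is_derive1_ln.
  case: (eqVneq rho 0) => [->|rN0].
    by rewrite sub0r mulN1r expRN lnK.
  have -> : expR ((rho - 1) * ln v) = rho^-1 * (expR (rho * ln v) * (rho * v^-1)).
    rewrite mulrBl mul1r expRB lnK//; field; rewrite rN0 gt_eqF//.
  have H : is_derive v 1 (fun v => rho * ln v) (rho * v^-1).
    exact: (is_deriveZ rho dl).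
  have H2 := @is_derive1_comp R expR (fun v => rho * ln v) v _ _ (is_derive_expR _) H.
  have := is_deriveZ rho^-1 H2; congr is_derive.
  by apply/funext => w; exact: mulrC.
have e1 : 1 < expR u by rewrite -expR0 ltr_expR.
have := @continuous_FTC2 R (fun v => v `^ (rho - 1)) F 1 (expR u) e1.
rewrite /Rintegral => ->.
- rewrite -EFinB /= /F /box_cox ln1 expRK; case: eqP => [_|/eqP rN0]; first by rewrite subr0.
  by rewrite mulr0 expR0 -mulrBl.
- apply: derivable_within_continuous => v; rewrite in_itv/= => /andP[v1 _].
  have v0 : 0 < v by lra.
  have dl : is_derive v 1 (@ln R) v^-1 by exact: is_derive1_ln.
  have H := is_deriveZ (rho - 1) dl.
  have H2 := @is_derive1_comp R expR (fun v => (rho - 1) * ln v) v _ _ (is_derive_expR _) H.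
  apply: (near_eq_derivable _ (@ex_derive _ _ _ _ _ _ _ H2)).
  by near=> w; rewrite /= powRE//; near: w; exact: lt_nbhsr.
- split.
  + move=> v; rewrite in_itv/= => /andP[v1 _]; apply: ex_derive.
    by apply: dF; lra.
  + apply: cvg_at_right_filter; apply: differentiable_continuous.
    by apply/derivable1_diffP; apply: ex_derive; apply: dF; lra.
  + apply: cvg_at_left_filter; apply: differentiable_continuous.
    by apply/derivable1_diffP; apply: ex_derive; apply: dF; lra.
- move=> v; rewrite in_itv/= => /andP[v1 _].
  by rewrite derive1E; apply: derive_val; apply: dF; lra.
Unshelve. all: by end_near. Qed.
End box_cox.

Lemma cvg_norm_le0 (R : realType) (T : Type) (F : set_system T) {FF : Filter F}
    (f g : T -> R) :
  (\forall x \near F, `|f x| <= g x) -> g x @[x --> F] --> 0 ->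
  f x @[x --> F] --> 0.
Proof.
move=> fg g0; apply/cvgr0Pnorm_le => e e0.
move/cvgr0Pnorm_le : g0 => /(_ e e0) g0.
near=> x; have fx : `|f x| <= g x by near: x.
by apply: (le_trans fx); apply: (le_trans (ler_norm _)); near: x.
Unshelve. all: by end_near. Qed.

Lemma cvg_near_eq (R : realType) (T : Type) (F : set_system T)
    {FF : Filter F} (f g : T -> R) (l : R) :
  f x @[x --> F] --> l -> (\forall x \near F, f x = g x) ->
  g x @[x --> F] --> l.
Proof. by move=> fl fg; apply: cvg_trans fl; exact: near_eq_cvg. Qed.

(** The lower bound comes from applying ln x <= x - 1 to the inverse of 1 + r. *)
Lemma ln1p_approx (R : realType) (r : R) : `|r| <= 1 / 2 ->
  `|ln (1 + r) - r| <= 2 * r ^+ 2.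
Proof.
move=> r2; have /andP[r2a r2b] : - (1 / 2) <= r <= 1 / 2 by rewrite -ler_norml.
have r0 : 0 < 1 + r by lra.
have h1 : ln (1 + r) <= r by apply: le_ln1Dx; lra.
have h2 : - ln (1 + r) <= (1 + r)^-1 - 1.
  have := @le_ln1Dx R ((1 + r)^-1 - 1); rewrite subrKC lnV ?posrE//; apply.
  have : 0 < (1 + r)^-1 by rewrite invr_gt0.
  lra.
rewrite ler_norml; apply/andP; split; last by have := sqr_ge0 r; lra.
have h3 : (1 + r)^-1 * (1 + r) = 1 by rewrite mulVf// gt_eqF.
have : (1 + r)^-1 - 1 <= - r + 2 * r ^+ 2 by rewrite expr2; nra.
lra.
Qed.

Lemma cvgry_expR (R : realType) : expR s @[s --> +oo] --> (+oo : set_system R).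
Proof.
apply/cvgryPge => M; near=> s; apply: (@le_trans _ _ (1 + s)); last exact: expR_ge1Dx.
have : M <= s by near: s; apply: nbhs_pinfty_ge; rewrite num_real.
lra.
Unshelve. all: by end_near. Qed.

(** With r the relative increment of U after removal of e^(gamma u), the hypothesis says that r / A
    tends to h; hence r tends to 0, and ln (1 + r) - r = O(r^2) is o(A). *)
Lemma ln_second_order (R : realType) (gamma rho : R) (A U : R -> R) (u : R) :
  second_order_RV gamma rho A U -> 0 <= u ->
  (ln (U (expR (s + u))) - gamma * (s + u) - (ln (U (expR s)) - gamma * s))
    / A (expR s) @[s --> +oo] --> box_cox rho u.
Proof.
move=> [rho0 [mU Ugt0] Asgn A0 UA] u0.
have B0 : A (expR s) @[s --> +oo] --> 0 by exact: cvg_comp (@cvgry_expR R) A0.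
have BN0 : \forall s \near +oo, A (expR s) != 0.
  case: Asgn => Asgn; near=> s.
    by rewrite gt_eqF//; near: s; exact: (@cvgry_expR R) _ Asgn.
  by rewrite lt_eqF//; near: s; exact: (@cvgry_expR R) _ Asgn.
have Upos : \forall s \near +oo, 0 < U (expR s) by exact: (@cvgry_expR R) _ Ugt0.
have Upos' : \forall s \near +oo, 0 < U (expR (s + u)).
  have H : s + u @[s --> +oo] --> +oo by exact: cvg_addrr.
  exact: H _ Upos.
pose r s := expR (- gamma * u) * (U (expR s * expR u) / U (expR s)) - 1.
have rB : r s / A (expR s) @[s --> +oo] --> box_cox rho u.
  have := UA _ (expR_gt0 u); rewrite oriented_integral_powR//.
  move=> /(cvg_comp _ _ (@cvgry_expR R)) /=.
  move=> /(@cvgMl_tmp _ _ _ _ _ (expR (- gamma * u))) H.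
  have pE : expR u `^ gamma = expR (gamma * u) by rewrite /powR gt_eqF ?expR_gt0// expRK.
  have eE : expR (- gamma * u) * expR (gamma * u) = 1 by rewrite -expRD mulNr addNr expR0.
  move: H; rewrite pE mulrA eE mul1r => H; apply: (cvg_near_eq H).
  by near=> s => /=; rewrite /r -eE; ring.
have r0 : r s @[s --> +oo] --> 0.
  have H : r s / A (expR s) * A (expR s) @[s --> +oo] --> 0.
    by rewrite -(mulr0 (box_cox rho u)); exact: cvgM.
  apply: (cvg_near_eq H).
  by near=> s => /=; rewrite divfK//; near: s.
have rr : 2 * (`|r s / A (expR s)| * `|r s|) @[s --> +oo] --> 0.
  rewrite -[X in _ --> X](mulr0 2); apply: cvgMr.
  rewrite -[X in _ --> X](mulr0 `|box_cox rho u|); apply: cvgM; first exact: cvg_norm.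
  by rewrite -[X in _ --> X](@normr0 R R); apply: cvg_norm.
have d0 : (ln (1 + r s) - r s) / A (expR s) @[s --> +oo] --> 0.
  apply: cvg_norm_le0 rr; near=> s.
  rewrite !normf_div mulrAC mulrA ler_wpM2r ?invr_ge0//.
  rewrite -normrM -expr2 ger0_norm ?sqr_ge0//; apply: ln1p_approx.
  by near: s; move/cvgr0Pnorm_le : r0; apply; rewrite divr_gt0.
have H : (ln (1 + r s) - r s) / A (expR s) + r s / A (expR s) @[s --> +oo] --> box_cox rho u.
  by rewrite -[X in _ --> X]add0r; exact: cvgD.
apply: (cvg_near_eq H).
near=> s => /=; rewrite -mulrDl subrK; congr (_ / _).
have U1 : 0 < U (expR s) by near: s.
have U2 : 0 < U (expR (s + u)) by near: s.
rewrite /r addrC subrK -expRD lnM ?posrE ?expR_gt0 ?divr_gt0// ln_div ?posrE// expRK.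
ring.
Unshelve. all: by end_near. Qed.

(** * A measurable normalising function with Potter-type bounds *)

Lemma near_pinftyP (R : realType) (P : R -> Prop) :
  (\forall s \near +oo, P s) <-> exists M, forall s, M <= s -> P s.
Proof.
split=> [[M [_ MP]]|[M MP]]; last first.
  by near=> s; apply: MP; near: s; apply: nbhs_pinfty_ge; rewrite num_real.
by exists (M + 1) => s Ms; apply: MP; apply: lt_le_trans Ms; rewrite ltrDl.
Unshelve. all: by end_near. Qed.

Lemma near_pinfty_translate (R : realType) (P : R -> Prop) :
  (\forall s \near +oo, P s) -> \forall s \near +oo, forall u, 0 <= u -> P (s + u).
Proof.
move=> /near_pinftyP[M MP]; apply/near_pinftyP; exists M => s Ms u u0.
by apply: MP; rewrite (le_trans Ms)// lerDl.
Qed.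

Lemma norm_expRB1_le (R : realType) (x : R) : `|expR x - 1| <= `|x| * expR `|x|.
Proof.
have [x0|x0] := leP 0 x.
  rewrite !ger0_norm//; last by rewrite subr_ge0 -expR0 ler_expR.
  have h1 : 1 - x <= expR (- x) by apply: (le_trans _ (expR_ge1Dx _)); lra.
  have h2 := expR_gt0 x.
  have := expRxMexpNx_1 x; nra.
rewrite ltr0_norm ?ltr0_norm//; last by rewrite subr_lt0 -expR0 ltr_expR.
have h1 := expR_ge1Dx x.
have h2 : 1 <= expR (- x) by rewrite -expR0 ler_expR; lra.
nra.
Qed.

(** The last clause holds for all u >= 0: its exponential bound supplies a dominating function, and
    its linear bound keeps exponentials of increments of [l] integrable. *)
Definition second_order_aux (R : realType) (rho : R) (l a : R -> R) : Prop :=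
  [/\ a s @[s --> +oo] --> 0,
      \forall s \near +oo, a s != 0,
      forall b e : R, 0 < b -> 0 < e -> \forall s \near +oo, forall u : R,
        0 <= u <= b -> `|l (s + u) - l s - a s * box_cox rho u| <= e * `|a s|,
      forall b e : R, 0 < b -> 0 < e -> \forall s \near +oo, forall u : R,
        0 <= u <= b -> `|a (s + u) / a s - expR (rho * u)| <= e &
      forall d : R, 0 < d -> exists C : R, \forall s \near +oo, forall u : R,
        0 <= u -> `|l (s + u) - l s| <= C * `|a s| * expR (d * u) /\
                  `|l (s + u) - l s| <= d * (u + 1)].

Section second_order.
Context (R : realType) (l B : R -> R) (rho : R).
Hypotheses (rho0 : rho <= 0) (ml : measurable_fun setT l)
  (B0 : B s @[s --> +oo] --> 0)
  (Bsgn : (\forall s \near +oo, 0 < B s) \/ (\forall s \near +oo, B s < 0))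
  (lB : forall u : R, 0 <= u -> (l (s + u) - l s) / B s @[s --> +oo] --> box_cox rho u).

Let c1 := box_cox rho 1.
Let c1_gt0 : 0 < c1. Proof. exact: box_cox_gt0. Qed.
(** Dividing by [c1], the limit of the unit increment over [B], makes [a] equivalent to [B]; being
    built from [l], it is measurable. *)
Let a s := (l (s + 1) - l s) / c1.

Let BN0 : \forall s \near +oo, B s != 0.
Proof.
case: Bsgn => Bsgn'; near=> s.
  by rewrite gt_eqF//; near: s.
by rewrite lt_eqF//; near: s.
Unshelve. all: by end_near. Qed.

Let aB : a s / B s @[s --> +oo] --> (1 : R).
Proof.
have H : c1^-1 * ((l (s + 1) - l s) / B s) @[s --> +oo] --> (1 : R).
  rewrite -[X in _ --> X](@mulVf _ c1) ?gt_eqF//.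
  by apply: cvgMr; exact: lB.
by apply: (cvg_near_eq H); near=> s; rewrite /a; ring.
Unshelve. all: by end_near. Qed.

Let a0 : a s @[s --> +oo] --> 0.
Proof.
have H : a s / B s * B s @[s --> +oo] --> 0.
  by rewrite -[X in _ --> X](mulr0 (1 : R)); exact: cvgM.
by apply: (cvg_near_eq H); near=> s; rewrite divfK//; near: s.
Unshelve. all: by end_near. Qed.

Let aBpos : \forall s \near +oo, 0 < a s / B s.
Proof. by apply: (cvgr_gt 1 aB); rewrite ltr01. Qed.

Let asgn : (\forall s \near +oo, 0 < a s) \/ (\forall s \near +oo, a s < 0).
Proof.
case: Bsgn => Bsgn'; [left|right]; near=> s.
  have B1 : 0 < B s by near: s.
  by rewrite -(@pmulr_lgt0 _ (B s)^-1) ?invr_gt0//; near: s.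
have B1 : B s < 0 by near: s.
by rewrite -(@nmulr_lgt0 _ (B s)^-1) ?invr_lt0//; near: s.
Unshelve. all: by end_near. Qed.

Let aN0 : \forall s \near +oo, a s != 0.
Proof.
case: asgn => as'; near=> s.
  by rewrite gt_eqF//; near: s.
by rewrite lt_eqF//; near: s.
Unshelve. all: by end_near. Qed.

Let la (u : R) : 0 <= u -> (l (s + u) - l s) / a s @[s --> +oo] --> box_cox rho u.
Proof.
move=> u0.
have H : (l (s + u) - l s) / B s * (a s / B s)^-1 @[s --> +oo] --> box_cox rho u.
  rewrite -[X in _ --> X]mulr1 -[X in _ * X]invr1.
  apply: cvgM; first exact: lB.
  by apply: cvgV; rewrite ?oner_neq0.
apply: (cvg_near_eq H); near=> s.
have a1 : a s != 0 by near: s.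
have b1 : B s != 0 by near: s.
by field; rewrite a1 b1.
Unshelve. all: by end_near. Qed.

(** Up to [c1], a(s + u) is the difference of the increments of [l] from s to s + u + 1 and to s +
    u; [box_coxD] identifies the limit. *)
Let ara (u : R) : 0 <= u -> a (s + u) / a s @[s --> +oo] --> expR (rho * u).
Proof.
move=> u0.
have H : c1^-1 * ((l (s + (u + 1)) - l s) / a s - (l (s + u) - l s) / a s)
    @[s --> +oo] --> expR (rho * u).
  have -> : expR (rho * u) = c1^-1 * (box_cox rho (u + 1) - box_cox rho u).
    by rewrite box_coxD -/c1; field; rewrite gt_eqF.
  by apply: cvgMr; apply: cvgB; apply: la => //; rewrite addr_ge0.
apply: (cvg_near_eq H); near=> s.
by rewrite [in RHS]/a addrA; ring.
Unshelve. all: by end_near. Qed.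

Let apos2 : \forall s \near +oo, forall u : R, 0 <= u -> 0 < a (s + u) / a s.
Proof.
case: asgn => as'; have as2 := near_pinfty_translate as'; near=> s.
  have as1 : 0 < a s by near: s.
  by move=> u u0; rewrite divr_gt0//; move: u u0; near: s.
have as1 : a s < 0 by near: s.
move=> u u0; rewrite -mulrNN -invrN divr_gt0 ?oppr_gt0//.
by move: u u0; near: s.
Unshelve. all: by end_near. Qed.

(** Locally uniform regular variation of |a|, from [uniform_convergence] for ln |a| with unit
    normalisation; here the measurability of [a] matters. *)
Let lna (b e : R) : 0 < b -> 0 < e -> \forall s \near +oo, forall u : R,
  0 <= u <= b -> `|ln `|a (s + u)| - ln `|a s| - rho * u| <= e.
Proof.
move=> b0 e0.
have ma : measurable_fun setT (fun s => ln `|a s|).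
  apply: (measurableT_comp (@measurable_ln R)).
  apply: measurableT_comp => //; apply: measurable_funM => //.
  apply: measurable_funB => //; apply: (measurableT_comp ml).
  exact: measurable_funD.
have H := @uniform_convergence R (fun s => ln `|a s|) (cst 1) (fun u => rho * u)
  (cst 1) b (Num.max 1 (`|rho| * (2 * b))) b0 ma _ _ _ _ _ _ e e0.
have {H} : \forall s \near +oo, forall u : R, 0 <= u <= b ->
    `|ln `|a (s + u)| - ln `|a s| - 1 * (rho * u)| <= e * `|1|.
  apply: H.
  - by near=> s; rewrite oner_neq0.
  - move=> u u0.
    have H : ln (a (s + u) / a s) @[s --> +oo] --> ln (expR (rho * u)).
      apply: (@cvg_comp _ _ _ (fun s => a (s + u) / a s) (@ln R)); first exact: ara.
      exact/continuous_ln/expR_gt0.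
    rewrite expRK in H; apply: (cvg_near_eq H); near=> s.
    have p2 : 0 < a (s + u) / a s by move: u u0 {H}; near: s.
    rewrite divr1 -(gtr0_norm p2) normf_div ln_div// posrE normr_gt0.
      by apply: contraTneq p2 => ->; rewrite mul0r ltxx.
    by apply: contraTneq p2 => ->; rewrite invr0 mulr0 ltxx.
  - by move=> e' e'0; near=> s => u _; rewrite divr1 subrr normr0 ltW.
  - by move=> u y _ _; rewrite mul1r mulrDr.
  - move=> u /andP[u0 ub]; rewrite normrM (ger0_norm u0) le_max; apply/orP; right.
    by rewrite ler_wpM2l.
  - by move=> u _; rewrite normr1 le_max lexx.
by apply: filterS => s H u ub; have := H u ub; rewrite mul1r normr1 mulr1.
Unshelve. all: by end_near. Qed.

Let araU (b e : R) : 0 < b -> 0 < e -> \forall s \near +oo, forall u : R,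
  0 <= u <= b -> `|a (s + u) / a s - expR (rho * u)| <= e.
Proof.
move=> b0 e0; have E0 := expR_gt0 (1 : R).
(* For |x| <= d one has |e^x - 1| <= d e <= [e], the first e being Euler's number; the factor e^(rho
   u) is at most 1. *)
pose d := Num.min 1 (e / expR 1).
have d0 : 0 < d by rewrite lt_min ltr01 divr_gt0.
near=> s => u ub; have u0 : 0 <= u by case/andP: ub.
have p2 : 0 < a (s + u) / a s by move: u u0 {ub}; near: s.
have Hd : `|ln `|a (s + u)| - ln `|a s| - rho * u| <= d.
  by move: u ub {u0 p2}; near: s; exact: lna.
set x := (X in `|X|) in Hd.
have -> : a (s + u) / a s = expR (rho * u) * expR x.
  have as0 : 0 < `|a s|.
    rewrite normr_gt0; apply: contraTneq p2 => ->; by rewrite invr0 mulr0 ltxx.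
  have asu0 : 0 < `|a (s + u)|.
    rewrite normr_gt0; apply: contraTneq p2 => ->; by rewrite mul0r ltxx.
  by rewrite -expRD /x subrKC expRB !lnK ?posrE// -normf_div gtr0_norm.
rewrite -{2}[expR _]mulr1 -mulrBr normrM ger0_norm ?expR_ge0//.
have r1 : expR (rho * u) <= 1 by rewrite -expR0 ler_expR mulr_le0_ge0.
apply: (@le_trans _ _ (1 * `|expR x - 1|)); first by rewrite ler_wpM2r.
rewrite mul1r; apply: (le_trans (norm_expRB1_le _)).
apply: (@le_trans _ _ (d * expR 1)).
  by apply: ler_pM => //; rewrite ?expR_ge0// ler_expR (le_trans Hd)// ge_min lexx.
by rewrite -ler_pdivlMr// ge_min lexx orbT.
Unshelve. all: by end_near. Qed.

Let laU (b e : R) : 0 < b -> 0 < e -> \forall s \near +oo, forall u : R,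
  0 <= u <= b -> `|l (s + u) - l s - a s * box_cox rho u| <= e * `|a s|.
Proof.
move=> b0 e0.
apply: (@uniform_convergence R l a (box_cox rho) (fun u => expR (rho * u)) b
  (Num.max 1 (2 * b)) b0 ml aN0 la) => //.
- by move=> e' e'0; exact: araU.
- by move=> u y _ _; rewrite box_coxD.
- move=> u /andP[u0 ub]; rewrite ger0_norm ?box_cox_ge0// le_max; apply/orP; right.
  exact: (le_trans (box_cox_le rho0 u0)).
- move=> u /andP[u0 _]; rewrite ger0_norm ?expR_ge0// le_max -[X in _ <= X]expR0 ler_expR.
  by rewrite mulr_le0_ge0.
Qed.

(** A unit step changes [l] by at most 2 |a| and multiplies |a| by at most e^d, so j + 1 steps give
    the geometric sum 2 (1 + e^d + ... + e^(d j)) = C1 (e^(d (j + 1)) - 1). For the linear bound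
    each step costs at most d. *)
Let lbound (d : R) : 0 < d -> exists C : R, \forall s \near +oo, forall u : R,
  0 <= u -> `|l (s + u) - l s| <= C * `|a s| * expR (d * u) /\
            `|l (s + u) - l s| <= d * (u + 1).
Proof.
move=> d0; have ed : 0 < expR d - 1 by rewrite subr_gt0 -expR0 ltr_expR.
pose C1 := 2 / (expR d - 1); have C10 : 0 < C1 by rewrite divr_gt0.
have C1E : C1 * (expR d - 1) = 2 by rewrite /C1 divfK// gt_eqF.
have : \forall s \near +oo, forall v : R, 0 <= v <= 1 ->
    [/\ `|l (s + v) - l s| <= 2 * `|a s|, `|l (s + v) - l s| <= d &
        `|a (s + v)| <= expR d * `|a s|].
  near=> s => v v01.
  have h1 : `|l (s + v) - l s - a s * box_cox rho v| <= 1 * `|a s|.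
    by move: v v01; near: s; exact: laU.
  have h2 : `|a (s + v) / a s - expR (rho * v)| <= expR d - 1.
    by move: v v01 {h1}; near: s; exact: araU.
  have h3 : `|a s| <= d / 2.
    by near: s; move/cvgr0Pnorm_le : a0; apply; rewrite divr_gt0.
  have aN : a s != 0 by near: s.
  case/andP: v01 => v0 v1.
  have bv := box_cox_le rho0 v0; have bv0 := box_cox_ge0 rho0 v0.
  have h4 : `|l (s + v) - l s| <= 2 * `|a s|.
    have -> : l (s + v) - l s =
      (l (s + v) - l s - a s * box_cox rho v) + a s * box_cox rho v by ring.
    apply: (le_trans (ler_normD _ _)); rewrite normrM (ger0_norm bv0).
    have := normr_ge0 (a s); nra.
  split => //; first by lra.
  have -> : a (s + v) = (a (s + v) / a s) * a s by rewrite divfK.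
  rewrite normrM ler_wpM2r//.
  have -> : a (s + v) / a s = (a (s + v) / a s - expR (rho * v)) + expR (rho * v) by ring.
  apply: (le_trans (ler_normD _ _)); rewrite (ger0_norm (expR_ge0 _)).
  have : expR (rho * v) <= 1 by rewrite -expR0 ler_expR mulr_le0_ge0.
  lra.
move=> /near_pinftyP[M HM].
(* The first unit step is split off, so the induction hypothesis is used at s + 1; this is why a
   fixed threshold M replaces the filter. *)
have ind (j : nat) : forall s v, M <= s -> 0 <= v <= 1 ->
    `|l (s + (j%:R + v)) - l s| <= C1 * (expR (d * (j%:R + 1)) - 1) * `|a s| /\
    `|l (s + (j%:R + v)) - l s| <= d * (j%:R + 1).
  elim: j => [|j IH] s v Ms v01.
    rewrite !add0r mulr1 C1E; have [h1 h2 _] := HM _ Ms _ v01.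
    by split.
  have Ms1 : M <= s + 1 by lra.
  have [h1 h2] := IH (s + 1) v Ms1 v01.
  have [h3 h4 h5] := HM s Ms 1 (ltac:(by rewrite ler01 lexx)).
  have sE : s + (j.+1%:R + v) = s + 1 + (j%:R + v) by rewrite -natr1; ring.
  have dE : l (s + (j.+1%:R + v)) - l s =
    (l (s + 1 + (j%:R + v)) - l (s + 1)) + (l (s + 1) - l s) by rewrite sE; ring.
  rewrite dE; split; apply: (le_trans (ler_normD _ _)).
    apply: (le_trans (lerD h1 h3)).
    have -> : d * (j.+1%:R + 1) = d * (j%:R + 1) + d by rewrite -natr1; ring.
    rewrite expRD.
    have e1 : 1 <= expR (d * (j%:R + 1)).
      by rewrite -expR0 ler_expR mulr_ge0 ?ltW// addr_ge0.
    have : C1 * (expR (d * (j%:R + 1)) - 1) * `|a (s + 1)| <=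
           C1 * (expR (d * (j%:R + 1)) - 1) * (expR d * `|a s|).
      by apply: ler_wpM2l => //; rewrite mulr_ge0 ?subr_ge0// ltW.
    have -> : C1 * (expR (d * (j%:R + 1)) * expR d - 1) * `|a s| =
      C1 * (expR (d * (j%:R + 1)) - 1) * (expR d * `|a s|) + C1 * (expR d - 1) * `|a s|.
      by ring.
    rewrite C1E; lra.
  apply: (le_trans (lerD h2 h4)); rewrite -natr1; nra.
exists (C1 * expR d); apply/near_pinftyP; exists M => s Ms u u0.
pose j := Num.truncn u; have /andP[ju uj] : j%:R <= u < j.+1%:R.
  exact: truncn_itv.
have vj : 0 <= u - j%:R <= 1 by rewrite -natr1 in uj; lra.
have [h1 h2] := ind j s _ Ms vj; rewrite subrKC in h1 h2.
split; last by apply: (le_trans h2); rewrite ler_pM2l//; lra.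
apply: (le_trans h1).
have : expR (d * (j%:R + 1)) <= expR d * expR (d * u).
  by rewrite -expRD ler_expR; nra.
have := normr_ge0 (a s); have := expR_gt0 (d * (j%:R + 1)).
move=> x1 x2 x3.
have -> : C1 * expR d * `|a s| * expR (d * u) = C1 * `|a s| * (expR d * expR (d * u)) by ring.
have -> : C1 * (expR (d * (j%:R + 1)) - 1) * `|a s| = C1 * `|a s| * (expR (d * (j%:R + 1)) - 1) by ring.
by apply: ler_wpM2l; [rewrite mulr_ge0// ltW | lra].
Unshelve. all: by end_near. Qed.

Lemma second_order_aux_exists :
  exists2 a' : R -> R, a' s / B s @[s --> +oo] --> (1 : R) & second_order_aux rho l a'.
Proof. by exists a. Qed.

End second_order.

(** * Moments under the exponential law *)

Section exponential_law.
Context (R : realType).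
Local Notation mu := (@lebesgue_measure R).

Definition exp_law : probability (measurableTypeR R) R :=
  exponential_distribution_exponential_prob__canonical__probability_measure_Probability
    (@ltr01 R).

Lemma exp_lawE (A : set (measurableTypeR R)) :
  exp_law A = (\int[mu]_(x in A) (exponential_pdf 1 x)%:E)%E.
Proof. by []. Qed.

Let pdf_ge0 (x : R) : (0 <= (exponential_pdf 1 x)%:E)%E.
Proof. by rewrite lee_fin exponential_pdf_ge0. Qed.

Lemma exp_law_dom : exp_law `<< mu.
Proof.
apply/null_content_dominatesP => A mA muA0; rewrite exp_lawE.
apply: null_set_integral => //.
apply: measurable_funTS; apply/measurable_EFinP; exact: measurable_exponential_pdf.
Qed.

Lemma integral_exp_law (f : R -> \bar R) :
  measurable_fun (`[0, +oo[ : set R) f -> (forall u, 0 <= u -> (0 <= f u)%E) ->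
  (\int[exp_law]_(u in `[0%R, +oo[) f u =
   \int[mu]_(u in `[0%R, +oo[) (f u * (expR (- u))%:E))%E.
Proof.
move=> mf f0; set D := (`[0, +oo[%classic : set (measurableTypeR R)).
have mD : measurable D by exact: measurable_itv.
(* Extension by zero gives the global nonnegativity that the change of variables asks for. *)
pose g := f \_ D.
have mg : measurable_fun D g.
  apply: (measurable_funS measurableT) => //.
  by apply/(measurable_restrictT f mD).
have g0 (x : measurableTypeR R) : (0 <= g x)%E.
  by rewrite /g patchE; case: ifPn => // /set_mem; rewrite /D/= in_itv/= andbT; exact: f0.
have gf x : x \in D -> g x = f x by move=> xD; rewrite /g patchE xD.
transitivity (\int[exp_law]_(u in D) g u)%E.
  by apply: eq_integral => x /gf.
rewrite -(Radon_Nikodym_SigmaFinite.change_of_variables exp_law_dom g0 mD mg).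
transitivity (\int[mu]_(u in D) (g u * (exponential_pdf 1 u)%:E))%E; last first.
  apply: eq_integral => x xD; rewrite gf// exponential_pdfE ?mul1r ?mulN1r//.
  by move/set_mem: xD; rewrite /D/= in_itv/= andbT.
have If := Radon_Nikodym_SigmaFinite.f_integrable exp_law_dom.
have mpdf : measurable_fun D (fun x => (exponential_pdf 1 x)%:E).
  by apply: measurable_funTS; apply/measurable_EFinP; exact: measurable_exponential_pdf.
apply: ae_eq_integral => //.
- apply: emeasurable_funM => //.
  by apply: measurable_funTS; exact: measurable_int If.
- exact: emeasurable_funM.
(* The Radon-Nikodym density equals the exponential density almost everywhere, since both integrate
   to the exponential law over every measurable subset of D. *)
- apply: ae_eqe_mul2l; apply: integral_ae_eq => //.
    exact: integrableS If.
  move=> E ED mE.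
  by rewrite -(Radon_Nikodym_SigmaFinite.f_integral exp_law_dom).
Qed.

Lemma expR_cvg0 (c : R) : 0 < c -> expR (- c * u) @[u --> +oo] --> 0.
Proof.
move=> c0; have H : expR (- (c * u)) @[u --> +oo] --> 0.
  by apply: (@cvg_comp _ _ _ (fun u => c * u) (fun z => expR (- z)));
     [exact: gt0_cvgMry | exact: cvgr_expR].
by apply: (cvg_near_eq H); near=> u; rewrite mulNr.
Unshelve. all: by end_near. Qed.

Let dexp (c x : R) : is_derive x 1 (fun u => expR (- c * u)) (expR (- c * x) * - c).
Proof.
have H : is_derive x 1 (fun u : R => - c * u) (- c * 1).
  exact: (is_deriveZ (- c) (@is_derive_id R R x 1)).
rewrite mulr1 in H.
exact: (@is_derive1_comp R expR (fun u => - c * u) x _ _ (is_derive_expR _) H).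
Qed.

Let is_derive_cont (F : R -> R) (x l : R) : is_derive x 1 F l -> {for x, continuous F}.
Proof.
by move=> H; apply: differentiable_continuous; apply/derivable1_diffP; exact: ex_derive.
Qed.

Lemma integral_expR_Ny (a c : R) : 0 < c ->
  (\int[mu]_(u in `[a, +oo[) (expR (- c * u))%:E = (expR (- c * a) / c)%:E)%E.
Proof.
move=> c0; pose F (u : R) : R := - c^-1 * expR (- c * u).
have dF (x : R) : is_derive x 1 F (expR (- c * x)).
  have -> : expR (- c * x) = - c^-1 * (expR (- c * x) * - c).
    by field; rewrite gt_eqF.
  exact: (is_deriveZ (- c^-1) (dexp c x)).
rewrite (@ge0_continuous_FTC2y _ _ F a 0).
- by rewrite -EFinB sub0r /F mulNr opprK mulrC.
- by move=> x _; exact: expR_ge0.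
- by apply: continuous_subspaceT => x; exact: is_derive_cont (dexp c x).
- by rewrite -[X in _ --> X](mulr0 (- c^-1)); apply: cvgMr; exact: expR_cvg0.
- by move=> x _; exact: ex_derive.
- by apply: cvg_at_right_filter; exact: is_derive_cont (dF a).
- by move=> x _; rewrite derive1E; exact: derive_val.
Qed.

Lemma integral_id_expR_Ny (c : R) : 0 < c ->
  (\int[mu]_(u in `[0%R, +oo[) (u * expR (- c * u))%:E = (c ^- 2)%:E)%E.
Proof.
move=> c0; pose F (u : R) : R := - (c^-1 * u + c ^- 2) * expR (- c * u).
have dF (x : R) : is_derive x 1 F (x * expR (- c * x)).
  have H1 : is_derive x 1 (fun u : R => - (c^-1 * u + c ^- 2)) (- (c^-1 * 1 + 0)).
    exact: (is_deriveN (is_deriveD (is_deriveZ c^-1 (@is_derive_id R R x 1)) (is_derive_cst _ _ _))).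
  have -> : x * expR (- c * x) =
    - (c^-1 * x + c ^- 2) *: (expR (- c * x) * - c) + expR (- c * x) *: (- (c^-1 * 1 + 0)).
    by rewrite /GRing.scale/=; field; rewrite gt_eqF.
  exact: (is_deriveM H1 (dexp c x)).
rewrite (@ge0_continuous_FTC2y _ _ F 0 0).
- by rewrite -EFinB sub0r /F !mulr0 expR0 mulr1 opprK add0r.
- by move=> x x0; rewrite mulr_ge0// expR_ge0.
- apply: continuous_subspaceT => x.
  by apply: (@continuousM _ _ id); [exact: cvg_id | exact: is_derive_cont (dexp c x)].
(* Half of the decay absorbs the linear factor: (c / 2) u <= e^(c u / 2). *)
- have c20 : 0 < c / 2 by rewrite divr_gt0.
  have H : (2 * c ^- 2) * expR (- (c / 2) * u) + c ^- 2 * expR (- c * u) @[u --> +oo] --> 0.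
    rewrite -[X in _ --> X](addr0 0) -[X in _ --> X + _](mulr0 (2 * c ^- 2)).
    rewrite -[X in _ --> _ + X](mulr0 (c ^- 2)).
    by apply: cvgD; apply: cvgMr; exact: expR_cvg0.
  apply: cvg_norm_le0 H; near=> u.
  have u0 : 0 <= u by near: u; apply: nbhs_pinfty_ge; rewrite num_real.
  rewrite /F mulNr normrN ger0_norm; last first.
    by rewrite mulr_ge0 ?expR_ge0// addr_ge0// ?mulr_ge0 ?invr_ge0 ?exprn_ge0// ltW.
  rewrite mulrDl lerD2r.
  have -> : expR (- c * u) = expR (- (c / 2) * u) * expR (- (c / 2) * u).
    by rewrite -expRD; congr expR; field.
  rewrite mulrA ler_wpM2r ?expR_ge0//.
  have h1 : expR (c / 2 * u) * expR (- (c / 2) * u) = 1.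
    by rewrite -expRD mulNr subrr expR0.
  have h2 : c / 2 * u <= expR (c / 2 * u) by apply: (le_trans _ (expR_ge1Dx _)); lra.
  have h3 : c / 2 * u * expR (- (c / 2) * u) <= 1.
    by rewrite -[leRHS]h1 ler_wpM2r ?expR_ge0.
  have -> : c^-1 * u * expR (- (c / 2) * u) = 2 * c ^- 2 * (c / 2 * u * expR (- (c / 2) * u)).
    by field; rewrite gt_eqF.
  by rewrite -[leRHS]mulr1 ler_wpM2l// mulr_ge0// invr_ge0 exprn_ge0 ?ltW.
- by move=> x _; exact: ex_derive.
- by apply: cvg_at_right_filter; exact: is_derive_cont (dF 0).
- by move=> x _; rewrite derive1E; exact: derive_val.
Unshelve. all: by end_near. Qed.

Lemma exp_law_ray (x : R) : 0 <= x ->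
  exp_law `]x, +oo[%classic = (expR (- x))%:E.
Proof.
move=> x0; rewrite exp_lawE.
have mpdf : measurable_fun `]x, +oo[ (fun x => (exponential_pdf (1 : R) x)%:E).
  by apply: measurable_funTS; apply/measurable_EFinP; exact: measurable_exponential_pdf.
rewrite integral_itv_obnd_cbnd//.
have <- : (\int[mu]_(u in `[x, +oo[) (expR (- 1 * u))%:E)%E = (expR (- x))%:E.
  by rewrite integral_expR_Ny// mulN1r divr1.
apply: eq_integral => u; rewrite inE/= in_itv/= andbT => xu.
by rewrite exponential_pdfE ?mul1r// (le_trans x0).
Qed.

Lemma exp_law_nonneg : exp_law `[0%R, +oo[%classic = 1%E.
Proof.
rewrite exp_lawE.
have mpdf : measurable_fun (`]0, +oo[ : set R) (fun x => (exponential_pdf (1 : R) x)%:E).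
  by apply: measurable_funTS; apply/measurable_EFinP; exact: measurable_exponential_pdf.
by rewrite -integral_itv_obnd_cbnd// -exp_lawE exp_law_ray// oppr0 expR0.
Qed.

Lemma exp_law_expR (c : R) : c < 1 ->
  (\int[exp_law]_(u in `[0%R, +oo[) (expR (c * u))%:E = ((1 - c)^-1)%:E)%E.
Proof.
move=> c1; rewrite integral_exp_law.
- have <- : (\int[mu]_(u in `[0%R, +oo[) (expR (- (1 - c) * u))%:E)%E = ((1 - c)^-1)%:E.
    by rewrite integral_expR_Ny ?subr_gt0// mulr0 expR0 mul1r.
  apply: eq_integral => u _; rewrite -EFinM -expRD; congr (expR _)%:E; ring.
- apply/measurable_EFinP; apply: measurable_funTS.
  by apply: (measurableT_comp (@measurable_expR R)); exact: measurable_funM.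
- by move=> u u0; rewrite lee_fin expR_ge0.
Qed.

Lemma measurable_box_cox (rho : R) (D : set R) : measurable_fun D (box_cox rho).
Proof.
by apply: measurable_funTS; apply: continuous_measurable_fun; exact: box_cox_continuous.
Qed.

(** Source of the denominators of [xi2], with c = gamma and c = 2 gamma. For rho != 0 it is a
    difference of two exponential moments over rho, for rho = 0 a gamma integral. *)
Lemma exp_law_box_cox (rho c : R) : rho <= 0 -> c < 1 ->
  (\int[exp_law]_(u in `[0%R, +oo[) (box_cox rho u * expR (c * u))%:E =
   (((1 - c) * (1 - c - rho))^-1)%:E)%E.
Proof.
move=> r0 c1; have c10 : 0 < 1 - c by lra.
have c2 : 0 < 1 - c - rho by lra.
have mE (b : R) : measurable_fun (`[0, +oo[ : set R) (fun u => expR (b * u)).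
  apply: measurable_funTS.
  by apply: (measurableT_comp (@measurable_expR R)); exact: measurable_funM.
case: (eqVneq rho 0) => [->|rN0].
  rewrite integral_exp_law.
  - have <- : (\int[mu]_(u in `[0%R, +oo[) (u * expR (- (1 - c) * u))%:E)%E =
        (((1 - c) * (1 - c - 0))^-1)%:E.
      by rewrite integral_id_expR_Ny// subr0 expr2.
    apply: eq_integral => u _.
    rewrite /box_cox eqxx -EFinM -mulrA -expRD; congr (_ * expR _)%:E; ring.
  - by apply/measurable_EFinP; apply: measurable_funM => //; exact: measurable_box_cox.
  - by move=> u u0; rewrite lee_fin mulr_ge0 ?expR_ge0// box_cox_ge0.
have rlt : rho < 0 by rewrite lt_neqAle rN0.
have H (b : R) : b < 1 -> exp_law.-integrable `[0%R, +oo[ (fun u => (expR (b * u))%:E).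
  move=> b1; apply/integrableP; split; first by apply/measurable_EFinP; exact: mE.
  under eq_integral do rewrite abse_EFin ger0_norm ?expR_ge0//.
  by rewrite exp_law_expR// ltry.
have cr : c + rho < 1 by lra.
transitivity (\int[exp_law]_(u in `[0%R, +oo[)
   (((rho^-1)%:E * (expR ((c + rho) * u))%:E) - (rho^-1)%:E * (expR (c * u))%:E))%E.
  apply: eq_integral => u _; rewrite /box_cox (negbTE rN0) -!EFinM -EFinB [(c + rho) * u]mulrDl expRD.
  by congr EFin; ring.
rewrite integralB//=; [|exact: integrableZl (H _ cr)|exact: integrableZl (H _ c1)].
rewrite !integralZl//=; [|exact: (H _ c1)|exact: (H _ cr)].
rewrite !exp_law_expR// -!EFinM -EFinB; congr EFin.
field; rewrite rN0 /=; apply/andP; split; rewrite gt_eqF//; lra.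
Qed.

End exponential_law.
Arguments exp_law {R}.

(** * Second-order expansion of exponential moments *)

Lemma norm_expRB1D_le (R : realType) (x : R) :
  `|expR x - 1 - x| <= x ^+ 2 * expR `|x|.
Proof.
have p1 := expR_ge1Dx x; rewrite ger0_norm; last by lra.
have [x0|x0] := leP 0 x.
  have h := norm_expRB1_le x; rewrite (ger0_norm x0) in h *.
  rewrite ger0_norm in h; last by lra.
  have h2 : 1 - x <= expR (- x) by apply: (le_trans _ (expR_ge1Dx _)); lra.
  have h3 := expRxMexpNx_1 x; have h4 := expR_gt0 x; rewrite expr2; nra.
rewrite ltr0_norm//.
have h1 : 1 - x <= expR (- x) by apply: (le_trans _ (expR_ge1Dx _)); lra.
have h3 := expRxMexpNx_1 x.
have h4 := expR_gt0 x.
have h5 : 1 <= expR (- x) by lra.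
have : x ^+ 2 <= x ^+ 2 * expR (- x) by rewrite ler_peMr// sqr_ge0.
have : expR x * (1 - x) <= 1 by nra.
rewrite expr2; nra.
Qed.

Section exp_moment.
Context (R : realType) (gamma rho p : R) (l a : R -> R).
Hypotheses (rho0 : rho <= 0) (p0 : 0 < p) (pg1 : p * gamma < 1)
  (ml : measurable_fun setT l) (la : second_order_aux rho l a).

Local Notation D := (`[0%R, +oo[%classic).

(** The p-th moment integrand minus its limit e^(p gamma u), divided by a(s). Dominated convergence
    is applied to this quotient. *)
Let G (s u : R) : R := expR (p * gamma * u) * ((expR (p * (l (s + u) - l s)) - 1) / a s).

Let mE (b : R) : measurable_fun (`[0, +oo[ : set R) (fun u => expR (b * u)).
Proof.
apply: measurable_funTS.
by apply: (measurableT_comp (@measurable_expR R)); exact: measurable_funM.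
Qed.

Let mls (s : R) : measurable_fun (`[0, +oo[ : set R) (fun u => l (s + u) - l s).
Proof.
apply: measurable_funTS; apply: measurable_funB => //.
by apply: (measurableT_comp ml); exact: measurable_funD.
Qed.

Let mG s : measurable_fun (`[0, +oo[ : set R) (G s).
Proof.
apply: measurable_funM; first exact: mE.
apply: measurable_funM => //; apply: measurable_funB => //.
by apply: (measurableT_comp (@measurable_expR R)); exact: measurable_funM.
Qed.

Let Gbound : exists C c : R, c < 1 /\ \forall s \near +oo, forall u, 0 <= u ->
  `|G s u| <= C * expR (c * u).
Proof.
have [a0 aN0 _ _ lb] := la.
have p10 : 0 < 1 + p by rewrite addr_gt0.
(* The growth e^(d u) of the increment and its exponentiation e^(p d u) together raise the rate p
   gamma by (1 + p) d, that is, to its midpoint with 1. *)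
pose d : R := (1 - p * gamma) / 2 / (1 + p).
have d0 : 0 < d by rewrite !divr_gt0 ?subr_gt0.
have dE : (1 + p) * d = (1 - p * gamma) / 2 by rewrite /d mulrC divfK// gt_eqF.
have [C HC] := lb d d0.
exists (p * C * expR (p * d)), (p * gamma + (1 + p) * d); split.
  rewrite dE; have := pg1; lra.
near=> s => u u0.
have as0 : a s != 0 by near: s.
have [h1 h2] : `|l (s + u) - l s| <= C * `|a s| * expR (d * u) /\
               `|l (s + u) - l s| <= d * (u + 1) by move: u u0; near: s.
rewrite /G normrM (ger0_norm (expR_ge0 _)) normf_div.
set z := l (s + u) - l s in h1 h2 *.
have e1 : `|expR (p * z) - 1| <= p * (C * `|a s| * expR (d * u)) * expR (p * (d * (u + 1))).
  apply: (le_trans (norm_expRB1_le _)); rewrite normrM (gtr0_norm p0).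
  by apply: ler_pM; rewrite ?mulr_ge0 ?expR_ge0 ?(ltW p0)// ?ler_expR ler_pM2l.
have -> : p * C * expR (p * d) * expR ((p * gamma + (1 + p) * d) * u) =
  expR (p * gamma * u) * (p * (C * `|a s| * expR (d * u)) * expR (p * (d * (u + 1))) / `|a s|).
  have -> : (p * gamma + (1 + p) * d) * u = p * gamma * u + (d * u + p * d * u) by ring.
  have -> : p * (d * (u + 1)) = p * d * u + p * d by ring.
  by rewrite !expRD; field; rewrite normr_eq0.
by rewrite ler_wpM2l ?expR_ge0// ler_wpM2r ?invr_ge0.
Unshelve. all: by end_near. Qed.

(** Taylor: with z the increment of [l], z / a tends to h(u) and z to 0, so the quadratic remainder
    of e^(p z) is o(a). *)
Let Glim (s_ : nat -> R) (u : R) : s_ n @[n --> \oo] --> +oo -> 0 <= u ->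
  G (s_ n) u @[n --> \oo] --> p * (box_cox rho u * expR (p * gamma * u)).
Proof.
move=> sy u0; have [a0 aN0 lU _ lb] := la.
have b0 : 0 < u + 1 by lra.
have z1 : (l (s_ n + u) - l (s_ n)) / a (s_ n) @[n --> \oo] --> box_cox rho u.
  apply: (@cvg_comp _ _ _ s_ (fun s => (l (s + u) - l s) / a s) _ _ _ sy).
  apply/cvgrPdist_le => e e0; near=> s.
  have as0 : a s != 0 by near: s.
  have H : `|l (s + u) - l s - a s * box_cox rho u| <= e * `|a s|.
    have H : forall v, 0 <= v <= u + 1 -> `|l (s + v) - l s - a s * box_cox rho v| <= e * `|a s|.
      by near: s; exact: lU.
    by apply: H; lra.
  rewrite distrC -(@ler_pM2r _ `|a s|) ?normr_gt0// -normrM mulrBl divfK//.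
  by rewrite [box_cox _ _ * _]mulrC.
have an0 : a (s_ n) @[n --> \oo] --> 0 by exact: cvg_comp sy a0.
have anN : \forall n \near \oo, a (s_ n) != 0 by exact: sy _ aN0.
have z0 : l (s_ n + u) - l (s_ n) @[n --> \oo] --> 0.
  have H : (l (s_ n + u) - l (s_ n)) / a (s_ n) * a (s_ n) @[n --> \oo] --> 0.
    by rewrite -[X in _ --> X](mulr0 (box_cox rho u)); exact: cvgM.
  by apply: (cvg_near_eq H); near=> n; rewrite divfK//; near: n.
pose z n := l (s_ n + u) - l (s_ n).
have pz0 : p * z n @[n --> \oo] --> 0.
  by rewrite -[X in _ --> X](mulr0 p); exact: cvgMr.
have pz1 : p * (z n / a (s_ n)) @[n --> \oo] --> p * box_cox rho u by exact: cvgMr.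
have r0 : (expR (p * z n) - 1 - p * z n) / a (s_ n) @[n --> \oo] --> 0.
  have H : `|p * (z n / a (s_ n))| * (`|p * z n| * expR 1) @[n --> \oo] --> 0.
    rewrite -[X in _ --> X](mulr0 `|p * box_cox rho u|); apply: cvgM; first exact: cvg_norm.
    rewrite -[X in _ --> X](mul0r (expR 1)); apply: cvgMl.
    by rewrite -[X in _ --> X](@normr0 R R); exact: cvg_norm.
  apply: cvg_norm_le0 H; near=> n.
  rewrite normf_div; apply: (@le_trans _ _ ((p * z n) ^+ 2 * expR 1 / `|a (s_ n)|)).
    rewrite ler_wpM2r ?invr_ge0//; apply: (le_trans (norm_expRB1D_le _)).
    rewrite ler_wpM2l ?sqr_ge0// ler_expR.
    by near: n; move/cvgr0Pnorm_le : pz0; apply.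
  rewrite -[(p * z n) ^+ 2]real_normK ?num_real//.
  have -> : p * (z n / a (s_ n)) = p * z n / a (s_ n) by rewrite mulrA.
  rewrite [X in _ <= X * _]normf_div.
  by rewrite le_eqVlt; apply/orP; left; apply/eqP; ring.
have H : expR (p * gamma * u) * ((expR (p * z n) - 1 - p * z n) / a (s_ n) + p * (z n / a (s_ n)))
   @[n --> \oo] --> p * (box_cox rho u * expR (p * gamma * u)).
  have -> : p * (box_cox rho u * expR (p * gamma * u)) =
    expR (p * gamma * u) * (0 + p * box_cox rho u) by ring.
  by apply: cvgMr; exact: cvgD.
by apply: (cvg_near_eq H); near=> n; rewrite /G -/(z n); ring.
Unshelve. all: by end_near. Qed.

Let iE (c : R) : c < 1 -> exp_law.-integrable D (fun u => (expR (c * u))%:E).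
Proof.
move=> c1; apply/integrableP; split; first by apply/measurable_EFinP; exact: mE.
under eq_integral do rewrite abse_EFin ger0_norm ?expR_ge0//.
by rewrite exp_law_expR// ltry.
Qed.

Let iG : \forall s \near +oo, exp_law.-integrable D (fun u => (G s u)%:E).
Proof.
have [C [c [c1 HC]]] := Gbound; near=> s.
have Hs : forall u, 0 <= u -> `|G s u| <= C * expR (c * u) by near: s.
have C0 : 0 <= C.
  have := Hs 0 (lexx _); rewrite mulr0 expR0 mulr1; exact: le_trans.
apply: (@le_integrable _ (measurableTypeR R) R exp_law D (measurable_itv _)
  (fun u => (G s u)%:E) (fun u => C%:E * (expR (c * u))%:E)%E).
- by apply/measurable_EFinP; exact: mG.
- move=> u; rewrite /= in_itv/= andbT => u0.
  rewrite lee_fin [`|C * _|]normrM (ger0_norm C0) (ger0_norm (expR_ge0 _)).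
  exact: Hs.
- by apply: integrableZl => //; exact: iE.
Unshelve. all: by end_near. Qed.

Lemma exp_moment_integrable : \forall s \near +oo,
  exp_law.-integrable D (fun u => (expR (p * (gamma * u + (l (s + u) - l s))))%:E).
Proof.
have [_ aN0 _ _ _] := la.
near=> s; have as0 : a s != 0 by near: s.
have iGs : exp_law.-integrable D (fun u => (G s u)%:E) by near: s.
have mD : measurable (D : set (measurableTypeR R)) by exact: measurable_itv.
have H := integrableD mD (iE pg1) (integrableZl mD (a s) iGs).
apply: eq_integrable H => // u _; rewrite -EFinM -EFinD; congr EFin.
have -> : p * (gamma * u + (l (s + u) - l s)) = p * gamma * u + p * (l (s + u) - l s) by ring.
rewrite expRD /G; field; exact: as0.
Unshelve. all: by end_near. Qed.

Lemma exp_moment_second_order (s_ : nat -> R) : s_ n @[n --> \oo] --> +oo ->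
  (\int[exp_law]_(u in D) expR (p * (gamma * u + (l (s_ n + u) - l (s_ n))))
    - (1 - p * gamma)^-1) / a (s_ n) @[n --> \oo]
  --> p / ((1 - p * gamma) * (1 - p * gamma - rho)).
Proof.
move=> sy; have [_ aN0 _ _ _] := la.
have [C [c [c1 /near_pinftyP[M HM]]]] := Gbound.
(* Dominated convergence needs the bound for every n, so the sequence is cut off below at the
   threshold of [Gbound]; eventually nothing changes. *)
pose t n := Num.max M (s_ n).
have ty : t n @[n --> \oo] --> +oo.
  apply/cvgryPge => K; near=> n; rewrite le_max; apply/orP; right.
  by near: n; move/cvgryPge : sy; exact.
have H : (\int[exp_law]_(u in D) (G (t n) u)%:E)%E @[n --> \oo] -->
    (\int[exp_law]_(u in D) (p * (box_cox rho u * expR (p * gamma * u)))%:E)%E.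
  apply: (@dominated_cvg _ _ _ exp_law D (measurable_itv _)
    (fun n u => (G (t n) u)%:E) _ (fun u => C%:E * (expR (c * u))%:E)%E).
  - by move=> n; apply/measurable_EFinP; exact: mG.
  - move=> u; rewrite /= in_itv/= andbT => u0.
    by apply: cvg_EFin; [exact: nearW | exact: Glim].
  - by [].
  - by apply: integrableZl => //; exact: iE.
  - move=> n u; rewrite /= in_itv/= andbT => u0.
    by rewrite lee_fin; apply: HM => //; rewrite le_max lexx.
have limE : (\int[exp_law]_(u in D) (p * (box_cox rho u * expR (p * gamma * u)))%:E)%E =
    (p / ((1 - p * gamma) * (1 - p * gamma - rho)))%:E.
  under eq_integral do rewrite EFinM.
  rewrite ge0_integralZl_EFin ?(ltW p0)//.
  - by rewrite exp_law_box_cox// -EFinM.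
  - move=> u; rewrite /= in_itv/= andbT => u0.
    by rewrite lee_fin mulr_ge0 ?expR_ge0// box_cox_ge0.
  - apply/measurable_EFinP; apply: measurable_funM; [exact: measurable_box_cox|exact: mE].
rewrite limE in H.
have {}H : \int[exp_law]_(u in D) G (t n) u @[n --> \oo] -->
  p / ((1 - p * gamma) * (1 - p * gamma - rho)) by exact: fine_cvg H.
apply: (cvg_near_eq H); near=> n.
have tE : t n = s_ n by apply/max_r; near: n; move/cvgryPge : sy; exact.
have as0 : a (s_ n) != 0 by near: n; exact: sy _ aN0.
have iGs : exp_law.-integrable D (fun u => (G (s_ n) u)%:E) by near: n; exact: sy _ iG.
rewrite /= tE.
have -> : \int[exp_law]_(u in D) expR (p * (gamma * u + (l (s_ n + u) - l (s_ n)))) =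
   \int[exp_law]_(u in D) (expR (p * gamma * u) + a (s_ n) * G (s_ n) u).
  apply: eq_Rintegral => u _.
  rewrite /G mulrDr expRD mulrA; field; exact: as0.
rewrite RintegralD//; [|exact: iE|exact: (integrableZl _ _ iGs)].
rewrite RintegralZl// [X in (X + _ - _)]/Rintegral exp_law_expR//=.
by rewrite addrAC subrr add0r mulrC mulrA mulVf ?mul1r.
Unshelve. all: by end_near. Qed.

End exp_moment.

(** * Quantiles and exceedances *)

Section quantile_transform.
Context d (T : measurableType d) (R : realType) (P : probability T R).
Variable X : {RV P >-> R}.

Let cdfE x : cdf X x = (fine (cdf X x))%:E.
Proof. by rewrite fineK ?fin_num_measure. Qed.

Let S_has_inf (p : R) : 0 < p < 1 -> has_inf [set x : R | (p%:E <= cdf X x)%E].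
Proof.
move=> /andP[p0 p1]; split.
  have H : fine (cdf X x) @[x --> +oo] --> (1 : R) by exact/fine_cvg/cvg_cdfy1.
  have /near_pinftyP[M HM] : \forall x \near +oo, p < fine (cdf X x).
    exact: (cvgr_gt 1 H).
  by exists M => /=; rewrite cdfE lee_fin; apply/ltW/HM.
have H : fine (cdf X x) @[x --> -oo] --> (0 : R) by exact/fine_cvg/cvg_cdfNy0.
have [M [_ HM]] : \forall x \near -oo, fine (cdf X x) < p by exact: (cvgr_lt 0 H).
exists (M - 1) => x /= px; rewrite leNgt; apply/negP => xM.
have : fine (cdf X x) < p by apply: HM; lra.
by rewrite ltNge -lee_fin -cdfE px.
Qed.

(** The infimum is attained because the distribution function is right-continuous; 0 < p < 1 keeps
    [inf] away from its default value. *)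
Lemma quantile_le (p x : R) : 0 < p < 1 ->
  (quantile X p <= x) = (p%:E <= cdf X x)%E.
Proof.
move=> p01; have HS := S_has_inf p01; apply/idP/idP => H; last first.
  by apply: ge_inf; [case: HS|].
apply: (@le_trans _ _ (cdf X (quantile X p))); last exact: cdf_nondecreasing.
have := @cdf_right_continuous _ _ _ _ X (quantile X p); move=> /cvge_to_ge; apply.
near=> y.
have yq : quantile X p < y by near: y; exact: nbhs_right_gt.
have [z /= pz zy] := inf_lt HS.1 yq.
by apply: (le_trans pz); apply: cdf_nondecreasing; exact: ltW.
Unshelve. all: by end_near. Qed.

Lemma tail_quantileE (s : R) : tail_quantile X (expR s) = quantile X (1 - expR (- s)).
Proof. by rewrite /tail_quantile expRN. Qed.

(** Negation of [quantile_le] on the survival scale; s > 0 puts the level 1 - e^(-s) strictly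
    between 0 and 1. *)
Lemma tail_quantile_gt (s y S : R) : 0 < s -> ccdf X y = (expR (- S))%:E ->
  (y < tail_quantile X (expR s)) = (S < s).
Proof.
move=> s0 HS; have es : expR (- s) < 1 by rewrite -expR0 ltr_expR oppr_lt0.
have es0 := expR_gt0 (- s).
rewrite ltNge tail_quantileE quantile_le; last by lra.
rewrite cdf_1_ccdf HS -EFinB lee_fin lerD2l lerN2 ler_expR lerN2.
by rewrite ltNge.
Qed.

Hypothesis Fpos : forall x, (0 < ccdf X x)%E.

Definition tail_log (x : R) : R := - ln (fine (ccdf X x)).

Lemma ccdf_tail_log x : ccdf X x = (expR (- tail_log x))%:E.
Proof.
rewrite /tail_log opprK lnK ?fineK ?fin_num_measure// posrE.
by rewrite -lte_fin fineK ?fin_num_measure.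
Qed.

Lemma tail_log_homo : {homo tail_log : x y / x <= y}.
Proof.
move=> x y xy; have := ccdf_nonincreasing X xy.
by rewrite !ccdf_tail_log lee_fin ler_expR lerN2.
Qed.

Lemma exp_law_setI_nonneg (B : set (measurableTypeR R)) : measurable B ->
  exp_law B = exp_law (B `&` `[0%R, +oo[).
Proof.
move=> mB; set D : set (measurableTypeR R) := `[0%R, +oo[%classic.
have mD : measurable D by exact: measurable_itv.
have N0 : exp_law (~` D) = 0%E.
  have := probability_setC exp_law mD; rewrite exp_law_nonneg subee//; exact.
rewrite -[B in LHS](setUIDK B D) measureU//; [|exact: measurableI|exact: measurableD|].
- rewrite [X in (_ + X)%E](_ : _ = 0%E) ?adde0//.
  by apply: (subset_measure0 _ _ _ N0); [exact: measurableD|exact: measurableC|move=> x []].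
- by apply/seteqP; split => // x [[]] _ Dx [].
Qed.

Hypothesis mU : measurable_fun (`]0, +oo[ : set R) (tail_quantile X).

Let g (s u : R) : R := tail_quantile X (expR (s + u)).

Let mg s : measurable_fun setT (g s : measurableTypeR R -> measurableTypeR R).
Proof.
apply: (@measurable_comp _ _ _ (measurableTypeR R) (measurableTypeR R) (measurableTypeR R)
  `]0, +oo[%classic (tail_quantile X) setT (fun u => expR (s + u))) => //.
  by move=> _ [u _ <-]; rewrite /= in_itv/= expR_gt0.
by apply: (measurableT_comp (@measurable_expR R)); exact: measurable_funD.
Qed.

(** Two finite measures on the half-line above e agree on rays: for y >= e, U(e^(s + u)) > y means u
    > [tail_log] y - s, an event of exponential probability e^(s - tail_log y). Rays form a
    generating pi-system. *)
Lemma expectation_tail_transform (e : R) (phi : R -> \bar R) :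
  measurable_fun setT phi -> (forall x, 0 <= phi x)%E -> (forall x, x <= e -> phi x = 0%E) ->
  0 < tail_log e ->
  (\int[P]_w phi (X w) = (expR (- tail_log e))%:E *
    \int[exp_law]_(u in `[0%R, +oo[) phi (tail_quantile X (expR (tail_log e + u))))%E.
Proof.
move=> mphi phi0 phie s0; set s := tail_log e in s0 *.
pose I : set (measurableTypeR R) := `]e, +oo[%classic.
have mI : measurable I by exact: measurable_itv.
pose D : set (measurableTypeR R) := `[0%R, +oo[%classic.
have mD : measurable D by exact: measurable_itv.
have es0 : 0 <= expR (- s) by exact: expR_ge0.
pose gs : measurableTypeR R -> measurableTypeR R := g s.
have mgs : measurable_fun setT gs by exact: mg.
pose m2 : {measure set (measurableTypeR R) -> \bar R} := mscale (NngNum es0)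
  (measure_function_pushforward__canonical__measure_function_Measure exp_law mgs).
have key (y : R) : e <= y -> m2 `]y, +oo[%classic = ccdf X y.
  move=> ey; rewrite ccdf_tail_log.
  transitivity ((expR (- s))%:E * exp_law (gs @^-1` `]y, +oo[%classic))%E; first by [].
  have mB : measurable (gs @^-1` `]y, +oo[%classic).
    by rewrite -[X in measurable X]setTI; exact: (mg s).
  rewrite exp_law_setI_nonneg//.
  have sy : s <= tail_log y by exact: tail_log_homo.
  have -> : gs @^-1` `]y, +oo[ `&` `[0%R, +oo[%classic = `]tail_log y - s, +oo[%classic.
    apply/seteqP; split => u; rewrite /gs /g /= !in_itv/= !andbT.
      move=> [yu u0]; move: yu.
      rewrite (@tail_quantile_gt (s + u) _ _ _ (ccdf_tail_log y)); [lra|].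
      by rewrite ltr_wpDr.
    move=> yu; have su0 : 0 < s + u by lra.
    rewrite (tail_quantile_gt su0 (ccdf_tail_log y)); split; lra.
  rewrite exp_law_ray ?subr_ge0// -EFinM -expRD; congr (expR _)%:E; ring.
have mX : measurable_fun setT (X : T -> measurableTypeR R).
  have mX : measurable_fun setT X by [].
  exact: mX.
pose dX : {measure set (measurableTypeR R) -> \bar R} :=
  measure_function_pushforward__canonical__measure_function_Measure P mX.
(* The measures agree only above e, so both are first restricted to [I]; every ray then becomes one
   starting at or above e. *)
have meq (A : set (measurableTypeR R)) : measurable A -> A `<=` I ->
    dX A = m2 A.
  move=> mA AI.
  pose m1r : {measure set (measurableTypeR R) -> \bar R} := mrestr dX mI.
  pose m2r : {measure set (measurableTypeR R) -> \bar R} := mrestr m2 mI.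
  suff : m1r A = m2r A by rewrite /m1r /m2r /= /mrestr setIidl.
  pose rays n : set (measurableTypeR R) := `]- n%:R, +oo[%classic.
  refine (@measure_unique _ R (measurableTypeR R) (@RGenOInfty.G R) rays _ _ _ _ m1r m2r _ _ A mA).
  - exact: RGenOInfty.measurableE.
  - move=> _ _ [x ->] [y ->]; exists (Num.max x y).
    by apply/seteqP; split => u /=; rewrite !in_itv/= !andbT gt_max; [move=> [-> ->]|move=> /andP].
  - by move=> n; exists (- n%:R).
  - rewrite -subTset => x _; exists (Num.truncn `|x|).+1 => //=.
    rewrite /rays /= in_itv/= andbT ltrNl; apply: (le_lt_trans (ler_norm _)).
    by rewrite normrN truncnS_gt.
  - move=> _ [x ->].
    transitivity (dX (`]x, +oo[%classic `&` I)); first by [].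
    transitivity (m2 (`]x, +oo[%classic `&` I)); last by [].
    have -> : `]x, +oo[ `&` I = `]Num.max x e, +oo[%classic.
      by apply/seteqP; split => u; rewrite /I /= !in_itv/= !andbT gt_max; [move=> [-> ->]|move=> /andP].
    by rewrite key// le_max lexx orbT.
  - move=> n; apply: (@le_lt_trans _ _ 1%E); last exact: ltry.
    have mr : measurable (rays n) by exact: measurable_itv.
    have mrI : measurable (rays n `&` I) by exact: measurableI.
    exact: (probability_le1 P (measurable_funPTI X mrI)).
have vanish (mu : {measure set (measurableTypeR R) -> \bar R}) :
    (\int[mu]_x phi x = \int[mu]_(x in I) phi x)%E.
  rewrite [RHS]integral_mkcond; apply: eq_integral => x _.
  rewrite patchE; case: ifPn => // /negP xI; apply: phie; rewrite leNgt.
  by apply/negP => ex; apply: xI; rewrite inE /I /= in_itv/= ex.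
transitivity (\int[dX]_x phi x)%E.
  by rewrite (ge0_integral_pushforward mX P measurableT).
rewrite vanish (eq_measure_integral m2 meq) -vanish.
rewrite ge0_integral_mscale//=; congr (_ * _)%E.
rewrite ge0_integral_pushforward//= preimage_setT.
have N0 : exp_law (~` D) = 0%E.
  have := probability_setC exp_law mD; rewrite exp_law_nonneg subee//; exact.
rewrite (ge0_negligible_integral (measurableC mD) _ _ _ N0)//.
- by rewrite setDE setCK setTI.
- exact: measurableT_comp mphi mgs.
Qed.
End quantile_transform.

(** * Expectiles *)

(** As a function of z the loss has curvature 2 tau or 2 (1 - tau), at least 2 c. Half its
    derivative, tau z_+ - (1 - tau) z_-, is written with z_- = z_+ - z. *)
Lemma asymmetric_square_strongly_convex (R : realType) (tau c z dz : R) :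
  0 <= c -> c <= tau -> c <= 1 - tau ->
  tau * Num.max z 0 ^+ 2 + (1 - tau) * Num.max (- z) 0 ^+ 2 +
  (c * dz ^+ 2 - 2 * dz * ((2 * tau - 1) * Num.max z 0 + (1 - tau) * z)) <=
  tau * Num.max (z - dz) 0 ^+ 2 + (1 - tau) * Num.max (- (z - dz)) 0 ^+ 2.
Proof.
move=> c0 ct ct1.
have p1 : 0 <= (tau - c) * dz ^+ 2 by rewrite mulr_ge0 ?sqr_ge0// subr_ge0.
have p2 : 0 <= (1 - tau - c) * dz ^+ 2 by rewrite mulr_ge0 ?sqr_ge0// subr_ge0.
have p3 : 0 <= (tau - c) * (z - dz) ^+ 2 by rewrite mulr_ge0 ?sqr_ge0// subr_ge0.
have p4 : 0 <= (1 - tau - c) * (z - dz) ^+ 2 by rewrite mulr_ge0 ?sqr_ge0// subr_ge0.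
have mx (u : R) : 0 <= u -> Num.max u 0 = u by move=> u0; apply/max_l.
have mx0 (u : R) : u <= 0 -> Num.max u 0 = 0 by move=> u0; apply/max_r.
have /orP[z0|z0] := le_total 0 z; have /orP[d0|d0] := le_total 0 (z - dz).
- rewrite (mx z)// (mx0 (- z)) ?oppr_le0// (mx (z - dz))// (mx0 (- (z - dz))) ?oppr_le0//; nra.
- rewrite (mx z)// (mx0 (- z)) ?oppr_le0// (mx0 (z - dz)) // (mx (- (z - dz))); last by lra.
  have q : 0 <= dz ^+ 2 - (z - dz) ^+ 2 by nra.
  have : 0 <= (tau - c) * (dz ^+ 2 - (z - dz) ^+ 2) by rewrite mulr_ge0// subr_ge0.
  lra.
- rewrite (mx0 z) // (mx (- z)); last by lra.
  rewrite (mx (z - dz))// (mx0 (- (z - dz))) ?oppr_le0//.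
  have q : 0 <= dz ^+ 2 - (z - dz) ^+ 2 by nra.
  have : 0 <= (1 - tau - c) * (dz ^+ 2 - (z - dz) ^+ 2) by rewrite mulr_ge0// subr_ge0.
  lra.
- rewrite (mx0 z) // (mx (- z)); last by lra.
  rewrite (mx0 (z - dz)) // (mx (- (z - dz))); last by lra.
  nra.
Qed.

Section expectile.
Context d (T : measurableType d) (R : realType) (P : probability T R).
Variable X : {RV P >-> R}.
Hypotheses (iX : P.-integrable setT (EFin \o X))
           (iX2 : P.-integrable setT (EFin \o (fun w => X w ^+ 2))).

Definition mean : R := \int[P]_w X w.
Definition second_moment : R := \int[P]_w (X w ^+ 2).
Definition excess (x : R) : R := \int[P]_w Num.max (X w - x) 0.
Definition excess2 (x : R) : R := \int[P]_w (Num.max (X w - x) 0 ^+ 2).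

Lemma expectation_integrable (f : T -> R) : P.-integrable setT (EFin \o f) ->
  ('E_P[f] = (\int[P]_w f w)%:E)%E.
Proof.
move=> If; rewrite unlock /Rintegral fineK//.
exact: (integrable_fin_num measurableT If).
Qed.

Let mX : measurable_fun setT X. Proof. by []. Qed.

Let mXx (x : R) : measurable_fun setT (fun w => X w - x).
Proof. exact: measurable_funB. Qed.

Lemma integrable_bounded_by_sq (f : T -> R) (C : R) : measurable_fun setT f ->
  (forall w, `|f w| <= C * (1 + X w ^+ 2)) -> P.-integrable setT (EFin \o f).
Proof.
move=> mf fb.
have i1 : P.-integrable setT (EFin \o (fun w => C * (1 + X w ^+ 2))).
  have i0 : P.-integrable setT (EFin \o (fun=> 1 : R)) by exact: finite_measure_integrable_cst.
  exact: (integrableZl measurableT C (integrableD measurableT i0 iX2)).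
apply: (le_integrable measurableT _ _ i1); first exact/measurable_EFinP.
move=> w _ /=; rewrite lee_fin; apply: (le_trans (fb w)); exact: ler_norm.
Qed.

Lemma integrable_excess (x : R) :
  P.-integrable setT (EFin \o (fun w => Num.max (X w - x) 0)).
Proof.
apply: (@integrable_bounded_by_sq _ (1 + `|x|)).
  by apply: measurable_maxr.
move=> w; have h1 := sqr_ge0 (X w); have h2 := normr_ge0 x.
have h3 : - x <= `|x| by rewrite -normrN; exact: ler_norm.
have h4 : X w <= 1 + X w ^+ 2 by rewrite expr2; nra.
rewrite ger0_norm ?le_max ?lexx ?orbT//.
have h5 : 0 <= X w ^+ 2 * `|x| by rewrite mulr_ge0.
by case: (lerP (X w - x) 0) => h; nra.
Qed.

Lemma integrable_excess2 (x : R) :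
  P.-integrable setT (EFin \o (fun w => Num.max (X w - x) 0 ^+ 2)).
Proof.
apply: (@integrable_bounded_by_sq _ (2 * (1 + x ^+ 2))).
  by apply: measurable_funX; apply: measurable_maxr.
move=> w; rewrite ger0_norm ?sqr_ge0//.
have h1 := sqr_ge0 (X w); have h2 := sqr_ge0 x.
have h3 : 0 <= X w ^+ 2 * x ^+ 2 by rewrite mulr_ge0.
have h4 : (X w - x) ^+ 2 <= 2 * (X w ^+ 2 + x ^+ 2) by have := sqr_ge0 (X w + x); nra.
case: (lerP (X w - x) 0) => h; nra.
Qed.

Lemma integrable_deficit2 (x : R) :
  P.-integrable setT (EFin \o (fun w => Num.max (- (X w - x)) 0 ^+ 2)).
Proof.
apply: (@integrable_bounded_by_sq _ (2 * (1 + x ^+ 2))).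
  apply: measurable_funX; apply: measurable_maxr => //; exact: measurableT_comp.
move=> w; rewrite ger0_norm ?sqr_ge0//.
have h1 := sqr_ge0 (X w); have h2 := sqr_ge0 x.
have h3 : 0 <= X w ^+ 2 * x ^+ 2 by rewrite mulr_ge0.
have h4 : (X w - x) ^+ 2 <= 2 * (X w ^+ 2 + x ^+ 2) by have := sqr_ge0 (X w + x); nra.
case: (lerP (- (X w - x)) 0) => h; nra.
Qed.

Let i1 : P.-integrable setT (EFin \o (fun=> 1 : R)).
Proof. exact: finite_measure_integrable_cst. Qed.

Let icst (c : R) : P.-integrable setT (EFin \o (fun=> c)).
Proof. exact: finite_measure_integrable_cst. Qed.

Let Rint_cst (c : R) : \int[P]_w c = c.
Proof. by rewrite /Rintegral integral_cst//= probability_setT mule1. Qed.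

Lemma excess_homo (x y : R) : x <= y -> excess y <= excess x.
Proof.
move=> xy; apply: le_Rintegral; rewrite ?integrable_excess// => w _.
by rewrite ge_max !le_max lexx orbT andbT; apply/orP; left; lra.
Qed.

(** With [excess_homo] this makes [excess] 1-Lipschitz, whence the continuity of [foc]. *)
Lemma excess_Lipschitz (x y : R) : x <= y -> excess x <= excess y + (y - x).
Proof.
move=> xy; rewrite -[X in _ <= _ + X](Rint_cst (y - x)) -RintegralD//; last exact: integrable_excess.
apply: le_Rintegral.
- by [].
- exact: integrable_excess.
- apply: (@integrableD _ _ _ _ _ measurableT (EFin \o _) (EFin \o _)) => //; exact: integrable_excess.
- move=> w _; case: (lerP (X w - x) 0); case: (lerP (X w - y) 0); lra.
Qed.

Lemma excess_ge0 x : 0 <= excess x.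
Proof. by apply: Rintegral_ge0 => w _; rewrite le_max lexx orbT. Qed.

Let loss (tau x : R) (w : T) : R :=
  tau * Num.max (X w - x) 0 ^+ 2 + (1 - tau) * Num.max (- (X w - x)) 0 ^+ 2.

Let iloss (tau x : R) : P.-integrable setT (EFin \o loss tau x).
Proof.
apply: (@integrableD _ _ _ _ _ measurableT (EFin \o (fun w => tau * _)) (EFin \o (fun w => (1 - tau) * _))).
  exact: (integrableZl measurableT tau (integrable_excess2 x)).
exact: (integrableZl measurableT (1 - tau) (integrable_deficit2 x)).
Qed.

Lemma expectile_lossE tau x : expectile_loss X tau x = (\int[P]_w loss tau x w)%:E.
Proof. exact: (expectation_integrable (iloss tau x)). Qed.

(** The gradient with the negative part eliminated, so that it involves the left tail only through
    the mean. *)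
Definition foc (tau x : R) : R := (2 * tau - 1) * excess x - (1 - tau) * (x - mean).

Let igrad (tau x : R) : P.-integrable setT
  (EFin \o (fun w => (2 * tau - 1) * Num.max (X w - x) 0 + (1 - tau) * (X w - x))).
Proof.
apply: (@integrableD _ _ _ _ _ measurableT (EFin \o (fun w => _ * _)) (EFin \o (fun w => _ * _))).
  exact: (integrableZl measurableT _ (integrable_excess x)).
exact: (integrableZl measurableT (1 - tau) (integrableB measurableT iX (icst x))).
Qed.

Let focE (tau x : R) :
  \int[P]_w ((2 * tau - 1) * Num.max (X w - x) 0 + (1 - tau) * (X w - x)) = foc tau x.
Proof.
rewrite RintegralD//; last first.
- exact: (integrableZl measurableT (1 - tau) (integrableB measurableT iX (icst x))).
- exact: (integrableZl measurableT _ (integrable_excess x)).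
rewrite RintegralZl//; last exact: integrable_excess.
rewrite RintegralZl//; last exact: (integrableB measurableT iX (icst x)).
rewrite RintegralB// Rint_cst /foc /excess /mean; ring.
Qed.

(* The loss is strongly convex, with derivative - 2 * foc, so that a zero of
   foc is the unique minimiser. *)
Lemma loss_strongly_convex (tau x y : R) : 0 < tau < 1 ->
  \int[P]_w loss tau x w + (Num.min tau (1 - tau) * (y - x) ^+ 2 - 2 * (y - x) * foc tau x)
    <= \int[P]_w loss tau y w.
Proof.
move=> /andP[t0 t1]; set c := Num.min _ _.
have c0 : 0 <= c by rewrite le_min; lra.
have ct : c <= tau by rewrite ge_min lexx.
have ct1 : c <= 1 - tau by rewrite ge_min lexx orbT.
rewrite -[X in _ + X](_ : \int[P]_w (c * (y - x) ^+ 2 + (- (2 * (y - x))) *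
   ((2 * tau - 1) * Num.max (X w - x) 0 + (1 - tau) * (X w - x))) = _); last first.
  rewrite RintegralD//; last exact: (integrableZl measurableT _ (igrad tau x)).
  rewrite Rint_cst; congr (_ + _).
  rewrite (RintegralZl (- (2 * (y - x))) measurableT (igrad tau x)).
  by rewrite focE mulNr.
rewrite -RintegralD//; last first.
  apply: (@integrableD _ _ _ _ _ measurableT (EFin \o (fun w => _)) (EFin \o (fun w => _ * _))) => //.
  exact: (integrableZl measurableT _ (igrad tau x)).
apply: le_Rintegral => //.
  apply: (@integrableD _ _ _ _ _ measurableT (EFin \o (fun w => _)) (EFin \o (fun w => _))) => //.
  apply: (@integrableD _ _ _ _ _ measurableT (EFin \o (fun w => _)) (EFin \o (fun w => _ * _))) => //.
  exact: (integrableZl measurableT _ (igrad tau x)).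
move=> w _; rewrite /loss.
have := asymmetric_square_strongly_convex (X w - x) (y - x) c0 ct ct1.
by rewrite mulNr (_ : X w - x - (y - x) = X w - y)//; ring.
Qed.

Lemma foc_root (tau : R) : 1 / 2 < tau < 1 -> exists x, foc tau x = 0.
Proof.
move=> /andP[t1 t2].
(* Chosen so that (1 - tau) (b - mean) = (2 tau - 1) [excess] mean, which dominates (2 tau - 1)
   [excess] b because b >= mean. *)
pose b := mean + (2 * tau - 1) * excess mean / (1 - tau).
have e0 := excess_ge0 mean.
have ab : mean <= b by rewrite lerDl divr_ge0 ?mulr_ge0//; lra.
have cf : {within `[mean, b], continuous (foc tau)}.
  apply: continuous_subspaceT => x; apply/cvgrPdist_le => e e1.
  have e2 : 0 < e / 2 by lra.
  near=> y.
  have xy : `|x - y| <= e / 2 by near: y; exact: cvgr_dist_le.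
  have exy : `|excess x - excess y| <= `|x - y|.
    case: (leP x y) => xy'.
      have h1 := excess_homo xy'; have h2 := excess_Lipschitz xy'.
      rewrite ger0_norm; last by lra.
      rewrite ler0_norm; lra.
    have h1 := excess_homo (ltW xy'); have h2 := excess_Lipschitz (ltW xy').
    rewrite ler0_norm; last by lra.
    rewrite ger0_norm; lra.
  have -> : foc tau x - foc tau y =
    (2 * tau - 1) * (excess x - excess y) - (1 - tau) * (x - y) by rewrite /foc; ring.
  apply: (le_trans (ler_normB _ _)); rewrite !normrM.
  have -> : `|2 * tau - 1| = 2 * tau - 1 by rewrite ger0_norm//; lra.
  have -> : `|1 - tau| = 1 - tau by rewrite ger0_norm//; lra.
  nra.
have fb : foc tau b <= 0.
  have h1 : (1 - tau) * (b - mean) = (2 * tau - 1) * excess mean.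
    by rewrite /b addrAC subrr add0r mulrC divfK//; lra.
  have := excess_homo ab; rewrite /foc h1; nra.
have fa : 0 <= foc tau mean by rewrite /foc; nra.
have [|c _ fc] := @IVT R (foc tau) mean b 0 ab cf; last by exists c.
by rewrite ge_min le_max fa fb orbT.
Unshelve. all: by end_near. Qed.

Lemma expectile_foc (tau : R) : 1 / 2 < tau < 1 -> foc tau (expectile X tau) = 0.
Proof.
move=> tau12; have [x fx] := foc_root tau12.
have tau01 : 0 < tau < 1 by lra.
have c0 : 0 < Num.min tau (1 - tau) by rewrite lt_min; lra.
suff -> : expectile X tau = x by [].
(* Uniqueness of the minimiser pins down the choice made by [xget]. *)
rewrite /expectile; apply: xget_unique.
  move=> y; rewrite !expectile_lossE lee_fin.
  have := loss_strongly_convex x y tau01; rewrite fx.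
  have := sqr_ge0 (y - x); nra.
move=> y /(_ x); rewrite !expectile_lossE lee_fin => yx.
have := loss_strongly_convex x y tau01; rewrite fx => H.
apply/eqP; rewrite -subr_eq0 -sqrf_eq0 eq_le sqr_ge0 andbT.
by rewrite -(pmulr_rle0 _ c0); lra.
Qed.

(** Since z_-^2 = z^2 - z_+^2, the left part is replaced by raw moments. *)
Lemma deviatileE (tau : R) : let e := expectile X tau in
  deviatile X tau = Num.sqrt (tau / (1 - tau) * excess2 e +
    (second_moment - 2 * e * mean + e ^+ 2 - excess2 e)).
Proof.
move=> e; rewrite /deviatile -/e; congr Num.sqrt.
rewrite (_ : 'E_P[_] = (excess2 e)%:E)%E; last first.
  exact: (expectation_integrable (integrable_excess2 e)).
congr (_ + _).
rewrite (_ : 'E_P[_] = (\int[P]_w (Num.max (- (X w - e)) 0 ^+ 2))%:E)%E; last first.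
  exact: (expectation_integrable (integrable_deficit2 e)).
rewrite /=; apply/(addIr (excess2 e)); rewrite subrK.
rewrite -RintegralD//; [|exact: integrable_deficit2|exact: integrable_excess2].
transitivity (\int[P]_w (X w ^+ 2 + ((- (2 * e)) * X w + e ^+ 2))).
  apply: eq_Rintegral => w _.
  case: (lerP (- (X w - e)) 0) => h1; case: (lerP (X w - e) 0) => h2;
    [have -> : X w = e by lra | ring | ring | lra].
  ring.
have i3 : P.-integrable setT (EFin \o (fun w => - (2 * e) * X w)).
  exact: (integrableZl measurableT _ iX).
rewrite RintegralD//; last exact: (integrableD measurableT i3 (icst _)).
rewrite RintegralD// Rint_cst RintegralZl// /second_moment /mean; ring.
Qed.

End expectile.

(** * Partial moments above a level as exponential moments *)

Section excess_moments.
Context d (T : measurableType d) (R : realType) (P : probability T R).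
Variables (X : {RV P >-> R}) (gamma : R).
Hypotheses (Fpos : forall x, (0 < ccdf X x)%E)
  (mU : measurable_fun (`]0, +oo[ : set R) (tail_quantile X)).

Local Notation U := (tail_quantile X).
Local Notation D := (`[0%R, +oo[%classic).

Definition log_tail (s : R) : R := ln (U (expR s)) - gamma * s.

Definition tail_ratio (s u : R) : R := expR (gamma * u + (log_tail (s + u) - log_tail s)).

Lemma tail_ratioE (s u : R) : 0 < U (expR s) -> 0 < U (expR (s + u)) ->
  U (expR (s + u)) = U (expR s) * tail_ratio s u.
Proof.
rewrite /tail_ratio /log_tail; move: (U (expR s)) (U (expR (s + u))) => V1 V2 V10 V20.
have -> : gamma * u + (ln V2 - gamma * (s + u) - (ln V1 - gamma * s)) = ln V2 - ln V1 by ring.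
by rewrite expRB !lnK ?posrE// mulrC divfK// gt_eqF.
Qed.

Lemma measurable_log_tail : measurable_fun setT log_tail.
Proof.
apply: measurable_funB; last exact: measurable_funM.
apply: (measurableT_comp (@measurable_ln R)).
apply: (@measurable_comp _ _ _ R R R `]0, +oo[%classic U setT expR) => //.
by move=> _ [u _ <-]; rewrite /= in_itv/= expR_gt0.
Qed.

Definition tail_moment (p s : R) : R :=
  \int[exp_law]_(u in D) expR (p * (gamma * u + (log_tail (s + u) - log_tail s))).

Section at_level.
Variables (e : R).
Let s := tail_log X e.
Hypotheses (s_gt0 : 0 < s) (Upos : forall u, 0 <= u -> 0 < U (expR (s + u))).
Hypotheses
  (i1 : exp_law.-integrable D (fun u => (expR (1 * (gamma * u + (log_tail (s + u) - log_tail s))))%:E))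
  (i2 : exp_law.-integrable D (fun u => (expR (2 * (gamma * u + (log_tail (s + u) - log_tail s))))%:E)).

Let mD : measurable (D : set (measurableTypeR R)). Proof. exact: measurable_itv. Qed.

Lemma tail_quantile_excess u : 0 < u -> e < U (expR (s + u)).
Proof.
move=> u0; have su : 0 < s + u by rewrite addr_gt0.
by rewrite (tail_quantile_gt su (ccdf_tail_log Fpos e)) ltrDl.
Qed.

(** With [tail_quantile_excess] this traps e between U(e^s) and U(e^(s + u)), u > 0; the inequality
    is strict when F is flat to the left of e. *)
Lemma tail_quantile_le_level : U (expR s) <= e.
Proof.
by rewrite leNgt (tail_quantile_gt s_gt0 (ccdf_tail_log Fpos e)) ltxx.
Qed.

Let W u := tail_ratio s u.

Let UW u : 0 <= u -> U (expR (s + u)) = U (expR s) * W u.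
Proof.
by move=> u0; apply: tail_ratioE; [have := Upos (lexx 0); rewrite addr0|exact: Upos].
Qed.

Let iW : exp_law.-integrable D (EFin \o W).
Proof. by move: i1; congr (_.-integrable _ _); apply/funext => u; rewrite mul1r. Qed.

Let iW2 : exp_law.-integrable D (EFin \o (fun u => W u ^+ 2)).
Proof. by move: i2; congr (_.-integrable _ _); apply/funext => u; rewrite expRM_natl. Qed.

Let ic (c : R) : exp_law.-integrable D (EFin \o (fun=> c)).
Proof.
apply: (integrableS measurableT) => //; exact: finite_measure_integrable_cst.
Qed.

Let Rc (c : R) : \int[exp_law]_(u in D) c = c.
Proof.
rewrite /Rintegral integral_cst// [X in (_ * X)%E](_ : _ = 1%E) ?mule1//.
exact: exp_law_nonneg.
Qed.

Let tm1 : tail_moment 1 s = \int[exp_law]_(u in D) W u.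
Proof. by apply: eq_Rintegral => u _; rewrite mul1r. Qed.

Let tm2 : tail_moment 2 s = \int[exp_law]_(u in D) (W u ^+ 2).
Proof. by apply: eq_Rintegral => u _; rewrite expRM_natl. Qed.

Let exp_law_set1 (x : measurableTypeR R) : exp_law [set x] = 0%E.
Proof.
have /null_content_dominatesP H := @exp_law_dom R; apply: H.
  exact: measurable_set1.
exact: lebesgue_measure_set1.
Qed.

Let excess_integral (k : nat) (f : R -> R) : (0 < k)%N ->
  (forall u, 0 <= u -> f u = (U (expR (s + u)) - e) ^+ k) ->
  exp_law.-integrable D (EFin \o f) ->
  (\int[P]_w (Num.max (X w - e) 0 ^+ k)%:E =
   (expR (- s) * \int[exp_law]_(u in D) f u)%:E)%E.
Proof.
move=> k0 fE If.
pose phi (x : R) : \bar R := (Num.max (x - e) 0 ^+ k)%:E.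
have mphi : measurable_fun setT phi.
  apply/measurable_EFinP; apply: measurable_funX; apply: measurable_maxr => //.
  exact: measurable_funB.
rewrite (expectation_tail_transform Fpos mU mphi _ _ s_gt0).
- rewrite EFinM; congr (_ * _)%E.
  have If' : (\int[exp_law]_(u in D) (f u)%:E)%E \is a fin_num by exact: (integrable_fin_num mD If).
  rewrite /Rintegral fineK//.
  pose N : set (measurableTypeR R) := [set 0 : R].
  have mN : measurable N by exact: measurable_set1.
  have mg : measurable_fun (D : set (measurableTypeR R)) (fun u : measurableTypeR R => phi (U (expR (s + u)))).
    apply: (measurable_funS measurableT) => //.
    apply: (measurableT_comp mphi).
    apply: (@measurable_comp _ _ _ (measurableTypeR R) (measurableTypeR R) (measurableTypeR R)
      `]0, +oo[%classic U setT (fun u => expR (s + u))) => //.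
      by move=> _ [u _ <-]; rewrite /= in_itv/= expR_gt0.
    by apply: (measurableT_comp (@measurable_expR R)); exact: measurable_funD.
  rewrite (ge0_negligible_integral mN mD mg _ (exp_law_set1 0)); last first.
    by move=> u _; rewrite lee_fin exprn_ge0// le_max lexx orbT.
  rewrite (negligible_integral mN mD If (exp_law_set1 0)).
  apply: eq_integral => u; rewrite inE => -[/=]; rewrite in_itv/= andbT => u0 uN.
  have u1 : 0 < u by rewrite lt_neqAle u0 andbT eq_sym; apply/eqP.
  rewrite /phi fE// max_l// subr_ge0; exact/ltW/tail_quantile_excess.
- by move=> x; rewrite lee_fin exprn_ge0// le_max lexx orbT.
- by move=> x xe; rewrite /phi max_r ?subr_le0// expr0n eqn0Ngt k0.
Qed.

Lemma excess_level : excess X e = expR (- s) * (U (expR s) * tail_moment 1 s - e).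
Proof.
have If : exp_law.-integrable D (EFin \o (fun u => U (expR s) * W u - e)).
  exact: (integrableB mD (integrableZl mD (U (expR s)) iW) (ic e)).
have := @excess_integral 1 (fun u => U (expR s) * W u - e) isT _ If.
rewrite /excess /Rintegral => ->; last by move=> u u0; rewrite UW.
transitivity (expR (- s) * \int[exp_law]_(u in D) (U (expR s) * W u - e)); first by [].
have iA : exp_law.-integrable D (EFin \o (fun u => U (expR s) * W u)).
  exact: (integrableZl mD (U (expR s)) iW).
by rewrite (RintegralB mD iA (ic e)) Rc (RintegralZl _ mD iW) tm1.
Qed.

Let iA2 : exp_law.-integrable D (EFin \o (fun u => U (expR s) ^+ 2 * W u ^+ 2)).
Proof. exact: (integrableZl mD (U (expR s) ^+ 2) iW2). Qed.

Let iB1 : exp_law.-integrable D (EFin \o (fun u => - (2 * e * U (expR s)) * W u)).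
Proof. exact: (integrableZl mD (- (2 * e * U (expR s))) iW). Qed.

Let iB2 : exp_law.-integrable D (EFin \o (fun u => - (2 * e * U (expR s)) * W u + e ^+ 2)).
Proof. exact: (integrableD mD iB1 (ic (e ^+ 2))). Qed.

Let If2 : exp_law.-integrable D (EFin \o (fun u => U (expR s) ^+ 2 * W u ^+ 2 + (- (2 * e * U (expR s)) * W u + e ^+ 2))).
Proof. exact: (integrableD mD iA2 iB2). Qed.

Let excess2_int : (\int[P]_w (Num.max (X w - e) 0 ^+ 2)%:E =
  (expR (- s) * (U (expR s) ^+ 2 * tail_moment 2 s - 2 * e * U (expR s) * tail_moment 1 s + e ^+ 2))%:E)%E.
Proof.
rewrite (@excess_integral 2 _ isT _ If2); last by move=> u u0; rewrite UW//; ring.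
congr (_ * _)%:E.
rewrite (RintegralD mD iA2 iB2) (RintegralD mD iB1 (ic _)) Rc.
by rewrite (RintegralZl _ mD iW2) (RintegralZl _ mD iW) addrA mulNr tm1 tm2.
Qed.

Lemma excess2_level : excess2 X e = expR (- s) *
  (U (expR s) ^+ 2 * tail_moment 2 s - 2 * e * U (expR s) * tail_moment 1 s + e ^+ 2).
Proof. by rewrite /excess2 /Rintegral excess2_int. Qed.

(** Stated for the extended integral, so that square integrability of the right tail follows from it
    and is not presupposed. *)
Lemma excess2_finite : (\int[P]_w (Num.max (X w - e) 0 ^+ 2)%:E < +oo)%E.
Proof. by rewrite excess2_int ltry. Qed.

End at_level.
End excess_moments.

(** * Regularly varying tails *)

Lemma sqrtr_expR (R : realType) (x : R) : 0 < x -> Num.sqrt x = expR (2^-1 * ln x).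
Proof.
move=> x0; apply/eqP; rewrite -(@eqrXn2 _ 2)// ?sqrtr_ge0 ?expR_ge0// sqr_sqrtr ?(ltW x0)//.
by rewrite -expRM_natl mulrA divff// mul1r lnK.
Qed.

(** Peano remainder with value 0 at h = 0: the expansion is exact for every h, so increments that
    vanish need no separate treatment. *)
Lemma derive_remainder (R : realType) (f : R -> R) (y l : R) : is_derive y 1 f l ->
  exists psi : R -> R, psi h @[h --> (0 : R)] --> (0 : R) /\
    forall h, f (y + h) = f y + h * (l + psi h).
Proof.
move=> df; exists (fun h => if h == 0 then 0 else (f (y + h) - f y) / h - l); split; last first.
  move=> h; case: eqP => [->|/eqP h0]; first by rewrite addr0 mul0r addr0.
  by rewrite subrKC mulrC divfK// subrKC.
have /cvg_ex[l' Hl'] : cvg (h^-1 *: ((f \o shift y) (h *: 1) - f y) @[h --> 0^']).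
  exact: (@ex_derive _ _ _ _ _ _ _ df).
have l'E : l' = l.
  have := @derive_val _ _ _ _ _ _ _ df; rewrite /derive => <-.
  by apply/esym/cvg_lim.
move: Hl'; rewrite l'E => /cvgrPdist_lt H.
apply/cvgrPdist_lt => e e0.
have /(@nbhs_ballP R R^o 0)[d /= d0 Hd] := H e e0.
have hd : \forall h \near (0 : R), `|h| < d.
  have id0 : h @[h --> (0 : R)] --> (0 : R) by exact: cvg_id.
  by move/cvgr0Pnorm_lt : id0 => /(_ d d0).
near=> h; case: eqP => [_|/eqP h0]; first by rewrite subr0 normr0.
rewrite sub0r normrN distrC.
have : ball 0 d h.
  by rewrite /ball/= sub0r normrN; near: h.
move=> /Hd /(_ h0); rewrite /= /shift/= /GRing.scale/= mulr1 [h + y]addrC.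
by rewrite [h^-1 * _]mulrC.
Unshelve. all: by end_near. Qed.

(** * Calculus of limits at a given rate *)

Section rate.
Context (R : realType) (r : nat -> R).
Hypothesis ry : r n @[n --> \oo] --> +oo.
Implicit Types (x y : nat -> R).

Lemma rate_cvg x (x0 al : R) : r n * (x n - x0) @[n --> \oo] --> al -> x n @[n --> \oo] --> x0.
Proof.
move=> H.
have rV : (r n)^-1 @[n --> \oo] --> 0 by apply/gtr0_cvgV0 => //; move/cvgryPgt : ry; exact.
have H2 : r n * (x n - x0) * (r n)^-1 + x0 @[n --> \oo] --> x0.
  by rewrite -[X in _ --> X]add0r -[X in _ --> X + _](mulr0 al); apply: cvgD; [exact: cvgM|exact: cvg_cst].
apply: (cvg_near_eq H2); near=> n.
have r0 : 0 < r n by near: n; move/cvgryPgt : ry; exact.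
by rewrite mulrAC divff ?gt_eqF// mul1r subrK.
Unshelve. all: by end_near. Qed.

(** Deterministic delta method, the source of the rules for [ln] and the inverse. *)
Lemma rate_comp (f : R -> R) x (x0 l al : R) : is_derive x0 1 f l ->
  r n * (x n - x0) @[n --> \oo] --> al -> r n * (f (x n) - f x0) @[n --> \oo] --> l * al.
Proof.
move=> df H; have [psi [psi0 fE]] := derive_remainder df.
have x0' : x n - x0 @[n --> \oo] --> 0.
  by rewrite -[X in _ --> X](subrr x0); apply: cvgB; [exact: rate_cvg H|exact: cvg_cst].
have H2 : r n * (x n - x0) * (l + psi (x n - x0)) @[n --> \oo] --> l * al.
  have -> : l * al = al * (l + 0) by rewrite addr0 mulrC.
  apply: cvgM => //.
  by apply: cvgD; [exact: cvg_cst|exact: cvg_comp x0' psi0].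
apply: (cvg_near_eq H2); near=> n.
by have := fE (x n - x0); rewrite subrKC => ->; ring.
Unshelve. all: by end_near. Qed.

Lemma rateD x y (x0 y0 al be : R) : r n * (x n - x0) @[n --> \oo] --> al ->
  r n * (y n - y0) @[n --> \oo] --> be ->
  r n * (x n + y n - (x0 + y0)) @[n --> \oo] --> al + be.
Proof.
move=> Hx Hy; apply: (cvg_near_eq (cvgD Hx Hy)); near=> n => /=; ring.
Unshelve. all: by end_near. Qed.

Lemma rateZ x (c x0 al : R) : r n * (x n - x0) @[n --> \oo] --> al ->
  r n * (c * x n - c * x0) @[n --> \oo] --> c * al.
Proof.
move=> Hx; have H : c * (r n * (x n - x0)) @[n --> \oo] --> c * al by exact: cvgMr.
apply: (cvg_near_eq H); near=> n => /=; ring.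
Unshelve. all: by end_near. Qed.

Lemma rateM x y (x0 y0 al be : R) : r n * (x n - x0) @[n --> \oo] --> al ->
  r n * (y n - y0) @[n --> \oo] --> be ->
  r n * (x n * y n - x0 * y0) @[n --> \oo] --> al * y0 + x0 * be.
Proof.
move=> Hx Hy; have yy := rate_cvg Hy.
have H : r n * (x n - x0) * y n + x0 * (r n * (y n - y0)) @[n --> \oo] --> al * y0 + x0 * be.
  by apply: cvgD; [exact: cvgM|exact: cvgMr].
apply: (cvg_near_eq H); near=> n => /=; ring.
Unshelve. all: by end_near. Qed.

Lemma rate_cst (c : R) : r n * (c - c) @[n --> \oo] --> (0 : R).
Proof. by under eq_fun do rewrite subrr mulr0; exact: cvg_cst. Qed.

Lemma rate_ln x (x0 al : R) : 0 < x0 -> r n * (x n - x0) @[n --> \oo] --> al ->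
  r n * (ln (x n) - ln x0) @[n --> \oo] --> x0^-1 * al.
Proof. by move=> x00; apply: rate_comp; exact: is_derive1_ln. Qed.

Lemma rate_inv x (x0 al : R) : x0 != 0 -> r n * (x n - x0) @[n --> \oo] --> al ->
  r n * ((x n)^-1 - x0^-1) @[n --> \oo] --> - x0 ^- 2 * al.
Proof.
move=> x00; apply: rate_comp.
have := @is_deriveV R id x0 1 1 x00 (is_derive_id x0 1).
by rewrite /GRing.scale/= mulr1.
Qed.

End rate.

(** * Growth of the tail quantile function and finiteness of moments *)

Section regularly_varying_tail.
Context d (T : measurableType d) (R : realType) (P : probability T R).
Variables (X : {RV P >-> R}) (gamma rho : R) (A : R -> R).
Hypotheses (gamma_gt0 : 0 < gamma) (gamma_lt : gamma < 2^-1)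
  (U_2RV : second_order_RV gamma rho A (tail_quantile X)).
Hypothesis X_neg2 : ('E_P[(fun w => (((X : T -> R)^\- w) ^+ 2)%R)] < +oo)%E.

Local Notation U := (tail_quantile X).
Local Notation l := (log_tail X gamma).

Let rho0 : rho <= 0. Proof. by case: U_2RV. Qed.

Let mU : measurable_fun (`]0, +oo[ : set R) U.
Proof. by case: U_2RV => _ []. Qed.

Lemma tail_quantile_pos : \forall s \near +oo, forall u, 0 <= u -> 0 < U (expR (s + u)).
Proof.
have [_ [_ H] _ _ _] := U_2RV.
have H2 : \forall s \near +oo, 0 < U (expR s) by exact: (@cvgry_expR R) _ H.
exact: near_pinfty_translate H2.
Qed.

Lemma log_tail_aux : exists2 a : R -> R,
  a s / A (expR s) @[s --> +oo] --> (1 : R) & second_order_aux rho l a.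
Proof.
have [_ [_ _] Asgn A0 _] := U_2RV.
apply: (@second_order_aux_exists R l (fun s => A (expR s)) rho rho0) => //.
- exact: measurable_log_tail.
- exact: cvg_comp (@cvgry_expR R) A0.
- by case: Asgn => Asgn; [left|right]; exact: (@cvgry_expR R) _ Asgn.
- by move=> u u0; exact: ln_second_order U_2RV u0.
Qed.

(** The linear bound of [second_order_aux], started at a fixed point; it says that U(t) = t^(gamma +
    o(1)). *)
Lemma log_tail_growth (dl : R) : 0 < dl -> exists K : R,
  \forall s \near +oo, `|ln (U (expR s)) - gamma * s| <= dl * s + K.
Proof.
move=> dl0; have [a _ [_ _ _ _ lb]] := log_tail_aux.
have [C /near_pinftyP[M HM]] := lb dl dl0.
exists (`|l M| + dl + dl * `|M|); near=> s.
have Ms : M <= s by near: s; apply: nbhs_pinfty_ge; rewrite num_real.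
have [_ h] := HM M (lexx _) (s - M) (ltac:(rewrite subr_ge0; exact: Ms)).
rewrite subrKC in h.
rewrite -[X in `|X|]/(l s); have -> : l s = (l s - l M) + l M by ring.
apply: (le_trans (ler_normD _ _)).
have : - M <= `|M| by rewrite -normrN; exact: ler_norm.
nra.
Unshelve. all: by end_near. Qed.

Lemma tail_quantile_cvgy : U (expR s) @[s --> +oo] --> +oo.
Proof.
have g2 : 0 < gamma / 2 by rewrite divr_gt0.
have [K HK] := log_tail_growth g2.
have H : expR (gamma / 2 * s - K) @[s --> +oo] --> +oo.
  apply: (@cvg_comp _ _ _ (fun s => gamma / 2 * s - K) expR); last exact: cvgry_expR.
  have H : gamma / 2 * s @[s --> +oo] --> +oo by exact: gt0_cvgMry.
  apply/cvgryPge => M; near=> s; rewrite lerBrDr; near: s.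
  by move/cvgryPge : H; exact.
apply/cvgryPge => M; near=> s.
have Us : 0 < U (expR s).
  have : forall u, 0 <= u -> 0 < U (expR (s + u)) by near: s; exact: tail_quantile_pos.
  by move=> /(_ 0 (lexx _)); rewrite addr0.
have h1 : M <= expR (gamma / 2 * s - K) by near: s; move/cvgryPge : H; exact.
apply: (le_trans h1); rewrite -[leRHS]lnK// ler_expR.
have : `|ln (U (expR s)) - gamma * s| <= gamma / 2 * s + K by near: s.
rewrite ler_norml => /andP[]; lra.
Unshelve. all: by end_near. Qed.

(** Gives q_tau (1 - tau) -> 0, which makes errors of order 1 - tau negligible against 1 / q_tau. *)
Lemma tail_quantile_expN_cvg0 : U (expR s) * expR (- s) @[s --> +oo] --> (0 : R).
Proof.
have g2 : 0 < (1 - gamma) / 2.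
  by rewrite divr_gt0// subr_gt0; move: gamma_lt; lra.
have [K HK] := log_tail_growth g2.
have H : expR K * expR (- ((1 - gamma) / 2) * s) @[s --> +oo] --> (0 : R).
  by rewrite -[X in _ --> X](mulr0 (expR K)); apply: cvgMr; exact: expR_cvg0.
apply: cvg_norm_le0 H; near=> s.
have Us : 0 < U (expR s).
  have : forall u, 0 <= u -> 0 < U (expR (s + u)) by near: s; exact: tail_quantile_pos.
  by move=> /(_ 0 (lexx _)); rewrite addr0.
rewrite gtr0_norm ?mulr_gt0 ?expR_gt0// -{1}(lnK Us) -!expRD ler_expR.
have : `|ln (U (expR s)) - gamma * s| <= (1 - gamma) / 2 * s + K by near: s.
rewrite ler_norml => /andP[]; lra.
Unshelve. all: by end_near. Qed.

(** U is unbounded, so some U(e^s) exceeds x and F(x) < 1 - e^(-s). *)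
Lemma ccdf_pos (x : R) : (0 < ccdf X x)%E.
Proof.
have [s [s0 xs]] : exists s, 0 < s /\ x < U (expR s).
  near (pinfty_nbhs R) => s; exists s; split.
    by near: s; apply: nbhs_pinfty_gt; rewrite num_real.
  by near: s; move/cvgryPgt : tail_quantile_cvgy; exact.
move: xs; rewrite ltNge tail_quantileE quantile_le; last first.
  have : expR (- s) < 1 by rewrite -expR0 ltr_expR oppr_lt0.
  by have := expR_gt0 (- s); lra.
rewrite -ltNge ccdf_1_cdf => h; rewrite sube_gt0.
apply: (lt_trans h); rewrite lte_fin gtrBl; exact: expR_gt0.
Unshelve. all: by end_near. Qed.

Lemma tail_log_cvgy : tail_log X x @[x --> +oo] --> +oo.
Proof.
apply/cvgryPge => M; near (pinfty_nbhs R) => s; near=> x.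
have s0 : 0 < s by near: s; apply: nbhs_pinfty_gt; rewrite num_real.
have Ms : M <= s by near: s; apply: nbhs_pinfty_ge; rewrite num_real.
apply: (le_trans Ms); rewrite leNgt -(tail_quantile_gt s0 (ccdf_tail_log ccdf_pos x)) -leNgt.
by near: x; apply: nbhs_pinfty_ge; rewrite num_real.
Unshelve. all: by end_near. Qed.

Let ml : measurable_fun setT l. Proof. exact: measurable_log_tail. Qed.

Lemma level_regular : \forall s \near +oo, [/\ 0 < s,
  forall u, 0 <= u -> 0 < U (expR (s + u)),
  exp_law.-integrable `[0%R, +oo[ (fun u => (expR (1 * (gamma * u + (l (s + u) - l s))))%:E) &
  exp_law.-integrable `[0%R, +oo[ (fun u => (expR (2 * (gamma * u + (l (s + u) - l s))))%:E)].
Proof.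
have [a _ la] := log_tail_aux.
have g1 : 1 * gamma < 1 by rewrite mul1r; move: gamma_lt; lra.
have g2 : 2 * gamma < 1 by move: gamma_lt; lra.
near=> s; split; near: s.
- by apply: nbhs_pinfty_gt; rewrite num_real.
- exact: tail_quantile_pos.
- exact: exp_moment_integrable ml la.
- exact: exp_moment_integrable ml la.
Unshelve. all: by end_near. Qed.

Lemma square_integrable : P.-integrable setT (EFin \o (fun w => X w ^+ 2)).
Proof.
have mX : measurable_fun setT X by [].
near (pinfty_nbhs R) => e.
have e0 : 0 <= e by near: e; apply: nbhs_pinfty_ge; rewrite num_real.
have [s0 Up i1 i2] : [/\ 0 < tail_log X e,
  forall u, 0 <= u -> 0 < U (expR (tail_log X e + u)),
  exp_law.-integrable `[0%R, +oo[ (fun u => (expR (1 * (gamma * u + (l (tail_log X e + u) - l (tail_log X e)))))%:E) &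
  exp_law.-integrable `[0%R, +oo[ (fun u => (expR (2 * (gamma * u + (l (tail_log X e + u) - l (tail_log X e)))))%:E)].
  near: e; exact: tail_log_cvgy _ level_regular.
have h1 := excess2_finite ccdf_pos mU s0 Up i1 i2.
have I1 : P.-integrable setT (EFin \o (fun w => Num.max (X w - e) 0 ^+ 2)).
  apply/integrableP; split.
    apply/measurable_EFinP; apply: measurable_funX; apply: measurable_maxr => //.
    exact: measurable_funB.
  by under eq_integral do rewrite /= ger0_norm ?sqr_ge0//.
have I2 : P.-integrable setT (EFin \o (fun w => X^\- w ^+ 2)).
  apply/integrableP; split.
    by apply/measurable_EFinP; apply: measurable_funX; exact: measurable_funrneg.
  by under eq_integral do rewrite /= ger0_norm ?sqr_ge0//; move: X_neg2; rewrite unlock.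
have I3 : P.-integrable setT (EFin \o (fun=> 2 * e ^+ 2)) by exact: finite_measure_integrable_cst.
(* Majorant: X^2 <= 2 (X - e)_+^2 + X_-^2 + 2 e^2. *)
have I4 := integrableD measurableT (integrableD measurableT (integrableZl measurableT 2 I1) I2) I3.
apply: (le_integrable measurableT _ _ I4).
  by apply/measurable_EFinP; exact: measurable_funX.
move=> w _ /=; rewrite lee_fin ger0_norm ?sqr_ge0//; apply: le_trans (ler_norm _).
rewrite /funrneg.
have [x0|x0] := leP (X w) 0.
  have -> : Num.max (- X w) 0 = - X w by apply/max_l; rewrite oppr_ge0.
  have := sqr_ge0 (Num.max (X w - e) 0); have := sqr_ge0 e; nra.
have -> : Num.max (- X w) 0 = 0 by apply/max_r; rewrite oppr_le0 ltW.
have [x1|x1] := leP (X w) e.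
  have := sqr_ge0 (Num.max (X w - e) 0); nra.
have -> : Num.max (X w - e) 0 = X w - e by apply/max_l; lra.
have := sqr_ge0 (X w - 2 * e); nra.
Unshelve. all: by end_near. Qed.

Lemma integrable_X : P.-integrable setT (EFin \o X).
Proof.
have mX : measurable_fun setT X by [].
apply: (@integrable_bounded_by_sq _ _ _ P X square_integrable X 1) => // w.
rewrite mul1r -[X in _ + X]real_normK ?num_real//.
have := sqr_ge0 (`|X w| - 1); have := normr_ge0 (X w); nra.
Qed.

End regularly_varying_tail.

(** * Second-order expansion of the deviatile *)

Section deviatile_expansion.
Context d (T : measurableType d) (R : realType) (P : probability T R).
Variables (X : {RV P >-> R}) (gamma rho : R) (A : R -> R) (tau r : nat -> R)
  (lambda1 lambda2 : R) (a : R -> R).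
Hypotheses (gamma_gt0 : 0 < gamma) (gamma_lt : gamma < 2^-1)
  (U_2RV : second_order_RV gamma rho A (tail_quantile X)).
Hypothesis X_neg2 : ('E_P[(fun w => (((X : T -> R)^\- w) ^+ 2)%R)] < +oo)%E.
Hypotheses (tau01 : forall n, 0 < tau n < 1)
  (tau_cvg : tau n @[n --> \oo] --> (1 : R))
  (r_cvgy : r n @[n --> \oo] --> +oo)
  (r_quantile : r n * (quantile X (tau n))^-1 @[n --> \oo] --> lambda1)
  (r_aux : r n * A (1 - tau n)^-1 @[n --> \oo] --> lambda2).

Local Notation U := (tail_quantile X).
Local Notation l := (log_tail X gamma).
Hypotheses (aA : a x / A (expR x) @[x --> +oo] --> (1 : R))
  (la : second_order_aux rho l a).

Let rho0 : rho <= 0. Proof. by case: U_2RV. Qed.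
Let mU : measurable_fun (`]0, +oo[ : set R) U.
Proof. by case: U_2RV => _ []. Qed.
Let Fpos x : (0 < ccdf X x)%E.
Proof. exact: (ccdf_pos gamma_gt0 U_2RV). Qed.
Let iX2 : P.-integrable setT (EFin \o (fun w => X w ^+ 2)).
Proof. exact: (square_integrable gamma_gt0 gamma_lt U_2RV X_neg2). Qed.
Let iX : P.-integrable setT (EFin \o X).
Proof. exact: (integrable_X gamma_gt0 gamma_lt U_2RV X_neg2). Qed.

Let m := mean X.
Let e n := expectile X (tau n).
(** [s] and [t] are the logarithmic levels of expectile and quantile: [q n] is exactly U(e^(t n)),
    while U(e^(s n)) is only a lower bound of [e n]. *)
Let s n := tail_log X (e n).
Let t n := - ln (1 - tau n).
Let q n := quantile X (tau n).
Let V n := U (expR (s n)).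
Let J1 n := tail_moment X gamma 1 (s n).
Let J2 n := tail_moment X gamma 2 (s n).

Let g1 : 0 < 1 - gamma. Proof. by move: gamma_lt; lra. Qed.
Let g2 : 0 < 1 - 2 * gamma. Proof. by move: gamma_lt; lra. Qed.
Let g1r : 0 < 1 - gamma - rho. Proof. by move: gamma_lt rho0; lra. Qed.
Let g2r : 0 < 1 - 2 * gamma - rho. Proof. by move: gamma_lt rho0; lra. Qed.

Let expNt n : expR (- t n) = 1 - tau n.
Proof. by rewrite /t opprK lnK// posrE; have := tau01 n; lra. Qed.

Let expt n : expR (t n) = (1 - tau n)^-1.
Proof. by rewrite -expNt expRN invrK. Qed.

Let qE n : q n = U (expR (t n)).
Proof. by rewrite tail_quantileE expNt /q; congr quantile; ring. Qed.

Let tau_half : \forall n \near \oo, 1 / 2 < tau n < 1.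
Proof.
near=> n; have -> : tau n < 1 by have := tau01 n; lra.
by rewrite andbT; near: n; apply: (cvgr_gt 1 tau_cvg); lra.
Unshelve. all: by end_near. Qed.

Let tau0 : 1 - tau n @[n --> \oo] --> (0 : R).
Proof. by rewrite -[X in _ --> X](subrr (1 : R)); apply: cvgB; [exact: cvg_cst|]. Qed.

Let focE : \forall n \near \oo,
  (2 * tau n - 1) * excess X (e n) = (1 - tau n) * (e n - m).
Proof.
near=> n; have t12 : 1 / 2 < tau n < 1 by near: n.
by have := expectile_foc iX iX2 t12; rewrite /foc -/(e n) -/m; lra.
Unshelve. all: by end_near. Qed.

Let excess_gt0 M : 0 < excess X M.
Proof.
pose B := X @^-1` `]M + 1, +oo[%classic.
have mB : measurable B by exact: measurable_funPTI.
have iB : P.-integrable setT (EFin \o \1_B) by exact: integrable_indic.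
apply: (@lt_le_trans _ _ (\int[P]_w \1_B w)).
  rewrite /Rintegral integral_indic// setIT -lte_fin fineK ?fin_num_measure//.
  exact: Fpos (M + 1).
apply: le_Rintegral => //; first exact: (integrable_excess iX2).
move=> w _; rewrite indicE; case: (boolP (w \in B)) => [|_]; last by rewrite le_max lexx orbT.
by rewrite inE /B /= in_itv/= andbT => h; rewrite le_max; apply/orP; left; rewrite /=; lra.
Qed.

(** If e n stayed below M, its excess would be at least the positive number [excess X M], while the
    first-order condition makes it O(1 - tau n). *)
Let ey : e n @[n --> \oo] --> +oo.
Proof.
apply/cvgryPge => M; have c0 := excess_gt0 M.
set c := excess X M in c0.
have H : (1 - tau n) * (`|M| + `|m|) @[n --> \oo] --> (0 : R).
  by rewrite -[X in _ --> X](mul0r (`|M| + `|m|)); apply: cvgMl.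
have c2 : 0 < c / 2 by rewrite divr_gt0.
near=> n; rewrite leNgt; apply/negP => eM.
have h1 : (1 - tau n) * (`|M| + `|m|) < c / 2.
  by apply: (le_lt_trans (ler_norm _)); near: n; move/cvgr0Pnorm_lt : H; exact.
have h2 : 3 / 4 < tau n by near: n; apply: (cvgr_gt 1 tau_cvg); lra.
have h3 : (2 * tau n - 1) * excess X (e n) = (1 - tau n) * (e n - m) by near: n.
have h4 : c <= excess X (e n) by apply: excess_homo => //; exact: ltW.
have h5 := tau01 n.
have h6 : e n - m <= `|M| + `|m|.
  have := ler_norm M; have : - m <= `|m| by rewrite -normrN; exact: ler_norm.
  lra.
have : c / 2 <= (2 * tau n - 1) * excess X (e n) by nra.
have : (1 - tau n) * (e n - m) <= (1 - tau n) * (`|M| + `|m|) by apply: ler_wpM2l => //; lra.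
lra.
Unshelve. all: by end_near. Qed.

Let sy : s n @[n --> \oo] --> +oo.
Proof. exact: cvg_comp ey (tail_log_cvgy gamma_gt0 U_2RV). Qed.

Let ty : t n @[n --> \oo] --> +oo.
Proof.
apply/cvgryPge => M; near=> n.
rewrite -lerN2 -ler_expR expNt; near: n.
have := expR_gt0 (- M) => h; have : \forall n \near \oo, `|1 - tau n| <= expR (- M).
  by move/cvgr0Pnorm_le : tau0; exact.
by apply: filterS => n; apply: le_trans; exact: ler_norm.
Unshelve. all: by end_near. Qed.

Let rV0 : (r n)^-1 @[n --> \oo] --> (0 : R).
Proof. by apply/gtr0_cvgV0 => //; move/cvgryPgt : r_cvgy; exact. Qed.

Let a0 : a x @[x --> +oo] --> (0 : R). Proof. by case: la. Qed.
Let aN0 : \forall x \near +oo, a x != 0. Proof. by case: la. Qed.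

Let as0 : a (s n) @[n --> \oo] --> (0 : R). Proof. exact: cvg_comp sy a0. Qed.
Let asN0 : \forall n \near \oo, a (s n) != 0. Proof. exact: sy _ aN0. Qed.

Let rat : r n * a (t n) @[n --> \oo] --> lambda2.
Proof.
have AN0 : \forall x \near +oo, A (expR x) != 0.
  case: U_2RV => _ _ Asgn _ _; case: Asgn => Asgn; near=> x.
    by rewrite gt_eqF//; near: x; exact: (@cvgry_expR R) _ Asgn.
  by rewrite lt_eqF//; near: x; exact: (@cvgry_expR R) _ Asgn.
have H1 : a (t n) / A (expR (t n)) @[n --> \oo] --> (1 : R).
  exact: (@cvg_comp _ _ _ t (fun x => a x / A (expR x)) _ _ _ ty aA).
have H : r n * A (1 - tau n)^-1 * (a (t n) / A (expR (t n))) @[n --> \oo] --> lambda2.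
  by rewrite -[X in _ --> X]mulr1; exact: cvgM.
apply: (cvg_near_eq H); near=> n; rewrite -expt.
have An : A (expR (t n)) != 0 by near: n; exact: ty _ AN0.
by field.
Unshelve. all: by end_near. Qed.

Let lev : \forall n \near \oo, [/\ 0 < s n,
  forall u, 0 <= u -> 0 < U (expR (s n + u)),
  exp_law.-integrable `[0%R, +oo[ (fun u => (expR (1 * (gamma * u + (l (s n + u) - l (s n)))))%:E) &
  exp_law.-integrable `[0%R, +oo[ (fun u => (expR (2 * (gamma * u + (l (s n + u) - l (s n)))))%:E)].
Proof. exact: sy _ (level_regular gamma_lt U_2RV). Qed.

Let e_gt0 : \forall n \near \oo, 0 < e n.
Proof. by move/cvgryPgt : ey; exact. Qed.

Let V_gt0 : \forall n \near \oo, 0 < V n.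
Proof.
apply: filterS lev => n [_ Up _ _].
by have := Up 0 (lexx _); rewrite addr0.
Qed.

Let V_le : \forall n \near \oo, V n <= e n.
Proof. by apply: filterS lev => n [s0 _ _ _]; exact: tail_quantile_le_level. Qed.

Let excE : \forall n \near \oo, excess X (e n) = expR (- s n) * (V n * J1 n - e n).
Proof. by apply: filterS lev => n [s0 Up i1 i2]; exact: excess_level. Qed.

Let exc2E : \forall n \near \oo, excess2 X (e n) =
  expR (- s n) * (V n ^+ 2 * J2 n - 2 * e n * V n * J1 n + e n ^+ 2).
Proof. by apply: filterS lev => n [s0 Up i1 i2]; exact: excess2_level. Qed.

Let z n := V n / e n.

(** From V <= e < U(e^(s + v)), the gap ln e - ln V is below gamma v + l(s + v) - l(s) for each v >
    0; v is taken proportional to eps |a(s)|. *)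
Let lnz (eps : R) : 0 < eps -> \forall n \near \oo, `|ln (z n)| <= eps * `|a (s n)|.
Proof.
move=> eps0; have [_ _ lU _ _] := la.
have h1 : \forall n \near \oo, forall u : R, 0 <= u <= 1 ->
  `|l (s n + u) - l (s n) - a (s n) * box_cox rho u| <= eps / 2 * `|a (s n)|.
  have eps2 : 0 < eps / 2 by rewrite divr_gt0.
  exact: sy _ (lU 1 (eps / 2) ltr01 eps2).
near=> n.
have [s0 Up _ _] : [/\ 0 < s n,
  forall u, 0 <= u -> 0 < U (expR (s n + u)),
  exp_law.-integrable `[0%R, +oo[ (fun u => (expR (1 * (gamma * u + (l (s n + u) - l (s n)))))%:E) &
  exp_law.-integrable `[0%R, +oo[ (fun u => (expR (2 * (gamma * u + (l (s n + u) - l (s n)))))%:E)].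
  by near: n.
have en0 : 0 < e n by near: n.
have Vn0 : 0 < V n by near: n.
have Vn1 : V n <= e n by near: n.
have an : a (s n) != 0 by near: n.
have an1 : `|a (s n)| <= 1.
  by near: n; move/cvgr0Pnorm_le : as0; apply; rewrite ltr01.
have an0 : 0 < `|a (s n)| by rewrite normr_gt0.
(* The 1 beside gamma pays for a(s) h(v) <= v; the other half of eps is the uniform error on
   [0, 1]. *)
pose w := eps / 2 * `|a (s n)| / (gamma + 1).
have gg : 0 < gamma + 1 by rewrite addr_gt0.
have w_0 : 0 < w by apply: divr_gt0 => //; apply: mulr_gt0 => //; exact: divr_gt0.
pose v : R := Num.min 1 w.
have v0 : 0 < v by rewrite lt_min ltr01.
have v1 : v <= 1 by rewrite ge_min lexx.
have vw : (gamma + 1) * v <= eps / 2 * `|a (s n)|.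
  by rewrite -ler_pdivlMl// mulrC ge_min lexx orbT.
have h : `|l (s n + v) - l (s n) - a (s n) * box_cox rho v| <= eps / 2 * `|a (s n)|.
  have : forall u : R, 0 <= u <= 1 ->
    `|l (s n + u) - l (s n) - a (s n) * box_cox rho u| <= eps / 2 * `|a (s n)| by near: n.
  by apply; rewrite (ltW v0) v1.
have eV : e n < V n * tail_ratio X gamma (s n) v.
  rewrite -tail_ratioE//; last exact: Up (ltW v0).
  exact: (tail_quantile_excess Fpos s0 v0).
have lneV : ln (e n) <= ln (V n) + (gamma * v + (l (s n + v) - l (s n))).
  rewrite -[X in _ <= _ + X]expRK -lnM ?posrE ?expR_gt0// ler_ln ?posrE ?mulr_gt0 ?expR_gt0//.
  exact: ltW.
have lnVe : ln (V n) <= ln (e n) by rewrite ler_ln ?posrE.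
rewrite /z ln_div ?posrE// ler0_norm; last by lra.
have bv := box_cox_le rho0 (ltW v0); have bv0 := box_cox_ge0 rho0 (ltW v0).
have ab : a (s n) * box_cox rho v <= v.
  apply: (le_trans (ler_norm _)); rewrite normrM (ger0_norm bv0).
  by apply: (le_trans (ler_pM _ _ an1 bv)) => //; rewrite mul1r.
move: h; rewrite ler_norml => /andP[_ h].
by lra.
Unshelve. all: by end_near. Qed.

Let lnz0 : ln (z n) @[n --> \oo] --> (0 : R).
Proof.
have H : 1 * `|a (s n)| @[n --> \oo] --> (0 : R).
  rewrite -[X in _ --> X](mulr0 1); apply: cvgMr.
  by rewrite -[X in _ --> X](@normr0 R R); exact: cvg_norm as0.
exact: cvg_norm_le0 (lnz ltr01) H.
Qed.

Let z_gt0 : \forall n \near \oo, 0 < z n.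
Proof.
near=> n; rewrite /z divr_gt0//; near: n; [exact: V_gt0|exact: e_gt0].
Unshelve. all: by end_near. Qed.

Let z1 : z n @[n --> \oo] --> (1 : R).
Proof.
have H : expR (ln (z n)) @[n --> \oo] --> expR (0 : R).
  by apply: (@cvg_comp _ _ _ (fun n => ln (z n)) expR); [exact: lnz0|exact: continuous_expR].
rewrite expR0 in H; apply: (cvg_near_eq H); near=> n.
by rewrite lnK// posrE; near: n.
Unshelve. all: by end_near. Qed.

Let J1a : (J1 n - (1 - gamma)^-1) / a (s n) @[n --> \oo] --> ((1 - gamma) * (1 - gamma - rho))^-1.
Proof.
have p1 : 1 * gamma < 1 by rewrite mul1r; move: g1; lra.
have := exp_moment_second_order rho0 ltr01 p1 (measurable_log_tail gamma mU) la sy.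
by rewrite !mul1r.
Qed.

Let J2a : (J2 n - (1 - 2 * gamma)^-1) / a (s n) @[n --> \oo] -->
  2 / ((1 - 2 * gamma) * (1 - 2 * gamma - rho)).
Proof.
have p1 : 2 * gamma < 1 by move: g2; lra.
exact: (exp_moment_second_order rho0 (@ltr0n R 2) p1 (measurable_log_tail gamma mU) la sy).
Qed.

Let J1c : J1 n @[n --> \oo] --> (1 - gamma)^-1.
Proof.
have H : (J1 n - (1 - gamma)^-1) / a (s n) * a (s n) + (1 - gamma)^-1 @[n --> \oo] --> (1 - gamma)^-1.
  rewrite -[X in _ --> X]add0r -[X in _ --> X + _](mulr0 (((1 - gamma) * (1 - gamma - rho))^-1)).
  by apply: cvgD; [exact: cvgM|exact: cvg_cst].
apply: (cvg_near_eq H); near=> n; rewrite divfK ?subrK//.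
by near: n.
Unshelve. all: by end_near. Qed.

(** The limit of [u n], the logarithm of (1 - F(e)) / (1 - tau). *)
Let k := ln (gamma^-1 - 1).

Let gV1 : 1 < gamma^-1 - 1.
Proof.
have : 2 < gamma^-1 by rewrite -[2]invrK ltf_pV2 ?posrE ?invr_gt0.
lra.
Qed.

Let k_gt0 : 0 < k. Proof. exact: ln_gt0. Qed.

(** Mean excess over e, given an exceedance and relative to e; [w0] is its value for an exact Pareto
    tail. *)
Let w n := z n * J1 n - 1.
Let w0 : R := gamma / (1 - gamma).

Let w00 : 0 < w0. Proof. exact: divr_gt0. Qed.

Let lnw0 : ln w0 = - k.
Proof.
rewrite -lnV ?posrE; last by move: gV1; lra.
congr ln; rewrite /w0; field.
by rewrite !gt_eqF//; move: g1; lra.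
Qed.

Let wc : w n @[n --> \oo] --> w0.
Proof.
have -> : w0 = 1 * (1 - gamma)^-1 - 1.
  by rewrite /w0; field; rewrite gt_eqF//; move: g1; lra.
by apply: cvgB; [exact: cvgM|exact: cvg_cst].
Qed.

Let eV0 : (e n)^-1 @[n --> \oo] --> (0 : R).
Proof. by apply/gtr0_cvgV0. Qed.

Let me1 : 1 - m / e n @[n --> \oo] --> (1 : R).
Proof.
rewrite -[X in _ --> X]subr0 -[X in _ --> _ - X](mulr0 m).
by apply: cvgB; [exact: cvg_cst|exact: cvgMr].
Qed.

Let tau21 : 2 * tau n - 1 @[n --> \oo] --> (1 : R).
Proof.
rewrite -[X in _ --> X](_ : 2 * 1 - 1 = 1); last by ring.
by apply: cvgB; [exact: cvgMr|exact: cvg_cst].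
Qed.

Let w_gt0 : \forall n \near \oo, 0 < w n. Proof. exact: (cvgr_gt _ wc). Qed.
Let me_gt0 : \forall n \near \oo, 0 < 1 - m / e n. Proof. exact: (cvgr_gt _ me1). Qed.
Let tau2_gt0 : \forall n \near \oo, 0 < 2 * tau n - 1. Proof. exact: (cvgr_gt _ tau21). Qed.

Let u n := t n - s n.

Let expNs n : expR (- s n) = expR (u n) * (1 - tau n).
Proof. by rewrite -expNt -expRD /u; congr expR; ring. Qed.

(* The first-order condition, divided by e. *)
Let foc_u : \forall n \near \oo, expR (u n) * ((2 * tau n - 1) * w n) = 1 - m / e n.
Proof.
near=> n.
have en0 : 0 < e n by near: n.
have f1 : (2 * tau n - 1) * excess X (e n) = (1 - tau n) * (e n - m) by near: n.
have f2 : excess X (e n) = expR (- s n) * (V n * J1 n - e n) by near: n.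
have tn1 : 0 < 1 - tau n by rewrite -expNt expR_gt0.
have e1 : (1 - tau n) * e n != 0 by rewrite mulf_neq0 ?gt_eqF.
apply: (mulfI e1).
have -> : (1 - tau n) * e n * (1 - m / e n) = (1 - tau n) * (e n - m) by field; rewrite gt_eqF.
by rewrite -f1 f2 expNs /w /z; field; rewrite gt_eqF.
Unshelve. all: by end_near. Qed.

Let uE : \forall n \near \oo, u n = ln (1 - m / e n) - ln (2 * tau n - 1) - ln (w n).
Proof.
near=> n.
have wn0 : 0 < w n by near: n.
have tn0 : 0 < 2 * tau n - 1 by near: n.
have <- : expR (u n) * ((2 * tau n - 1) * w n) = 1 - m / e n by near: n.
rewrite !lnM ?posrE ?mulr_gt0 ?expR_gt0// expRK; ring.
Unshelve. all: by end_near. Qed.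

Let comp_cvg (h : R -> R) (x : nat -> R) (x0 : R) : {for x0, continuous h} ->
  x n @[n --> \oo] --> x0 -> h (x n) @[n --> \oo] --> h x0.
Proof. by move=> hc xc; exact: cvg_comp xc hc. Qed.

Let scale_cvg (c : R) (x : nat -> R) (x0 : R) :
  x n @[n --> \oo] --> x0 -> c * x n @[n --> \oo] --> c * x0.
Proof. exact: cvgMr. Qed.

Let sum_cvg (x y : nat -> R) (x0 y0 : R) : x n @[n --> \oo] --> x0 ->
  y n @[n --> \oo] --> y0 -> x n + y n @[n --> \oo] --> x0 + y0.
Proof. exact: cvgD. Qed.

Let uc : u n @[n --> \oo] --> k.
Proof.
have ln_cvg (x : nat -> R) (x0 : R) : 0 < x0 -> x n @[n --> \oo] --> x0 ->
    ln (x n) @[n --> \oo] --> ln x0.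
  by move=> x00; apply: comp_cvg; exact: continuous_ln.
have H : ln (1 - m / e n) - ln (2 * tau n - 1) - ln (w n) @[n --> \oo] --> k.
  have -> : k = ln 1 - ln 1 - ln w0 by rewrite lnw0 subrr sub0r opprK.
  by apply: cvgB; [apply: cvgB|]; exact: ln_cvg.
by apply: (cvg_near_eq H); apply: filterS uE => n ->.
Qed.

(** Keeps the moving shift in a fixed compact set, where the uniform versions of the second-order
    relations apply. *)
Let u_itv : \forall n \near \oo, 0 <= u n <= k + 1.
Proof.
near=> n; apply/andP; split; apply: ltW; near: n; first exact: (cvgr_gt _ uc).
by apply: (cvgr_lt _ uc); rewrite ltrDl.
Unshelve. all: by end_near. Qed.

Let k1_gt0 : 0 < k + 1. Proof. exact: addr_gt0. Qed.

Let tE n : t n = s n + u n. Proof. by rewrite /u; ring. Qed.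

Let a_ratio : a (t n) / a (s n) @[n --> \oo] --> expR (rho * k).
Proof.
have H1 : expR (rho * u n) @[n --> \oo] --> expR (rho * k).
  by apply: comp_cvg; [exact: continuous_expR|exact: scale_cvg].
have H2 : a (t n) / a (s n) - expR (rho * u n) @[n --> \oo] --> (0 : R).
  apply/cvgr0Pnorm_le => eps eps0; have [_ _ _ /(_ _ _ k1_gt0 eps0) + _] := la.
  move=> /sy; near_simpl => h.
  near=> n; rewrite tE.
  have : forall v : R, 0 <= v <= k + 1 -> `|a (s n + v) / a (s n) - expR (rho * v)| <= eps by near: n.
  by apply; near: n.
have H := sum_cvg H2 H1; rewrite add0r in H.
by apply: (cvg_near_eq H); near=> n => /=; rewrite subrK.
Unshelve. all: by end_near. Qed.

(** The hypothesis on [A] concerns the level t; the exponential factor transfers it to the level s =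
    t - u. *)
Let mu : R := lambda2 * expR (- rho * k).

Let ra : r n * a (s n) @[n --> \oo] --> mu.
Proof.
have H : r n * a (t n) / (a (t n) / a (s n)) @[n --> \oo] --> mu.
  rewrite /mu mulNr expRN; apply: cvgM => //; apply: cvgV => //.
  by rewrite gt_eqF ?expR_gt0.
apply: (cvg_near_eq H); near=> n.
have a1 : a (s n) != 0 by near: n.
have a2 : a (t n) != 0 by near: n; exact: ty _ aN0.
by field; rewrite a1.
Unshelve. all: by end_near. Qed.

Let rate_of_aux (x : nat -> R) (c : R) :
  x n / a (s n) @[n --> \oo] --> c -> r n * x n @[n --> \oo] --> mu * c.
Proof.
move=> xc; have H : r n * a (s n) * (x n / a (s n)) @[n --> \oo] --> mu * c by exact: cvgM.
apply: (cvg_near_eq H); near=> n.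
have a1 : a (s n) != 0 by near: n.
by field.
Unshelve. all: by end_near. Qed.

Let dl n := l (t n) - l (s n).

Let rdl : r n * dl n @[n --> \oo] --> mu * box_cox rho k.
Proof.
apply: rate_of_aux.
have H1 : box_cox rho (u n) @[n --> \oo] --> box_cox rho k.
  by apply: comp_cvg uc; exact: box_cox_continuous.
have H2 : dl n / a (s n) - box_cox rho (u n) @[n --> \oo] --> (0 : R).
  apply/cvgr0Pnorm_le => eps eps0; have [_ _ /(_ _ _ k1_gt0 eps0) + _ _] := la.
  move=> /sy; near_simpl => h.
  near=> n; rewrite /dl tE.
  have a1 : a (s n) != 0 by near: n.
  have -> : (l (s n + u n) - l (s n)) / a (s n) - box_cox rho (u n) =
            (l (s n + u n) - l (s n) - a (s n) * box_cox rho (u n)) / a (s n) by field.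
  rewrite normrM normfV ler_pdivrMr ?normr_gt0//.
  have : forall v : R, 0 <= v <= k + 1 ->
    `|l (s n + v) - l (s n) - a (s n) * box_cox rho v| <= eps * `|a (s n)| by near: n.
  by apply; near: n.
have H := sum_cvg H2 H1; rewrite add0r in H.
by apply: (cvg_near_eq H); near=> n => /=; rewrite subrK.
Unshelve. all: by end_near. Qed.

Let dl0 : dl n @[n --> \oo] --> (0 : R).
Proof.
have H : r n * (dl n - 0) @[n --> \oo] --> mu * box_cox rho k.
  by apply: (cvg_near_eq rdl); near=> n; rewrite subr0.
exact: (rate_cvg r_cvgy H).
Unshelve. all: by end_near.
Qed.

Let q_e : \forall n \near \oo, q n / e n = z n * expR (gamma * u n + dl n).
Proof.
near=> n.
have [s0 Up _ _] : [/\ 0 < s n,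
  forall u, 0 <= u -> 0 < U (expR (s n + u)),
  exp_law.-integrable `[0%R, +oo[ (fun u => (expR (1 * (gamma * u + (l (s n + u) - l (s n)))))%:E) &
  exp_law.-integrable `[0%R, +oo[ (fun u => (expR (2 * (gamma * u + (l (s n + u) - l (s n)))))%:E)].
  by near: n.
have /andP[u0 _] : 0 <= u n <= k + 1 by near: n.
have Vn0 : 0 < V n by near: n.
rewrite qE /dl tE /z mulrAC; congr (_ / _).
by have := @tail_ratioE _ _ _ _ X gamma (s n) (u n) Vn0 (Up _ u0).
Unshelve. all: by end_near. Qed.

Let q_e_cvg : q n / e n @[n --> \oo] --> expR (gamma * k).
Proof.
have H : z n * expR (gamma * u n + dl n) @[n --> \oo] --> expR (gamma * k).
  rewrite -[X in _ --> X]mul1r; apply: cvgM => //.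
  apply: comp_cvg; first exact: continuous_expR.
  by rewrite -[X in _ --> X]addr0; apply: sum_cvg => //; exact: scale_cvg.
by apply: (cvg_near_eq H); apply: filterS q_e => n ->.
Qed.

Let q_gt0 : \forall n \near \oo, 0 < q n.
Proof.
near=> n; have en0 : 0 < e n by near: n.
have zn0 : 0 < z n by near: n.
have : 0 < q n / e n.
  have -> : q n / e n = z n * expR (gamma * u n + dl n) by near: n.
  by rewrite mulr_gt0 ?expR_gt0.
by rewrite pmulr_lgt0 ?invr_gt0.
Unshelve. all: by end_near. Qed.

(** The exponential is the limit of q / e, which converts the rate hypothesis on 1 / q into one on 1
    / e. *)
Let nu : R := lambda1 * expR (gamma * k).

Let re : r n * (e n)^-1 @[n --> \oo] --> nu.
Proof.
have H : r n * (q n)^-1 * (q n / e n) @[n --> \oo] --> nu by exact: cvgM.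
apply: (cvg_near_eq H); near=> n.
have qn0 : 0 < q n by near: n.
have en0 : 0 < e n by near: n.
by field; rewrite !gt_eqF.
Unshelve. all: by end_near. Qed.

Let rtau : r n * (1 - tau n) @[n --> \oo] --> (0 : R).
Proof.
have H : r n * (q n)^-1 * (q n * (1 - tau n)) @[n --> \oo] --> (0 : R).
  rewrite -[X in _ --> X](mulr0 lambda1); apply: cvgM => //.
  have H : U (expR (t n)) * expR (- t n) @[n --> \oo] --> (0 : R).
    exact: (@cvg_comp _ _ _ t (fun x => U (expR x) * expR (- x)) _ _ _ ty (tail_quantile_expN_cvg0 gamma_lt U_2RV)).
  by apply: (cvg_near_eq H); near=> n; rewrite expNt -qE.
apply: (cvg_near_eq H); near=> n.
have qn0 : 0 < q n by near: n.
by field; rewrite !gt_eqF.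
Unshelve. all: by end_near. Qed.

(** The gap between U(e^s) and e is o(a(s)), hence contributes no bias. *)
Let rlnz : r n * ln (z n) @[n --> \oo] --> (0 : R).
Proof.
rewrite -[X in _ --> X](mulr0 mu); apply: rate_of_aux.
apply/cvgr0Pnorm_le => eps eps0; have h := lnz eps0.
near=> n; have a1 : a (s n) != 0 by near: n.
by rewrite normrM normfV ler_pdivrMr ?normr_gt0//; near: n.
Unshelve. all: by end_near. Qed.

Let rz : r n * (z n - 1) @[n --> \oo] --> (0 : R).
Proof.
have H0 : r n * (ln (z n) - 0) @[n --> \oo] --> (0 : R).
  by apply: (cvg_near_eq rlnz); near=> n; rewrite subr0.
have := rate_comp r_cvgy (is_derive_expR (0 : R)) H0; rewrite mulr0 expR0 => H.
apply: (cvg_near_eq H); near=> n; rewrite lnK// posrE.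
by near: n.
Unshelve. all: by end_near. Qed.

Let c1 : R := mu * ((1 - gamma) * (1 - gamma - rho))^-1.
Let c2 : R := mu * (2 / ((1 - 2 * gamma) * (1 - 2 * gamma - rho))).

Let rJ1 : r n * (J1 n - (1 - gamma)^-1) @[n --> \oo] --> c1.
Proof. exact: rate_of_aux J1a. Qed.

Let rJ2 : r n * (J2 n - (1 - 2 * gamma)^-1) @[n --> \oo] --> c2.
Proof. exact: rate_of_aux J2a. Qed.

Let rzJ1 : r n * (z n * J1 n - (1 - gamma)^-1) @[n --> \oo] --> c1.
Proof. by have := rateM r_cvgy rz rJ1; rewrite !mul1r mul0r add0r. Qed.

Let rzzJ2 : r n * (z n * z n * J2 n - (1 - 2 * gamma)^-1) @[n --> \oo] --> c2.
Proof.
by have := rateM r_cvgy (rateM r_cvgy rz rz) rJ2; rewrite !mul1r !mul0r !add0r mul0r add0r.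
Qed.

Let w0E : w0 = (1 - gamma)^-1 + -1.
Proof. by rewrite /w0; field; rewrite gt_eqF//; move: g1; lra. Qed.

Let rw : r n * (w n - w0) @[n --> \oo] --> c1.
Proof. by have := rateD rzJ1 (rate_cst r (-1)); rewrite -w0E addr0. Qed.

Let re' : r n * ((e n)^-1 - 0) @[n --> \oo] --> nu.
Proof. by apply: (cvg_near_eq re); near=> n; rewrite subr0. Unshelve. all: by end_near. Qed.

Let rme : r n * (1 - m / e n - 1) @[n --> \oo] --> - m * nu.
Proof.
have := rateD (rate_cst r 1) (rateZ (c := (- m)) re'); rewrite mulr0 addr0 add0r => H.
by apply: (cvg_near_eq H); near=> n; rewrite mulNr.
Unshelve. all: by end_near. Qed.

Let rtau2 : r n * (2 * tau n - 1 - 1) @[n --> \oo] --> (0 : R).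
Proof.
have H : -2 * (r n * (1 - tau n)) @[n --> \oo] --> (0 : R).
  by rewrite -[X in _ --> X](mulr0 (-2)); exact: scale_cvg.
by apply: (cvg_near_eq H); near=> n; ring.
Unshelve. all: by end_near. Qed.

Let ru : r n * (u n - k) @[n --> \oo] --> - m * nu - c1 / w0.
Proof.
have H1 := rate_ln r_cvgy ltr01 rme.
have H2 := rateZ (c := (-1)) (rate_ln r_cvgy ltr01 rtau2).
have H3 := rateZ (c := (-1)) (rate_ln r_cvgy w00 rw).
have := rateD (rateD H1 H2) H3.
rewrite ln1 lnw0 invr1 !mulr0 mul1r !addr0 add0r mulN1r opprK (mulrC _ c1) mulN1r => H.
apply: (cvg_near_eq H); near=> n.
rewrite !mulN1r; congr (_ * (_ - _)); symmetry; near: n; exact: uE.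
Unshelve. all: by end_near. Qed.

(** The second partial moment above e, given an exceedance and relative to e^2. *)
Let M2 n := z n * z n * J2 n - 2 * (z n * J1 n) + 1.
Let M20 : R := (1 - 2 * gamma)^-1 - 2 * (1 - gamma)^-1 + 1.

Let rM2 : r n * (M2 n - M20) @[n --> \oo] --> c2 - 2 * c1.
Proof.
have := rateD (rateD rzzJ2 (rateZ (c := (-2)) rzJ1)) (rate_cst r 1); rewrite addr0 !mulNr => H.
by apply: (cvg_near_eq H); near=> n; rewrite /M2 mulNr.
Unshelve. all: by end_near. Qed.

Let m2 := second_moment X.
(** The squared deviatile over e^2, after the first-order condition has replaced e^u (2 tau - 1) by
    (1 - m / e) / w. The term 1 - 2 m / e is split to match the limits already known. *)
Let N n := (1 - m / e n) * (M2 n / w n) + (1 - m / e n) + (- m / e n) + m2 * ((e n)^-1 * (e n)^-1).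
Let N0 : R := (1 - 2 * gamma)^-1.
Let cN : R := - m * nu * (M20 / w0) + ((c2 - 2 * c1) * w0^-1 + M20 * (- w0 ^- 2 * c1)) - 2 * m * nu.

Let rN : r n * (N n - N0) @[n --> \oo] --> cN.
Proof.
have w0N : w0 != 0 by rewrite gt_eqF.
have H1 := rateM r_cvgy rme (rateM r_cvgy rM2 (rate_inv r_cvgy w0N rw)).
have := rateD (rateD (rateD H1 rme) (rateZ (c := (- m)) re')) (rateZ (c := m2) (rateM r_cvgy re' re')).
set lim1 := (X in _ --> X -> _); have -> : lim1 = cN by rewrite /lim1 /cN; ring.
have -> : 1 * (M20 / w0) + 1 + - m * 0 + m2 * (0 * 0) = N0.
  rewrite /N0 /M20 /w0; field; do !(apply/andP; split); apply/eqP; move: g1 g2 gamma_gt0; lra.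
by [].
Qed.

Let devE : \forall n \near \oo, deviatile X (tau n) = e n * Num.sqrt (N n).
Proof.
near=> n.
have en0 : 0 < e n by near: n.
have wn0 : 0 < w n by near: n.
have H : expR (u n) * ((2 * tau n - 1) * w n) = 1 - m / e n by near: n.
have f2 : excess2 X (e n) =
  expR (- s n) * (V n ^+ 2 * J2 n - 2 * e n * V n * J1 n + e n ^+ 2) by near: n.
have tn1 : 0 < 1 - tau n by rewrite -expNt expR_gt0.
rewrite (deviatileE iX iX2) -/(e n) -/m -/m2 f2 expNs.
rewrite -[in RHS](ger0_norm (ltW en0)) -sqrtr_sqr -sqrtrM ?sqr_ge0//.
congr Num.sqrt; rewrite /N /M2 -[X in _ = _ * (X * _ + _ + _ + _)]H /z; field.
by rewrite !gt_eqF.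
Unshelve. all: by end_near. Qed.

Let N00 : 0 < N0. Proof. by rewrite invr_gt0. Qed.
Let N_gt0 : \forall n \near \oo, 0 < N n.
Proof. exact: (cvgr_gt _ (rate_cvg r_cvgy rN)). Qed.

Let L n := ln (z n) + gamma * u n + dl n - 2^-1 * ln (N n).
Let L0 : R := gamma * k - 2^-1 * ln N0.

Let q_dev : \forall n \near \oo, q n / deviatile X (tau n) = expR (L n).
Proof.
near=> n.
have en0 : 0 < e n by near: n.
have Nn0 : 0 < N n by near: n.
have zn0 : 0 < z n by near: n.
have -> : deviatile X (tau n) = e n * Num.sqrt (N n) by near: n.
rewrite invfM mulrA; have -> : q n / e n = z n * expR (gamma * u n + dl n) by near: n.
by rewrite sqrtr_expR// /L expRB -[in RHS]addrA [in RHS]expRD lnK.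
Unshelve. all: by end_near. Qed.

Let cL : R := gamma * (- m * nu - c1 / w0) + mu * box_cox rho k - 2^-1 * (N0^-1 * cN).

Let rL : r n * (L n - L0) @[n --> \oo] --> cL.
Proof.
have H0 : r n * (ln (z n) - 0) @[n --> \oo] --> (0 : R).
  by apply: (cvg_near_eq rlnz); near=> n; rewrite subr0.
have H1 : r n * (dl n - 0) @[n --> \oo] --> mu * box_cox rho k.
  by apply: (cvg_near_eq rdl); near=> n; rewrite subr0.
have := rateD (rateD (rateD H0 (rateZ (c := gamma) ru)) H1) (rateZ (c := (- 2^-1)) (rate_ln r_cvgy N00 rN)).
rewrite !add0r; set lim1 := (X in _ --> X -> _); have -> : lim1 = cL by rewrite /lim1 /cL; ring.
rewrite addr0 mulNr => H.
by apply: (cvg_near_eq H); near=> n; rewrite mulNr.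
Unshelve. all: by end_near. Qed.

Let betaE : beta_coef gamma = expR (- L0).
Proof.
rewrite /beta_coef /powR ifF; last by rewrite gt_eqF//; move: gV1; lra.
rewrite sqrtr_expR// /L0 /N0 lnV ?posrE// -expRN -expRD -/k; congr expR; ring.
Qed.

(** The [nu] terms form [xi1]. In [xi2] the last summand is - e^(-rho k) h(k), from the passage
    between the levels s and t, and the first one collects [c1] and [c2]. *)
Let cLE : cL = - (lambda1 * xi1 gamma m + lambda2 * xi2 gamma rho).
Proof.
have K0 : gamma^-1 - 1 != 0 by rewrite gt_eqF//; move: gV1; lra.
have [n1 n2 n3 n4 n5] : [/\ gamma != 0, 1 - gamma != 0, 1 - 2 * gamma != 0, 1 - gamma - rho != 0 &
  1 - 2 * gamma - rho != 0] by rewrite !gt_eqF.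
have n6 : 1 - rho - 2 * gamma != 0 by rewrite addrAC.
have n7 : 1 - rho - gamma != 0 by rewrite addrAC.
rewrite /cL /cN /nu /c1 /c2 /mu /N0 /M20 /w0 /xi1 /xi2 /box_cox /powR (negbTE K0) -/k.
case: eqP => [r0|/eqP r0].
  move: n4 n5 n6 n7; rewrite r0 oppr0 !mul0r expR0 !addr0 => *.
  field; repeat (apply/andP; split); assumption.
rewrite (mulNr rho k) expRN; set Kr := expR (rho * k); have : Kr != 0 by rewrite gt_eqF ?expR_gt0.
move=> *; field; repeat (apply/andP; split); assumption.
Qed.

Lemma deviatile_quantile_rate :
  (\forall n \near \oo, 0 < quantile X (tau n)) /\
  r n * (beta_coef gamma * quantile X (tau n) / deviatile X (tau n) - 1) @[n --> \oo] -->
    - (lambda1 * xi1 gamma (fine 'E_P[X]%E) + lambda2 * xi2 gamma rho).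
Proof.
split; first exact: q_gt0.
have -> : fine 'E_P[X]%E = m by rewrite unlock.
rewrite -cLE.
have := rateZ (c := (expR (- L0))) (rate_comp r_cvgy (is_derive_expR L0) rL).
rewrite mulrA -expRD addNr expR0 mul1r => H.
apply: (cvg_near_eq H); near=> n.
rewrite -mulrA -/(q n); have -> : q n / deviatile X (tau n) = expR (L n) by near: n.
by rewrite betaE.
Unshelve. all: by end_near. Qed.

End deviatile_expansion.

(** * Delta method *)

(** Only x is confined to the segment: it will be the linearized variable, and y the nonlinear one,
    which may leave it. *)
Lemma uniformly_continuous_segment (R : realType) (phi : R -> R) (B eps : R) :
  continuous phi -> 0 < eps -> exists2 dl : R, 0 < dl &
  forall x y : R, `|x| <= B -> `|x - y| <= dl -> `|phi x - phi y| <= eps.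
Proof.
move=> cphi eps0.
have /compact_near_coveringP cpt := @segment_compact R (- B) B.
pose Q (dl x : R) := forall y : R, `|x - y| <= dl -> `|phi x - phi y| <= eps.
have H : \forall dl \near 0^'+, `[- B, B]%classic `<=` Q dl.
  apply: cpt => x _.
  have eps2 : 0 < eps / 2 by rewrite divr_gt0.
  have : \forall z \near x, `|phi x - phi z| <= eps / 2 by move/cvgr_dist_le : (cphi x); exact.
  case/nbhs_ballP => /= r r0 xr.
  have r2 : 0 < r / 2 by rewrite divr_gt0.
  near=> x' dl => y /= x'y.
  have xx' : `|x - x'| < r / 2 by near: x'; apply/nbhs_ballP; exists (r / 2).
  have dlr : dl < r / 2 by near: dl; exact: nbhs_right_lt.
  have h1 : `|phi x - phi x'| <= eps / 2.
    by apply: xr; rewrite /ball/= (lt_trans xx')//; lra.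
  have h2 : `|phi x - phi y| <= eps / 2.
    apply: xr; rewrite /ball/=; have := ler_distD x' x y; lra.
  have : `|phi x' - phi y| <= `|phi x - phi x'| + `|phi x - phi y|.
    by rewrite (distrC (phi x)); exact: ler_distD.
  lra.
near (0 : R)^'+ => dl; exists dl => // x y xB; have : `[- B, B]%classic `<=` Q dl by near: dl.
by apply; rewrite /= in_itv/= -ler_norml.
Unshelve. all: by end_near. Qed.

Section bounded_expectation.
Context d (T : measurableType d) (R : realType) (P : probability T R).

Lemma integrable_bounded (f : T -> R) (M : R) : measurable_fun setT f ->
  (forall w, `|f w| <= M) -> P.-integrable setT (EFin \o f).
Proof.
move=> mf fM.
have i0 : P.-integrable setT (EFin \o (fun=> M : R)) by exact: finite_measure_integrable_cst.
apply: (le_integrable measurableT _ _ i0); first exact/measurable_EFinP.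
by move=> w _ /=; rewrite lee_fin (le_trans (fM w))// ler_norm.
Qed.

Lemma expectation_bounded (f : T -> R) (M : R) : measurable_fun setT f ->
  (forall w, `|f w| <= M) -> ('E_P[f] = (\int[P]_w f w)%:E)%E.
Proof. by move=> mf fM; apply: expectation_integrable; exact: integrable_bounded fM. Qed.

End bounded_expectation.

(** A continuous substitute for the indicator of large values, hence an admissible test function. *)
Definition tail_weight (R : realType) (K x : R) : R := Num.min 1 (Num.max 0 (x - K)).

Section tail_weight.
Context (R : realType).
Implicit Types K x : R.

Lemma tail_weight_continuous K : continuous (tail_weight K).
Proof.
move=> x; apply: (@continuous_min _ _ (fun=> 1) (fun x => Num.max 0 (x - K))); first exact: cvg_cst.
apply: (@continuous_max _ _ (fun=> 0) (fun x => x - K)); first exact: cvg_cst.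
by apply: cvgB; [exact: cvg_id|exact: cvg_cst].
Qed.

Lemma tail_weight_ge0 K x : 0 <= tail_weight K x.
Proof. by rewrite le_min ler01 le_max lexx. Qed.

Lemma tail_weight_le1 K x : tail_weight K x <= 1.
Proof. by rewrite ge_min lexx. Qed.

Lemma tail_weight_norm K x : `|tail_weight K x| <= 1.
Proof. by rewrite ger0_norm ?tail_weight_ge0// tail_weight_le1. Qed.

Lemma tail_weight0 K x : x <= K -> tail_weight K x = 0.
Proof. by move=> xK; rewrite /tail_weight max_l ?subr_le0// min_r. Qed.

Lemma tail_weight1 K x : K + 1 <= x -> tail_weight K x = 1.
Proof. by move=> xK; rewrite /tail_weight max_r ?min_l//; lra. Qed.

End tail_weight.

Section linearization.
Context d d' (T : measurableType d) (T' : measurableType d') (R : realType)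
  (P : probability T R) (P' : probability T' R).
Variables (a b Z : nat -> T -> R) (G H : T' -> R) (m c : R).
Hypotheses (ma : forall n, measurable_fun setT (a n)) (mb : forall n, measurable_fun setT (b n))
  (mZ : forall n, measurable_fun setT (Z n))
  (mG : measurable_fun setT G) (mH : measurable_fun setT H).
Hypothesis ab : cvg_in_distribution P P' (fun n w => (a n w, b n w)) (fun w => (G w, H w)).
Hypothesis Zab : forall K e : R, 0 < e -> \forall n \near \oo, forall w,
  `|a n w| <= K -> `|b n w| <= K -> `|Z n w - (m * a n w + b n w - c)| <= e.

Let S w := `|G w| + `|H w|.
Let mS : measurable_fun setT S.
Proof. by apply: measurable_funD; exact: measurableT_comp. Qed.

Let mchi K : measurable_fun setT (fun w => tail_weight K (S w)).
Proof.
by apply: measurableT_comp mS; apply: continuous_measurable_fun; exact: tail_weight_continuous.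
Qed.

(** Tightness of the single limit law, by dominated convergence; weak convergence then passes it on
    to the pairs (a n, b n). *)
Let tight (e : R) : 0 < e -> exists K : R, 0 <= K /\ \int[P']_w tail_weight K (S w) < e.
Proof.
move=> e0.
have := @dominated_cvg _ _ _ P' setT measurableT
  (fun (n : nat) w => (tail_weight n%:R (S w))%:E) (fun=> 0%E) (fun=> 1%E).
rewrite integral0 => /(_ _ _ _ _ _) h.
have {h} : (\int[P']_w (tail_weight n%:R (S w))%:E)%E @[n --> \oo] --> 0%E.
  apply: h => //.
  - by move=> n; exact/measurable_EFinP.
  - move=> w _; apply: cvg_near_cst; near=> n; congr EFin; apply: tail_weight0.
    by near: n; exact: nbhs_infty_ger.
  - exact: finite_measure_integrable_cst.
  - by move=> n w _; rewrite /= lee_fin tail_weight_norm.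
case/fine_cvgP => _ /cvgr0Pnorm_lt /(_ _ e0) [N _ /(_ N (leqnn N)) h].
by exists N%:R; split => //; exact: le_lt_trans (ler_norm _) h.
Unshelve. all: by end_near. Qed.

(** The linearized variables converge because phi of a linear form is a test function of the pair.
    Replacing them by [Z] costs little by uniform continuity where the pair is bounded, and at most
    2 M times the tail weight elsewhere. *)
Lemma cvg_in_distribution_linearized :
  cvg_in_distribution P P' Z (fun w => m * G w + H w - c).
Proof.
move=> phi cphi [M0 phiM0].
pose M : R := `|M0| + 1.
have M_gt0 : 0 < M by rewrite ltr_wpDl.
have phiM x : `|phi x| <= M by apply: (le_trans (phiM0 x)); rewrite (le_trans (ler_norm _))// lerDl.
have mphi (f : T -> R) : measurable_fun setT f -> measurable_fun setT (phi \o f).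
  by move=> mf; apply: measurableT_comp mf; exact: continuous_measurable_fun.
have mphi' (f : T' -> R) : measurable_fun setT f -> measurable_fun setT (phi \o f).
  by move=> mf; apply: measurableT_comp mf; exact: continuous_measurable_fun.
pose L n w := m * a n w + b n w - c.
pose L' w := m * G w + H w - c.
have mL n : measurable_fun setT (L n).
  by apply: measurable_funB => //; apply: measurable_funD => //; exact: measurable_funM.
have mL' : measurable_fun setT L'.
  by apply: measurable_funB => //; apply: measurable_funD => //; exact: measurable_funM.
have EL : \int[P]_w phi (L n w) @[n --> \oo] --> \int[P']_w phi (L' w).
  pose f (x : R * R) := phi (m * x.1 + x.2 - c).
  have cf : continuous f.
    move=> x; apply: (@continuous_comp _ _ _ (fun x : R * R => m * x.1 + x.2 - c) phi); last exact: cphi.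
    apply: cvgB; last exact: cvg_cst.
    by apply: cvgD; [apply: cvgMr; exact: cvg_fst|exact: cvg_snd].
  have := ab cf (ex_intro _ M (fun x => phiM _)).
  have -> : ('E_P'[f \o (fun w => (G w, H w))] = (\int[P']_w phi (L' w))%:E)%E.
    by apply: (@expectation_bounded _ _ _ _ _ M) => [|w]; [exact: (mphi' L')|exact: phiM].
  case/fine_cvgP => _ h; apply: (cvg_near_eq h); near=> n => /=.
  by rewrite (@expectation_bounded _ _ _ _ _ M)//; [exact: (mphi (L n))|move=> w; exact: phiM].
have mW K n : measurable_fun setT (fun w => tail_weight K (`|a n w| + `|b n w|)).
  apply: (@measurableT_comp _ _ _ _ _ _ (tail_weight K) _ (fun w => `|a n w| + `|b n w|)).
    by apply: continuous_measurable_fun; exact: tail_weight_continuous.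
  by apply: measurable_funD; exact: measurableT_comp.
have EW K : \int[P]_w tail_weight K (`|a n w| + `|b n w|) @[n --> \oo] --> \int[P']_w tail_weight K (S w).
  pose f (x : R * R) := tail_weight K (`|x.1| + `|x.2|).
  have cf : continuous f.
    move=> x; apply: (@continuous_comp _ _ _ (fun x : R * R => `|x.1| + `|x.2|) (tail_weight K)).
      by apply: cvgD; apply: cvg_norm; [exact: cvg_fst|exact: cvg_snd].
    exact: tail_weight_continuous.
  have f1 : exists M1 : R, forall v, `|f v| <= M1 by exists 1 => v; exact: tail_weight_norm.
  have := ab cf f1.
  have -> : ('E_P'[f \o (fun w => (G w, H w))] = (\int[P']_w tail_weight K (S w))%:E)%E.
    by apply: (@expectation_bounded _ _ _ _ _ 1) => [|w]; [exact: mchi|exact: tail_weight_norm].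
  case/fine_cvgP => _ h; apply: (cvg_near_eq h); near=> n => /=.
  rewrite (@expectation_bounded _ _ _ _ _ 1)//; last by move=> w; exact: tail_weight_norm.
  exact: mW.
have EZ : \int[P]_w phi (Z n w) - \int[P]_w phi (L n w) @[n --> \oo] --> (0 : R).
  apply/cvgr0Pnorm_le => e e0.
  (* One share for the bounded region and 2 M shares for the tail. *)
  have e1 : 0 < e / (1 + 2 * M) by rewrite divr_gt0//; lra.
  have [K [K0 EK]] := tight e1.
  (* This radius bounds the linear form as soon as |a| + |b| <= K + 1. *)
  have [dl dl0 phi_dl] := uniformly_continuous_segment ((`|m| + 1) * (K + 1) + `|c|) cphi e1.
  near=> n.
  have EKn : \int[P]_w tail_weight K (`|a n w| + `|b n w|) < e / (1 + 2 * M).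
    by near: n; exact: (cvgr_lt _ (EW K)).
  have Zn : forall w, `|a n w| <= K + 1 -> `|b n w| <= K + 1 -> `|Z n w - L n w| <= dl.
    by near: n; exact: Zab.
  have iW : P.-integrable setT (EFin \o (fun w => tail_weight K (`|a n w| + `|b n w|))).
    by apply: (@integrable_bounded _ _ _ _ _ 1) => // w; exact: tail_weight_norm.
  have iZ : P.-integrable setT (EFin \o (fun w => phi (Z n w))).
    by apply: (@integrable_bounded _ _ _ _ _ M) => [|w]; [exact: (mphi (Z n))|exact: phiM].
  have iL : P.-integrable setT (EFin \o (fun w => phi (L n w))).
    by apply: (@integrable_bounded _ _ _ _ _ M) => [|w]; [exact: (mphi (L n))|exact: phiM].
  have iB : P.-integrable setT (EFin \o (fun w => phi (Z n w) - phi (L n w))).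
    exact: (integrableB measurableT iZ iL).
  have iC : P.-integrable setT (EFin \o (fun w => 2 * M * tail_weight K (`|a n w| + `|b n w|))).
    exact: (integrableZl measurableT (2 * M) iW).
  have i1 : P.-integrable setT (EFin \o (fun=> e / (1 + 2 * M) : R)).
    exact: finite_measure_integrable_cst.
  have iD : P.-integrable setT (EFin \o (fun w => e / (1 + 2 * M) + 2 * M * tail_weight K (`|a n w| + `|b n w|))).
    exact: (integrableD measurableT i1 iC).
  rewrite -RintegralB//; apply: (le_trans (le_normr_Rintegral measurableT iB)).
  have : \int[P]_w `|phi (Z n w) - phi (L n w)| <=
    \int[P]_w (e / (1 + 2 * M) + 2 * M * tail_weight K (`|a n w| + `|b n w|)).
    apply: le_Rintegral => //; first exact: (integrable_norm iB).
    move=> w _.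
    have W0 : 0 <= 2 * M * tail_weight K (`|a n w| + `|b n w|).
      by rewrite mulr_ge0 ?tail_weight_ge0//; lra.
    have [abK|abK] := leP (`|a n w| + `|b n w|) (K + 1).
      have a1 : `|a n w| <= K + 1 by have := normr_ge0 (b n w); lra.
      have b1 : `|b n w| <= K + 1 by have := normr_ge0 (a n w); lra.
      suff : `|phi (Z n w) - phi (L n w)| <= e / (1 + 2 * M) by lra.
      rewrite distrC; apply: phi_dl; last by rewrite distrC; exact: Zn.
      rewrite /L; apply: (le_trans (ler_normB _ _)); rewrite lerD2r.
      apply: (le_trans (ler_normD _ _)); rewrite normrM.
      have := ler_wpM2l (normr_ge0 m) a1; lra.
    rewrite tail_weight1; last exact: ltW.
    have := ler_normB (phi (Z n w)) (phi (L n w)); have := phiM (Z n w); have := phiM (L n w); lra.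
  have -> : \int[P]_w (e / (1 + 2 * M) + 2 * M * tail_weight K (`|a n w| + `|b n w|)) =
    e / (1 + 2 * M) + 2 * M * \int[P]_w tail_weight K (`|a n w| + `|b n w|).
    rewrite RintegralD// RintegralZl//; congr (_ + _).
    by rewrite /Rintegral integral_cst//= probability_setT mule1.
  move=> /le_trans; apply.
  have M1 : e / (1 + 2 * M) * (1 + 2 * M) = e by rewrite divfK//; apply/eqP; lra.
  move: M1 EKn; set e' := e / _; set I := Rintegral _ _ _ => M1 EKn.
  have M20 : 0 <= 2 * M by lra.
  have := ler_wpM2l M20 (ltW EKn); lra.
have -> : ('E_P'[phi \o L'] = (\int[P']_w phi (L' w))%:E)%E.
  by apply: (@expectation_bounded _ _ _ _ _ M) => [|w]; [exact: (mphi' L')|exact: phiM].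
have EZL : \int[P]_w phi (Z n w) @[n --> \oo] --> \int[P']_w phi (L' w).
  have h : \int[P]_w phi (Z n w) - \int[P]_w phi (L n w) + \int[P]_w phi (L n w) @[n --> \oo] -->
    \int[P']_w phi (L' w) by rewrite -[X in _ --> X]add0r; exact: cvgD.
  by apply: (cvg_near_eq h); near=> n => /=; rewrite subrK.
have -> : (fun n => 'E_P[phi \o Z n]%E) = (fun n => (\int[P]_w phi (Z n w))%:E).
  apply/funext => n.
  by rewrite (@expectation_bounded _ _ _ _ _ M)//; [exact: (mphi (Z n))|move=> w; exact: phiM].
by apply: cvg_EFin => //; exact: nearW.
Unshelve. all: by end_near. Qed.

End linearization.

(** * Measurability of the estimators *)

Section order_statistics.

Lemma lt_nth_sorted (R : realDomainType) (s : seq R) (j : nat) (y : R) :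
  sorted <=%O s -> (j < size s)%N -> (y < nth 0 s j) = (count (fun x => (x <= y)%R) s <= j)%N.
Proof.
elim: s j => [|x s IHs] // j /= xs; rewrite ltnS => js.
have ss := path_sorted xs.
have [xy|yx] := leP x y.
  case: j js => [|j] js /=; first by rewrite addnC addn1 ltn0 ltNge xy.
  by rewrite add1n ltnS IHs.
have sy : count (fun z => z <= y) s = 0%N.
  apply/eqP; rewrite -leqn0 leqNgt -has_count; apply/hasPn => z zs.
  rewrite -ltNge (lt_le_trans yx)//.
  by move: xs; rewrite (path_sortedE le_trans) => /andP[/allP/(_ z zs)].
rewrite sy add0n leq0n; case: j js => [|j] js //=.
by rewrite IHs// sy.
Qed.

Context d (T : measurableType d) (R : realType) (P : probability T R).
Variable X : nat -> {RV P >-> R}.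

(** An order statistic exceeds y exactly when few enough sample points are at most y, and their
    number is a sum of measurable indicators. *)
Lemma measurable_order_stat (k n : nat) : measurable_fun setT (order_stat X k n).
Proof.
(* An index outside the sample makes [nth] return its default 0, a constant function. *)
have [kn|nk] := ltnP k.-1 n; last first.
  rewrite (_ : order_stat X k n = fun=> 0); first exact: measurable_cst.
  by apply/funext => w; rewrite /order_stat nth_default// size_sort size_map size_iota.
apply: (measurability _ (RGenOInfty.measurableE R)) => _ [_ [y ->] <-]; rewrite setTI.
pose c w : R := \sum_(i <- iota 1 n) (X i w <= y)%R%:R.
have mc : measurable_fun setT c.
  apply: measurable_sum => i; apply: measurableT_comp => //.
  exact: measurable_fun_ler.
have cE w : c w = (count (fun i => (X i w <= y)%R) (iota 1 n))%:R.
  have -> : count (fun i => (X i w <= y)%R) (iota 1 n) = (\sum_(i <- iota 1 n) (X i w <= y)%R)%N.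
    by rewrite -sum1_count big_mkcond; apply: eq_bigr => i _; case: (X i w <= y)%R.
  by rewrite /c natr_sum.
have -> : order_stat X k n @^-1` `]y, +oo[%classic = [set w | c w <= k.-1%:R].
  apply/seteqP; split => w /=; rewrite in_itv/= andbT /order_stat lt_nth_sorted ?sort_le_sorted ?size_sort ?size_map ?size_iota//;
   by rewrite (permP (permEl (perm_sort _ _))) count_map cE ler_nat.
have -> : [set w | c w <= k.-1%:R] = c @^-1` `]-oo, k.-1%:R]%classic.
  by apply/seteqP; split => w; rewrite /= in_itv.
by rewrite -[X in measurable X]setTI; apply: mc.
Qed.

End order_statistics.

Section beta_measurable.
Context (R : realType).

(** Inversion is discontinuous at 0, where it takes the value 0; a split by sign expresses it
    through [expR] and [ln]. *)
Lemma measurable_inv : measurable_fun setT (fun x : R => x^-1).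
Proof.
have -> : (fun x : R => x^-1) =
    (fun x : R => if 0 < x then expR (- ln x) else if x < 0 then - expR (- ln (- x)) else 0).
  apply/funext => x; case: ltgtP => x0; last by rewrite -x0 invr0.
    by rewrite expRN lnK.
  by rewrite expRN lnK ?posrE ?oppr_gt0// invrN opprK.
have mN : measurable_fun setT (fun x : R => - x) by exact: measurable_funN.
have mlnN : measurable_fun setT (fun x : R => ln (- x)) by exact: (measurableT_comp (@measurable_ln R) mN).
apply: measurable_fun_ifT; first exact: measurable_fun_ltr.
  by apply: measurableT_comp => //; apply: measurable_funN; exact: measurable_ln.
apply: measurable_fun_ifT => //; first exact: measurable_fun_ltr.
by apply: measurable_funN; apply: measurableT_comp => //; apply: measurable_funN.
Qed.

Lemma measurable_sqrt : measurable_fun setT (@Num.sqrt R).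
Proof.
have -> : @Num.sqrt R = (fun x : R => if 0 < x then expR (2^-1 * ln x) else 0).
  apply/funext => x; case: ltP => x0; last by rewrite ler0_sqrtr.
  exact: sqrtr_expR.
apply: measurable_fun_ifT => //; first exact: measurable_fun_ltr.
by apply: measurableT_comp => //; apply: measurable_funM => //; exact: measurable_ln.
Qed.

Lemma measurable_beta_coef : measurable_fun setT (@beta_coef R).
Proof.
have m1 : measurable_fun setT (fun x : R => x^-1 - 1).
  by apply: measurable_funB => //; exact: measurable_inv.
have meq : measurable_fun setT (fun t : R => - t == 0).
  by apply: measurable_fun_eqr => //; exact: measurable_funN.
apply: measurable_funM.
  (* [powR] is defined by cases on whether its base vanishes. *)
  apply: measurable_fun_ifT.
  - exact: measurable_fun_eqr.
  - by apply: (measurableT_comp (f := fun b : bool => b%:R : R)).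
  - apply: measurableT_comp => //; apply: measurable_funM; first exact: measurable_funN.
    exact: (measurableT_comp (@measurable_ln R) m1).
apply: (measurableT_comp measurable_inv); apply: (measurableT_comp measurable_sqrt).
by apply: measurable_funB => //; exact: measurable_funM.
Qed.

End beta_measurable.

(** * Expansion of the coefficient beta and of the product of relative errors *)

Section delta_method.
Context (R : realType).
Implicit Types gamma g : R.

Let log_beta g : R := - g * (ln (1 - g) - ln g) - 2^-1 * ln (1 - 2 * g).

Let beta_expR g : 0 < g < 2^-1 -> beta_coef g = expR (log_beta g).
Proof.
move=> /andP[g0 g2].
have h1 : 0 < 1 - g by lra.
have h2 : 0 < 1 - 2 * g by lra.
have E : g^-1 - 1 = (1 - g) / g by field; rewrite gt_eqF.
rewrite /beta_coef /powR E ifF; last by rewrite gt_eqF ?divr_gt0.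
by rewrite sqrtr_expR// ln_div ?posrE// -expRN -expRD.
Qed.

Lemma beta_coef_gt0 gamma : 0 < gamma -> gamma < 2^-1 -> 0 < beta_coef gamma.
Proof. by move=> g0 g2; rewrite beta_expR ?g0// expR_gt0. Qed.

(** Origin of m(gamma): it is the logarithmic derivative of beta. *)
Let is_derive_log_beta gamma : 0 < gamma -> gamma < 2^-1 ->
  is_derive gamma 1 log_beta (m_coef gamma).
Proof.
move=> g0 g2.
have h1 : 0 < 1 - gamma by lra.
have h2 : 0 < 1 - 2 * gamma by lra.
have lnD (c : R) : 0 < 1 - c * gamma ->
    is_derive gamma 1 (fun g : R => ln (1 - c * g)) (- c / (1 - c * gamma)).
  move=> h; have d : is_derive gamma 1 (fun g : R => 1 - c * g) (- c).
    have := is_deriveB (is_derive_cst (1 : R) gamma 1) (is_deriveZ c (is_derive_id gamma 1)).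
    by rewrite sub0r /GRing.scale/= mulr1.
  by rewrite mulrC; exact: (@is_derive1_comp R (@ln R) (fun g => 1 - c * g) gamma _ _ (is_derive1_ln h) d).
have d1 : is_derive gamma 1 (fun g : R => ln (1 - g)) (- (1 - gamma)^-1).
  have := lnD 1; rewrite mul1r mulN1r => /(_ h1).
  by under eq_fun do rewrite mul1r.
have d4 := is_derive1_ln g0.
have d5 := is_deriveB (is_deriveM (is_deriveN (is_derive_id gamma 1)) (is_deriveB d1 d4))
  (is_deriveZ 2^-1 (lnD 2 h2)).
have -> : m_coef gamma = - gamma *: (- (1 - gamma)^-1 - gamma^-1)
  + (ln (1 - gamma) - ln gamma) *: - 1 - 2^-1 *: (- 2 / (1 - 2 * gamma)).
  rewrite /GRing.scale/= /m_coef -ln_div ?posrE//.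
  have -> : gamma^-1 - 1 = (1 - gamma) / gamma by field; rewrite gt_eqF.
  by field; rewrite !gt_eqF.
exact: d5.
Qed.

(** Local in h, since the exponential form of beta needs gamma + h strictly between 0 and 1/2. *)
Lemma beta_coef_expansion gamma : 0 < gamma -> gamma < 2^-1 ->
  exists psi : R -> R, psi h @[h --> (0 : R)] --> (0 : R) /\
    \forall h \near (0 : R), beta_coef (gamma + h) = beta_coef gamma * (1 + h * (m_coef gamma + psi h)).
Proof.
move=> g0 g2.
have d := is_derive1_comp (is_derive_expR (log_beta gamma)) (is_derive_log_beta g0 g2).
have [psi [psi0 psiE]] := derive_remainder d.
have b0 := beta_coef_gt0 g0 g2; have bE : beta_coef gamma = expR (log_beta gamma) by rewrite beta_expR ?g0.
have near0 (e : R) : 0 < e -> \forall h \near (0 : R), `|h| < e.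
  by move=> e0; apply/nbhs_ballP; exists e => // h; rewrite /ball/= sub0r normrN.
exists (fun h => psi h / beta_coef gamma); split.
  by rewrite -[X in _ --> X](mul0r (beta_coef gamma)^-1); apply: cvgMl.
near=> h; have ghP : 0 < gamma + h < 2^-1.
  have h1 : `|h| < gamma.
    by near: h; exact: near0.
  have h2 : `|h| < 2^-1 - gamma.
    by near: h; apply: near0; lra.
  by move: h1 h2; rewrite !ltr_norml => /andP[? ?] /andP[? ?]; lra.
rewrite beta_expR// -[LHS]/((expR \o log_beta) (gamma + h)) psiE /= -bE; field.
by rewrite gt_eqF.
Unshelve. all: by end_near. Qed.

(** Three relative errors of order 1 / r are multiplied: their sum survives the scaling by r, and
    the cross terms are O(1 / r) uniformly on bounded a and b. *)
Lemma product_expansion (r D : nat -> R) (psi : R -> R) (m c : R) :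
  r n @[n --> \oo] --> +oo -> r n * D n @[n --> \oo] --> - c -> psi h @[h --> (0 : R)] --> (0 : R) ->
  forall K e : R, 0 < e -> \forall n \near \oo, forall a b : R, `|a| <= K -> `|b| <= K ->
  `|r n * ((1 + a / r n * (m + psi (a / r n))) * (1 + b / r n) * (1 + D n) - 1) - (m * a + b - c)| <= e.
Proof.
move=> ry rD psi0 K e e0.
have [K0|K0] := ltP K 0.
  by apply: nearW => n a b aK; have := normr_ge0 a; lra.
(* K shares bound a psi and one share bounds r D + c, together e / 2; the cross terms get the other
   half. *)
have e1 : 0 < e / (2 * (K + 1)) by rewrite divr_gt0//; lra.
have C1 : 0 <= K * (`|m| + 1) by rewrite mulr_ge0// addr_ge0.
(* A common bound for the three scaled errors, so that three pairwise products and one triple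
   product give 3 C^2 + C^3. *)
pose C : R := K * (`|m| + 1) + K + `|c| + 1.
have rV0 : (r n)^-1 @[n --> \oo] --> (0 : R).
  by apply/gtr0_cvgV0 => //; move/cvgryPgt : ry; exact.
have cC : `|c| < C by have := normr_ge0 c; rewrite /C; lra.
have rDN : `|r n * D n| @[n --> \oo] --> `|c| by rewrite -normrN; exact: cvg_norm.
have h0 : (3 * C ^+ 2 + C ^+ 3) * (r n)^-1 @[n --> \oo] --> (0 : R).
  by rewrite -[X in _ --> X](mulr0 (3 * C ^+ 2 + C ^+ 3)); apply: cvgMr.
have e12 : 0 < Num.min 1 (e / (2 * (K + 1))) by rewrite lt_min ltr01.
have /nbhs_ballP[dl /= dl0 psi_dl] : \forall h \near (0 : R), `|psi h| <= Num.min 1 (e / (2 * (K + 1))).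
  by move/cvgr0Pnorm_le : psi0; exact.
have h1 : K * (r n)^-1 @[n --> \oo] --> (0 : R).
  by rewrite -[X in _ --> X](mulr0 K); apply: cvgMr.
near=> n => a b aK bK.
have r1 : 1 <= r n by near: n; move/cvgryPge : ry; exact.
have r0 : 0 < r n by lra.
have rD1 : `|r n * D n| <= C by apply: ltW; near: n; exact: (cvgr_lt _ rDN).
have rD2 : `|r n * D n - - c| <= e / (2 * (K + 1)).
  by rewrite distrC; near: n; move/cvgr_dist_le : rD; exact.
have small : (3 * C ^+ 2 + C ^+ 3) * (r n)^-1 <= e / 2 by near: n; apply: (cvgr_le _ h0); lra.
have ps : `|psi (a / r n)| <= Num.min 1 (e / (2 * (K + 1))).
  apply: psi_dl; rewrite /ball/= sub0r normrN normrM normfV (gtr0_norm r0).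
  apply: (@le_lt_trans _ _ (K * (r n)^-1)); first by rewrite ler_wpM2r// invr_ge0 ltW.
  by near: n; exact: (cvgr_lt _ h1).
move: ps; rewrite le_min => /andP[ps1 ps2].
pose p := psi (a / r n); pose A := a * (m + p); pose D' := r n * D n.
have AC : `|A| <= C.
  rewrite /A normrM; apply: (@le_trans _ _ (K * (`|m| + 1))); last by rewrite /C; have := normr_ge0 c; lra.
  by apply: ler_pM => //; apply: (le_trans (ler_normD _ _)); rewrite lerD2l.
have bC : `|b| <= C by rewrite /C; have := normr_ge0 c; lra.
have -> : r n * ((1 + a / r n * (m + psi (a / r n))) * (1 + b / r n) * (1 + D n) - 1) - (m * a + b - c) =
  a * p + (D' + c) + ((A * b + A * D' + b * D') + A * b * D' / r n) / r n.
  by rewrite /A /D' /p; field; rewrite gt_eqF.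
have t1 : `|a * p| <= K * (e / (2 * (K + 1))) by rewrite normrM; apply: ler_pM.
have t2 : `|D' + c| <= e / (2 * (K + 1)) by move: rD2; rewrite opprK.
have C0 : 0 <= C by apply: le_trans bC.
have p2 (x y : R) : `|x| <= C -> `|y| <= C -> `|x * y| <= C ^+ 2.
  by move=> xC yC; rewrite normrM expr2; apply: ler_pM.
have t3 : `|A * b * D' / r n| <= C ^+ 3.
  rewrite normrM normfV (gtr0_norm r0) ler_pdivrMr// -[leLHS]mulr1.
  apply: ler_pM => //; rewrite normrM exprSr; apply: ler_pM => //; exact: p2.
have t4 : `|((A * b + A * D' + b * D') + A * b * D' / r n) / r n| <= e / 2.
  rewrite normrM normfV (gtr0_norm r0); apply: le_trans small.
  rewrite ler_wpM2r ?invr_ge0 ?(ltW r0)//.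
  apply: (le_trans (ler_normD _ _)); apply: lerD => //.
  apply: (le_trans (ler_normD _ _)).
  have := ler_normD (A * b) (A * D'); have := p2 _ _ AC bC; have := p2 _ _ AC rD1; have := p2 _ _ bC rD1.
  rewrite -/D'; lra.
have t5 : K * (e / (2 * (K + 1))) + e / (2 * (K + 1)) = e / 2 by field; apply/eqP; lra.
apply: (le_trans (ler_normD _ _)); have := ler_normD (a * p) (D' + c); lra.
Unshelve. all: by end_near. Qed.

End delta_method.

Unset Implicit Arguments.

(* X 0 is the generic variable X; X 1, X 2, ... is the sample.
   g n computes the estimator of gamma from X 1, ..., X n. *)
Theorem theorem3 (R : realType)
  (d : measure_display) (T : measurableType d) (P : probability T R)
  (d' : measure_display) (T' : measurableType d') (P' : probability T' R)
  (X : nat -> {RV P >-> R})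
  (gamma rho : R) (A : R -> R) (tau : nat -> R)
  (g : forall n : nat, n.-tuple R -> R)
  (Gamma Theta : {RV P' >-> R}) (lambda1 lambda2 : R)
  (X_iid : iid X)
  (X_neg2 : ('E_P[(fun w => (((X 0%N : T -> R)^\- w) ^+ 2)%R)] < +oo)%E)
  (gamma_gt0 : 0 < gamma) (gamma_lt : gamma < 2^-1) (rho_le0 : rho <= 0)
  (U_2RV : second_order_RV gamma rho A (tail_quantile (X 0%N)))
  (tau01 : forall n, 0 < tau n < 1)
  (tau_cvg : tau n @[n --> \oo] --> (1 : R))
  (ntau_cvg : n%:R * (1 - tau n) @[n --> \oo] --> +oo)
  (g_meas : forall n, measurable_fun [set: n.-tuple R] (g n)) :
  let gamma_hat n (w : T) := g n [tuple X i.+1 w | i < n] in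
  let rate n := Num.sqrt (n%:R * (1 - tau n)) in
  cvg_in_distribution P P'
    (fun n w => (rate n * (gamma_hat n w - gamma),
                 rate n * (quantile_estimator X (tau n) n w
                           / quantile (X 0%N) (tau n) - 1)))
    (fun w => (Gamma w, Theta w)) ->
  rate n * (quantile (X 0%N) (tau n))^-1 @[n --> \oo] --> lambda1 ->
  rate n * A (1 - tau n)^-1 @[n --> \oo] --> lambda2 ->
  cvg_in_distribution P P'
    (fun n w => rate n * (deviatile_estimator X (gamma_hat n w) (tau n) n w
                          / deviatile (X 0%N) (tau n) - 1))
    (fun w => m_coef gamma * Gamma w + Theta w
              - (lambda1 * xi1 gamma (fine 'E_P[X 0%N]%E)
                 + lambda2 * xi2 gamma rho)).
Proof.
move=> gamma_hat rate ab r_quantile r_aux.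
have tau1 n : 0 < 1 - tau n by have := tau01 n; lra.
have ry : rate n @[n --> \oo] --> +oo.
  apply/cvgryPge => M; near=> n.
  have h : `|M| ^+ 2 <= n%:R * (1 - tau n) by near: n; move/cvgryPge : ntau_cvg; exact.
  by apply: (le_trans (ler_norm M)); rewrite -[leLHS]ger0_norm// -sqrtr_sqr ler_wsqrtr.
have [a aA la] := log_tail_aux U_2RV.
have [q_gt0 rD] := deviatile_quantile_rate gamma_gt0 gamma_lt U_2RV X_neg2 tau01 tau_cvg ry r_quantile r_aux aA la.
set c := lambda1 * _ + _ in rD *.
have [psi [psi0 psiE]] := beta_coef_expansion gamma_gt0 gamma_lt.
have b0 := beta_coef_gt0 gamma_gt0 gamma_lt.
have mhat n : measurable_fun setT (gamma_hat n).
  apply: (measurableT_comp (g_meas n)); apply/measurable_fun_tnthP => i.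
  rewrite (_ : _ \o _ = X i.+1 :> (T -> R)); first exact: measurable_funPT.
  by apply/funext => w /=; rewrite tnth_mktuple.
have mq n : measurable_fun setT (quantile_estimator X (tau n) n) by exact: measurable_order_stat.
apply: (cvg_in_distribution_linearized _ _ _ _ _ ab) => //.
- by move=> n; apply: measurable_funM => //; apply: measurable_funB.
- by move=> n; apply: measurable_funM => //; apply: measurable_funB => //; apply: measurable_funM.
- move=> n; apply: measurable_funM => //; apply: measurable_funB => //; apply: measurable_funM => //.
  by apply: measurable_funM => //; exact: (measurableT_comp (@measurable_beta_coef R) (mhat n)).
move=> K e e0.
have H := product_expansion (m_coef gamma) ry rD psi0 K e0.
(* On the bounded set the error of the estimator of gamma is at most K / [rate n], eventually below
   [dl], so the local expansion of beta applies to every such sample. *)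
have [dl /= dl0 psi_dl] : exists2 dl : R, 0 < dl & forall h : R, `|h| < dl ->
    beta_coef (gamma + h) = beta_coef gamma * (1 + h * (m_coef gamma + psi h)).
  by move: psiE => /nbhs_ballP[dl /= dl0 h]; exists dl => // h' h'dl; apply: h; rewrite /ball/= sub0r normrN.
have h1 : K / rate n @[n --> \oo] --> (0 : R).
  rewrite -[X in _ --> X](mulr0 K); apply: cvgMr.
  by apply/gtr0_cvgV0 => //; move/cvgryPgt : ry; exact.
near=> n => w aK bK.
have r0 : 0 < rate n by near: n; move/cvgryPgt : ry; exact.
have qn : 0 < quantile (X 0%N) (tau n) by near: n.
pose al := rate n * (gamma_hat n w - gamma).
pose be := rate n * (quantile_estimator X (tau n) n w / quantile (X 0%N) (tau n) - 1).
have Hn : forall a b : R, `|a| <= K -> `|b| <= K ->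
  `|rate n * ((1 + a / rate n * (m_coef gamma + psi (a / rate n))) * (1 + b / rate n) *
    (1 + (beta_coef gamma * quantile (X 0%N) (tau n) / deviatile (X 0%N) (tau n) - 1)) - 1) -
    (m_coef gamma * a + b - c)| <= e by near: n.
have := Hn al be aK bK.
(* Exact factorization of the ratio: estimated beta over beta, times estimated quantile over q,
   times the deterministic beta q / dev. *)
suff -> : (1 + al / rate n * (m_coef gamma + psi (al / rate n))) * (1 + be / rate n) *
  (1 + (beta_coef gamma * quantile (X 0%N) (tau n) / deviatile (X 0%N) (tau n) - 1)) =
  deviatile_estimator X (gamma_hat n w) (tau n) n w / deviatile (X 0%N) (tau n) by [].
have alr : `|al / rate n| < dl.
  rewrite normrM normfV (gtr0_norm r0).
  apply: (@le_lt_trans _ _ (K / rate n)); first by rewrite ler_wpM2r// invr_ge0 ltW.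
  by near: n; exact: (cvgr_lt _ h1).
have ge : gamma_hat n w = gamma + al / rate n by rewrite /al; field; rewrite gt_eqF.
rewrite /deviatile_estimator ge psi_dl// /be; set dv := (deviatile _ _)^-1.
by field; rewrite !gt_eqF.
Unshelve. all: by end_near. Qed.
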